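(* Let $n\ge2$ and assume that the system $\dot X=\sum_{k=1}^m u_kH_kX$, $X(0)=I$, with $H_1,\dots,H_m\in\mathfrak{su}(n)$, is regular. Given $X_\infty\in\mathrm{SU}(n)$, $T>0$ and feedback gains $f_k^2>0$ ($f_k\in\mathbb{R}$, $1\le k\le m$), consider $X_r^T:\mathbb{R}\to\mathrm{SU}(n)$ and $u_k^T:\mathbb{R}\to\mathbb{R}$, $1\le k\le m$, as in the definition of regularity, and define $X_r=X_r^TX_\infty$. Then there exist continuous open-loop controls $u_k:\mathbb{R}_+\to\mathbb{R}$, $1\le k\le m$, such that the corresponding solution $X:\mathbb{R}_+\to\mathrm{SU}(n)$ of $\dot X=\sum_{k=1}^m u_k(t)H_kX$, $X(0)=I$, satisfies $$\lim_{t\to\infty}[X(t)-X_r(t)]=0. \qquad ( * )$$ More precisely: (a) If $V(X_\infty)>\delta$, then the smooth open-loop controls $$u_k(t)=u_k^T(t)-f_k^2\,V\big(X^\dagger(t)H_kX_r(t)\big),\qquad t\in\mathbb{R}_+,\ 1\le k\le m,$$ where $X$ is the solution of the closed-loop equation $\dot X=\sum_{k=1}^m\big(u_k^T(t)-f_k^2V(X^\dagger H_kX_r(t))\big)H_kX$, $X(0)=I$, assure that $( * )$ holds. (b) If $V(X_\infty)\le\delta$, then by following Algorithm 1 (described in the context) one determines continuous functions $v_k:\mathbb{R}_+\to\mathbb{R}$, $1\le k\le m$, such that the corresponding continuous open-loop controls $u_k(t)=u_k^T(t)-v_k(t)$, $t\in\mathbb{R}_+$, assure that $( * )$ holds.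
   Context: $M^n$ is the space of $n\times n$ complex matrices with the Euclidean norm, $I$ is the identity, ${}^\dagger$ denotes conjugate transpose, $V(X)=\Re(\mathrm{tr}(X))$ for $X\in M^n$, and $\mathbb{R}_+=[0,\infty)$. Definition (regular). The system $\dot X=\sum_{k=1}^m u_kH_kX$, $X(0)=I$, is regular when, given $T>0$, there exist smooth $T$-periodic functions $u^T_k:\mathbb{R}\to\mathbb{R}$, $1\le k\le m$, such that the solution $X_r^T$ of $\dot X_r^T=\sum_{k=1}^m u_k^T(t)H_kX_r^T$, $X_r^T(0)=I$ (which takes values in $\mathrm{SU}(n)$) is also periodic of period $T$ and satisfies $$\mathrm{span}_{\mathbb{R}}\{B_k^j(0): 1\le k\le m,\ j\in\mathbb{N}\}=\mathfrak{su}(n),$$ where $\mathbb{N}$ includes $0$, $A(t)=\sum_{k=1}^m u_k^T(t)H_k$, $B_k^0(t)=H_kX_r^T(t)$ and $B_k^{j+1}(t)=-A(t)B_k^j(t)+\dot B_k^j(t)$. The number $\delta$. Let $G$ be the set of all real numbers of the form $\sum_{i=1}^n\Re(\lambda_i)$ with $\lambda_i\in\mathbb{C}$, $|\lambda_i|=1$, $\prod_{i=1}^n\lambda_i=1$, $\Im(\lambda_1)=\dots=\Im(\lambda_n)$. The set $G$ is finite with maximum $n$, and $\delta$ is the maximal element of $G\setminus\{n\}$. Auxiliary system. For $(t,W)\in\mathbb{R}\times M^n$, $$\dot W=WX_r^\dagger(t)\sum_{k=1}^m f_k\,a_k(t,W)\,H_kX_r(t),\qquad a_k(t,W)=f_k\,V\big(WX_r^\dagger(t)H_kX_r(t)\big).$$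 Algorithm 1. Write $X_\infty=M^\dagger\,\mathrm{diag}(e^{\imath\lambda_1},\dots,e^{\imath\lambda_n})M$ with $M$ unitary, $\lambda_1,\dots,\lambda_n\in\mathbb{R}$ and $\sum_{i=1}^n\lambda_i=0$, and put $\overline Z(\theta)=M^\dagger\,\mathrm{diag}(e^{\imath\lambda_1(1-\theta)},\dots,e^{\imath\lambda_n(1-\theta)})M$ for $\theta\in[0,1]$. Choose any nonzero $N\in\mathbb{N}$ such that, with $\overline Z_\ell=\overline Z(\ell/N)$ for $0\le\ell\le N$, one has $V(\overline Z_{\ell+1}^\dagger\overline Z_\ell)=\sum_{j=1}^n\cos(\lambda_j/N)>\delta$ for all $0\le\ell\le N-1$ (so $\overline Z_0=X_\infty$, $\overline Z_N=I$). Define $T_1=0$ and $W_0(T_1)=I$. For every $1\le\ell\le N-1$ (successively), let $W_\ell:\mathbb{R}\to\mathrm{SU}(n)$ be the solution of the auxiliary system with initial condition $W_\ell(T_\ell)=\overline Z_\ell^\dagger\,\overline Z_{\ell-1}W_{\ell-1}(T_\ell)$, choose a real number $T_{\ell+1}>T_\ell$ such that $V(\overline Z_{\ell+1}^\dagger\overline Z_\ell W_\ell(T_{\ell+1}))>\delta$, and define, for $t\in[T_\ell,T_{\ell+1})$, $Z(t)=\overline Z_\ell W_\ell(t)$ and $v_k(t)=f_k\,a_k(t,W_\ell(t))$, $1\le k\le m$. Finally, let $W_N:\mathbb{R}\to\mathrm{SU}(n)$ be the solution of the auxiliary system with initial condition $W_N(T_N)=\overline Z_{N-1}W_{N-1}(T_N)$,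 and define, for $t\ge T_N$, $Z(t)=W_N(t)$ and $v_k(t)=f_k\,a_k(t,W_N(t))$, $1\le k\le m$.
   Formalization: In (b) the controls v_k of Algorithm 1 generally jump at the switching times T_2,…,T_N, so they are stated as continuous off these times (right-continuous with left limits there), and X is continuous and satisfies the equation at all other t≥0. *)

(* Defs.v *)
From HB Require Import structures.
From mathcomp Require Import all_boot all_order all_algebra.
From mathcomp Require Import sesquilinear spectral.
From mathcomp Require Import complex.
From mathcomp Require Import all_classical all_reals all_analysis.

Set Implicit Arguments.
Unset Strict Implicit.
Unset Printing Implicit Defensive.

Import Order.TTheory GRing.Theory Num.Theory.
Import numFieldNormedType.Exports.

Local Open Scope classical_set_scope.
Local Open Scope ring_scope.
Local Open Scope complex_scope.
Local Open Scope sesquilinear_scope.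

Section Matrices.
Context {R : realType} {n : nat}.
Implicit Types X Y : 'M[R[i]]_n.

Definition SU : set 'M[R[i]]_n := [set X | X \is unitarymx /\ \det X = 1].

Definition su : set 'M[R[i]]_n := [set X | X ^t* = - X /\ \tr X = 0].

Definition V X : R := complex.Re (\tr X).

Definition enorm X : R :=
  Num.sqrt (\sum_i \sum_j (complex.Re (X i j) ^+ 2 + complex.Im (X i j) ^+ 2)).

Definition real_span {I : Type} (F : I -> 'M[R[i]]_n) : set 'M[R[i]]_n :=
  [set Y | exists s : seq (R * I), Y = \sum_(p <- s) p.1%:C *: F p.2].

(* The derivative of a matrix-valued function of a real variable is taken
   entrywise, on real and imaginary parts. *)
Definition mx_is_derive (F : R -> 'M[R[i]]_n) (t : R) (L : 'M[R[i]]_n) :=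
  forall i j,
    is_derive t 1 (fun s => complex.Re (F s i j)) (complex.Re (L i j)) /\
    is_derive t 1 (fun s => complex.Im (F s i j)) (complex.Im (L i j)).

Definition mx_derive (F : R -> 'M[R[i]]_n) (t : R) : 'M[R[i]]_n :=
  \matrix_(i, j) Complex (derive1 (fun s => complex.Re (F s i j)) t)
                         (derive1 (fun s => complex.Im (F s i j)) t).

Definition is_rderive (g : R -> R) (t l : R) :=
  h^-1 * (g (t + h) - g t) @[h --> 0^'+] --> l.

Definition mx_is_rderive (F : R -> 'M[R[i]]_n) (t : R) (L : 'M[R[i]]_n) :=
  forall i j,
    is_rderive (fun s => complex.Re (F s i j)) t (complex.Re (L i j)) /\
    is_rderive (fun s => complex.Im (F s i j)) t (complex.Im (L i j)).

Definition mx_continuous_half (F : R -> 'M[R[i]]_n) :=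
  forall i j,
    {within `[0, +oo[, continuous (fun s => complex.Re (F s i j))} /\
    {within `[0, +oo[, continuous (fun s => complex.Im (F s i j))}.

Definition solves_line (rhs : R -> 'M[R[i]]_n -> 'M[R[i]]_n)
    (X : R -> 'M[R[i]]_n) :=
  forall t, mx_is_derive X t (rhs t (X t)).

(* Solutions on [0, +oo[ (one-sided derivative at 0; the values of X on the
   negative reals are irrelevant).  J is a set of positive times at which the
   right-hand side may jump: there X is only required to be continuous.  With
   J = set0 these are the classical solutions. *)
Definition solves_half (J : set R) (rhs : R -> 'M[R[i]]_n -> 'M[R[i]]_n)
    (X : R -> 'M[R[i]]_n) :=
  [/\ mx_continuous_half X,
      mx_is_rderive X 0 (rhs 0 (X 0)) &
      forall t, 0 < t -> ~ J t -> mx_is_derive X t (rhs t (X t))].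

End Matrices.

Section RealFunctions.
Context {R : realType}.

Definition smooth (g : R -> R) := forall (j : nat) t, derivable (derive1n j g) t 1.

Definition smooth_half (g : R -> R) :=
  exists g1 : R -> R, smooth g1 /\ {in `[0, +oo[, g =1 g1}.

(* Continuous on [0, +oo[ off J, and at the times of J right-continuous with a
   left limit; used with a finite J. *)
Definition piecewise_continuous_half (J : set R) (g : R -> R) :=
  [/\ forall t, 0 <= t -> g s @[s --> t^'+] --> g t,
      forall t, 0 < t -> cvg (g s @[s --> t^'-]) &
      forall t, 0 < t -> ~ J t -> {for t, continuous g}].

End RealFunctions.

Section System.
Context {R : realType} {n m : nat}.
Variable H : 'I_m -> 'M[R[i]]_n.

Definition generator (u : 'I_m -> R -> R) (t : R) : 'M[R[i]]_n :=
  \sum_k (u k t)%:C *: H k.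

Fixpoint Bmx (u : 'I_m -> R -> R) (X : R -> 'M[R[i]]_n) (k : 'I_m) (j : nat)
    (t : R) : 'M[R[i]]_n :=
  if j is j'.+1 then
    - (generator u t *m Bmx u X k j' t) + mx_derive (Bmx u X k j') t
  else H k *m X t.

Definition regular_reference (T : R) (u : 'I_m -> R -> R)
    (X : R -> 'M[R[i]]_n) :=
  [/\ forall k, smooth (u k) /\ (forall t, u k (t + T) = u k t),
      solves_line (fun t Y => generator u t *m Y) X /\ X 0 = 1%:M,
      forall t, X (t + T) = X t &
      real_span (fun p : 'I_m * nat => Bmx u X p.1 p.2 0) = su].

Definition regular :=
  forall T : R, 0 < T -> exists u X, regular_reference T u X.

Definition solution (J : set R) (u : 'I_m -> R -> R) (X : R -> 'M[R[i]]_n) :=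
  solves_half J (fun t Y => generator u t *m Y) X /\ X 0 = 1%:M.

(* "The corresponding solution is SU(n)-valued and tracks Xr": a solution
   exists, and every solution has these properties. *)
Definition steers (J : set R) (u : 'I_m -> R -> R) (Xr : R -> 'M[R[i]]_n) :=
  (exists X, solution J u X) /\
  forall X, solution J u X ->
    (forall t, 0 <= t -> SU (X t)) /\
    enorm (X t - Xr t) @[t --> +oo] --> 0.

Variables (f : 'I_m -> R) (Xr : R -> 'M[R[i]]_n).

Definition closed_loop (uT : 'I_m -> R -> R) (t : R) (X : 'M[R[i]]_n) :
    'M[R[i]]_n :=
  generator (fun k s => uT k s - f k ^+ 2 * V (X ^t* *m H k *m Xr s)) t *m X.

Definition aux_a (k : 'I_m) (t : R) (W : 'M[R[i]]_n) : R :=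
  f k * V (W *m (Xr t) ^t* *m H k *m Xr t).

Definition aux (t : R) (W : 'M[R[i]]_n) : 'M[R[i]]_n :=
  W *m (Xr t) ^t* *m (\sum_k (f k * aux_a k t W)%:C *: H k) *m Xr t.

End System.

Section Delta.
Variable R : realType.

Definition Gset (n : nat) : set R :=
  [set g | exists lam : 'I_n -> R[i],
    [/\ forall i, `|lam i| = 1, \prod_i lam i = 1,
        forall i j, complex.Im (lam i) = complex.Im (lam j) &
        g = \sum_i complex.Re (lam i)]].

(* The greatest element of Gset n other than n; [get] of an empty set would be
   an arbitrary point, but for 2 <= n this maximum exists since Gset n is
   finite and contains n * Re (e ^ (2 i pi / n)). *)
Definition delta (n : nat) : R :=
  get [set d | (Gset n `\ n%:R) d /\ ubound (Gset n `\ n%:R) d].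

End Delta.

Section Algorithm.
Context {R : realType} {n m : nat}.
Variables (H : 'I_m -> 'M[R[i]]_n) (f : 'I_m -> R) (Xr : R -> 'M[R[i]]_n).

Definition Zbar (M : 'M[R[i]]_n) (lam : 'I_n -> R) (theta : R) :
    'M[R[i]]_n :=
  M ^t* *m diag_mx (\row_j Complex (cos (lam j * (1 - theta)))
                                   (sin (lam j * (1 - theta)))) *m M.

Definition diagonalizes (Xinf M : 'M[R[i]]_n) (lam : 'I_n -> R) :=
  [/\ M \is unitarymx, \sum_j lam j = 0 & Xinf = Zbar M lam 0].

Variables (M : 'M[R[i]]_n) (lam : 'I_n -> R) (N : nat).

Definition Zl (l : nat) : 'M[R[i]]_n := Zbar M lam (l%:R / N%:R).

Definition fine_enough :=
  (0 < N)%N /\ forall l, (l < N)%N -> delta R n < V ((Zl l.+1) ^t* *m Zl l).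

(* Stage l uses the switching time T l and the function W l, for
   1 <= l <= N; of W 0 only the value at time T 1 matters. *)
Definition is_stage (T : nat -> R) (W : nat -> R -> 'M[R[i]]_n) (l : nat)
    (Wl : R -> 'M[R[i]]_n) :=
  solves_line (aux H f Xr) Wl /\
  Wl (T l) = if (l < N)%N then (Zl l) ^t* *m Zl l.-1 *m W l.-1 (T l)
             else Zl N.-1 *m W N.-1 (T N).

Definition is_next_time (T : nat -> R) (l : nat) (Wl : R -> 'M[R[i]]_n)
    (t : R) :=
  T l < t /\ delta R n < V ((Zl l.+1) ^t* *m Zl l *m Wl t).

Definition run_upto (T : nat -> R) (W : nat -> R -> 'M[R[i]]_n) (L : nat) :=
  [/\ T 1%N = 0, W 0%N (T 1%N) = 1%:M &
      forall l, (1 <= l <= L)%N ->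
        is_stage T W l (W l) /\
        ((l < N)%N -> is_next_time T l (W l) (T l.+1))].

Definition algorithm_controls (T : nat -> R) (W : nat -> R -> 'M[R[i]]_n)
    (v : 'I_m -> R -> R) :=
  forall k,
    (forall l t, (1 <= l < N)%N -> T l <= t < T l.+1 ->
       v k t = f k * aux_a H f Xr k t (W l t)) /\
    (forall t, T N <= t -> v k t = f k * aux_a H f Xr k t (W N t)).

(* In general W l (T l) differs from W l.-1 (T l), so that the controls jump at
   the times T 2, ..., T N. *)
Definition switching_times (T : nat -> R) : set R :=
  [set t | exists2 l, (2 <= l <= N)%N & t = T l].

End Algorithm.

(* Main.v *)
Require Import Defs.
From HB Require Import structures.
From mathcomp Require Import all_boot all_order all_algebra.
From mathcomp Require Import sesquilinear spectral.
From mathcomp Require Import complex.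
From mathcomp Require Import all_classical all_reals all_analysis.
From mathcomp Require Import perm ring lra.
Import Order.TTheory GRing.Theory Num.Theory.
Import numFieldNormedType.Exports.
Local Open Scope classical_set_scope.
Local Open Scope ring_scope.
Local Open Scope complex_scope.
Local Open Scope sesquilinear_scope.
Set Implicit Arguments.
Unset Strict Implicit.
Unset Printing Implicit Defensive.

(* Writing Z = X^* Xr, the tracking problem becomes that of driving Z to the
   identity along Z' = Z Xr^* (sum_k v_k H_k) Xr.  With the feedback
   v_k = g_k V(Z Xr^* H_k Xr), g_k >= 0, one has
   (V Z)' = sum_k g_k V(Z Xr^* H_k Xr)^2 >= 0.  A limit point Zlim of Z(j T)
   satisfies V(Zlim Xr(t)^* H_k Xr(t)) = 0 for all t; differentiating at 0,
   regularity gives V(Y A) = 0 for all A in su(n), where Y is a conjugate of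
   Zlim.  Hence Y - Y^* is scalar, so V(Zlim) lies in Gset, and V(Zlim) > delta
   forces V(Zlim) = n.  When V(Xinf) <= delta, this is iterated along the points
   of a geodesic from Xinf to 1, multiplying Z on the left by constants.  The
   controls of Algorithm 1 jump at the switching times; continuous controls are
   obtained by taking the gain sin(pi t / T)^2 and switching at multiples of T,
   where it vanishes. *)

(** * Real functions *)

Section RealCalculus.
Context {R : realType}.
Implicit Types (f g : R -> R) (a b t : R).

(** The equation for Z is quadratic, so solutions on the whole line are not automatic. A scalar
    factor equal to 1 on SU(n) makes the field globally Lipschitz, and a weighted norm turns the
    Picard operator into a contraction on all of the line. The limit argument is run for every
    continuous, bounded, nonnegative, periodic gain that is nonzero at a dense set of times, so that
    it serves the constant gains and the vanishing one alike. The system depends on time, hence the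
    sampling at multiples of T: V is bounded, so its increase over a late period is small, and a
    small increase of V forces a small displacement of Z. A limit of the samples can thus stand for
    Z during the whole period. [steers] speaks of every solution on the half line, with a one-sided
    derivative at 0 and possible corners at finitely many times. For given open-loop controls
    uniqueness is the constancy of X^* Y; for the nonlinear closed loop it needs a Gronwall
    estimate. *)

Lemma is_derive_continuous f (df : R -> R) :
  (forall t, is_derive t 1 f (df t)) -> continuous f.
Proof.
move=> fd t; apply/differentiable_continuous/derivable1_diffP.
by case: (fd t).
Qed.

Lemma ndecr_of_derive f (df : R -> R) a b :
  a <= b -> continuous f ->
  (forall t, a < t < b -> is_derive t 1 f (df t)) ->
  (forall t, a < t < b -> 0 <= df t) -> f a <= f b.
Proof.
move=> ab cf fd df0.
move: ab; rewrite le_eqVlt => /predU1P[->//|ab].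
have fd' x : x \in `]a, b[ -> is_derive x 1 f (df x).
  by rewrite in_itv/=; exact: fd.
have [c + e] := MVT ab fd' (continuous_subspaceT cf).
rewrite in_itv/= => cab; rewrite -subr_ge0 e.
by rewrite mulr_ge0 ?df0// subr_ge0 ltW.
Qed.

(** Meant for curves that are merely continuous at the switching times: each exceptional point
    inside the interval splits it into two on which that point is no longer interior. *)
Lemma cst_off_finite f (s : seq R) a b :
  a <= b -> continuous f ->
  (forall t, a < t < b -> t \notin s -> is_derive t 1 f 0) -> f a = f b.
Proof.
move=> + cf; elim: s a b => [|x s IH] a b ab fd.
  apply/eqP; rewrite eq_le; apply/andP; split.
    by apply: (@ndecr_of_derive f (cst 0)) => // t tab; exact: fd.
  rewrite -lerN2; apply: (@ndecr_of_derive (fun t => - f t) (cst 0)) => //.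
    by move=> t; apply: cvgN; exact: cf.
  by move=> t tab; rewrite -oppr0; apply: is_deriveN; exact: fd.
have [/andP[ax xb]|xab] := boolP (a < x < b).
  transitivity (f x); apply: IH; rewrite ?ltW// => t /andP[t1 t2] ts.
    apply: fd; first by rewrite t1 (lt_trans t2 xb).
    by rewrite inE negb_or ts lt_eqF.
  apply: fd; first by rewrite (lt_trans ax t1).
  by rewrite inE negb_or ts gt_eqF.
apply: IH => // t tab ts; apply: fd => //; rewrite inE negb_or ts andbT.
by apply: contra xab => /eqP <-.
Qed.

(** Replaces integrating [|df| <= dg]: both [g + f] and [g - f] are nondecreasing, so [df] need not
    be integrable. *)
Lemma derive_dominated f g (df dg : R -> R) a b :
  a <= b ->
  (forall t, is_derive t 1 f (df t)) -> (forall t, is_derive t 1 g (dg t)) ->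
  (forall t, a < t < b -> `|df t| <= dg t) -> `|f b - f a| <= g b - g a.
Proof.
move=> ab fd gd H.
have cf := is_derive_continuous fd; have cg := is_derive_continuous gd.
rewrite ler_norml; apply/andP; split.
  have : g a + f a <= g b + f b.
    apply: (@ndecr_of_derive (g + f) (dg + df)) => // t tab.
    - by apply: continuousD; [exact: cg|exact: cf].
    - have := H t tab; rewrite ler_norml => /andP[h _].
      by rewrite fctE/=; lra.
  by move=> ?; lra.
have : g a - f a <= g b - f b.
  apply: (@ndecr_of_derive (g - f) (dg - df)) => // t tab.
  - by apply: continuousB; [exact: cg|exact: cf].
  - have := H t tab; rewrite ler_norml => /andP[_ h].
    by rewrite !fctE/=; lra.
by move=> ?; lra.
Qed.

(** The integral from [a] is differentiable only to the right of [a]. The differences [G a] do not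
    depend on [a], so a lower bound that moves with the argument gives one primitive on the whole
    line. *)
Lemma antiderivative f t0 : continuous f ->
  exists F : R -> R, (forall t, is_derive t 1 F (f t)) /\ F t0 = 0.
Proof.
move=> cf.
pose I a x := (\int[@lebesgue_measure R]_(t in [set` `[a, x]]) f t)%R.
have Id a x : a < x -> is_derive x 1 (I a) (f x).
  move=> ax.
  have x1 : x < x + 1 by rewrite ltrDl.
  have fi : (@lebesgue_measure R).-integrable `[a, x + 1] (EFin \o f).
    apply: continuous_compact_integrable; first exact: segment_compact.
    exact: continuous_subspaceT.
  have [d e] := continuous_FTC1_closed x1 fi ax (cf x).
  by apply: DeriveDef; [exact: d|rewrite -derive1E; exact: e].
pose G a x := I a x - I a t0.
have Gab a b x : a < x -> a < t0 -> b < x -> b < t0 -> G a x = G b x.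
  wlog xt0 : x t0 @G / x <= t0.
    move=> h ax at0 bx bt0; have [xt|tx] := leP x t0; first exact: h.
    have := h t0 x (ltW tx) at0 ax bt0 bx.
    by rewrite /G => e; rewrite -opprB e opprB.
  move=> ax at0 bx bt0; rewrite /G.
  have : I a x - I b x = I a t0 - I b t0.
    pose m := Num.max a b.
    have mx : m < x by rewrite gt_max ax bx.
    (* I a - I b is only differentiable to the right of m *)
    pose h := fun y => I a y - I b y.
    have hd y : m < y -> is_derive y 1 h 0.
      rewrite gt_max => /andP[ay by_].
      have := is_deriveB (Id a y ay) (Id b y by_).
      by rewrite subrr.
    move: xt0; rewrite le_eqVlt => /predU1P[->//|xt0].
    have hd' y : y \in `]x, t0[ -> is_derive y 1 h (cst 0 y).
      by rewrite in_itv/= => /andP[xy _]; apply: hd; exact: lt_trans xy.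
    have ch : {within `[x, t0], continuous h}.
      apply: derivable_within_continuous => y; rewrite in_itv/= => /andP[xy _].
      by have [] := hd y (lt_le_trans mx xy).
    have [c _ /eqP] := MVT xt0 hd' ch.
    by rewrite mul0r subr_eq0 => /eqP.
  by move=> e; lra.
(* This lower bound lies strictly to the left of both [x] and [t0]; near a given [t] it is traded
   for the fixed bound [a]. *)
exists (fun x => G (- `|x| - `|t0| - 1) x); split; last by rewrite /G subrr.
move=> t; pose a := - `|t| - `|t0| - 2.
have at0 : a < t0 by rewrite /a; have := ler_norm (- t0); rewrite normrN; have := normr_ge0 t; lra.
have at_ : a < t by rewrite /a; have := ler_norm (- t); rewrite normrN; have := normr_ge0 t0; lra.
apply: (@near_eq_is_derive _ _ _ (G a)); last first.
  have := is_deriveB (Id a t at_) (is_derive_cst (I a t0) t 1).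
  by rewrite subr0.
near=> x; apply: Gab => //.
- near: x; exact: lt_nbhsr.
- have := ler_norm (- x); rewrite normrN; have := normr_ge0 t0.
  by move=> ? ?; lra.
- have := ler_norm (- t0); rewrite normrN; have := normr_ge0 x.
  by move=> ? ?; lra.
Unshelve. all: by end_near. Qed.

End RealCalculus.

(** * Global solutions of Lipschitz systems *)

Section Picard.
Context {R : realType}.
Implicit Types s t : R.

Lemma pow_half_small (c e : R) : 0 < e -> exists n : nat, c * 2^-1 ^+ n < e.
Proof.
move=> e0; pose n := Num.bound (`|c| / e); exists n.
have cn : c / e < n%:R.
  apply: (@le_lt_trans _ _ (`|c| / e)); first by rewrite ler_pM2r ?invr_gt0// ler_norm.
  by apply: archi_boundP; rewrite divr_ge0 ?normr_ge0// ltW.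
rewrite exprVn ltr_pdivrMr ?exprn_gt0//.
rewrite ltr_pdivrMr// mulrC in cn; apply: lt_trans cn _.
by rewrite ltr_pM2l// -natrX ltr_nat ltn_expl.
Qed.

(* The Picard operator halves the norm sup |y t| / (weight K t0 t) once K is
   large, so the iteration converges on the whole line at once. *)
Definition weight (K t0 t : R) := expR (K * (t - t0)) + expR (- (K * (t - t0))).

Lemma weight_gt1 (K t0 t : R) : 1 <= weight K t0 t.
Proof.
rewrite /weight; have [h|h] := leP 0 (K * (t - t0)).
  rewrite -[leLHS]addr0 lerD ?expR_ge0//.
  by apply: le_trans (expR_ge1Dx _); rewrite lerDl.
rewrite -[leLHS]add0r lerD ?expR_ge0//.
by apply: le_trans (expR_ge1Dx _); rewrite lerDl oppr_ge0 ltW.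
Qed.

(** [k] is the primitive of [c * weight] that vanishes at [t0], and it is bounded by
    [c / K * weight]: integration gains a factor [1 / K] in the weighted norm. *)
Lemma weight_dominates (K t0 c t : R) (f df : R -> R) :
  0 < K -> 0 <= c -> (forall s, is_derive s 1 f (df s)) -> f t0 = 0 ->
  (forall s, `|df s| <= c * weight K t0 s) ->
  `|f t| <= c / K * weight K t0 t.
Proof.
move=> K0 c0 fd f0 H.
pose k s := c / K * (expR (K * (s - t0)) - expR (- (K * (s - t0)))).
have kd (s : R) : is_derive s (1 : R) k (c * weight K t0 s).
  have d0 : is_derive s (1 : R) (fun s => s - t0) (1 : R).
    by rewrite -[X in is_derive _ _ _ X]subr0; apply: is_deriveB.
  have d1 : is_derive s (1 : R) (fun s => K * (s - t0)) K.
    by rewrite -[X in is_derive _ _ _ X]mulr1; exact: is_deriveZ.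
  have d2 : is_derive s (1 : R) (fun s => expR (K * (s - t0))) (expR (K * (s - t0)) * K).
    exact: (@is_derive1_comp _ expR).
  have d3 : is_derive s (1 : R) (fun s => expR (- (K * (s - t0))))
      (expR (- (K * (s - t0))) * (- K)).
    exact: (@is_derive1_comp _ expR (fun s => - (K * (s - t0))) _ _ _ _ (is_deriveN d1)).
  apply: (is_derive_eq (is_deriveZ (c / K) (is_deriveB d2 d3))).
  rewrite /weight /= /GRing.scale/= mulrN opprK -mulrDl.
  by rewrite mulrCA mulrAC -mulrA mulfV ?gt_eqF// mulr1 mulrC.
have k0 : k t0 = 0 by rewrite /k !subrr mulr0 oppr0 subrr mulr0.
have kle s : `|k s| <= c / K * weight K t0 s.
  rewrite /k normrM ger0_norm ?divr_ge0 ?(ltW K0)// ler_wpM2l ?divr_ge0 ?(ltW K0)//.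
  by apply: (le_trans (ler_normB _ _)); rewrite /weight !ger0_norm ?expR_ge0.
apply: le_trans (kle t); have [tt|tt] := leP t0 t.
  have := derive_dominated tt fd kd (fun s _ => H s).
  by rewrite f0 k0 !subr0 => h; apply: le_trans h (ler_norm _).
have := derive_dominated (ltW tt) fd kd (fun s _ => H s).
by rewrite f0 k0 !sub0r normrN => h; apply: le_trans h _; rewrite -normrN ler_norm.
Qed.

(** States are real functions on a finite type, so that a complex matrix can be coded by its real
    and imaginary parts. The bound [B] at the initial state makes the first Picard step finite in
    the weighted norm. *)
Theorem global_picard (I : finType) (F : R -> (I -> R) -> I -> R) (L B t0 : R)
    (y0 : I -> R) :
  0 <= L -> (forall t i, `|F t y0 i| <= B) ->
  (forall t y z i, `|F t y i - F t z i| <= L * \sum_j `|y j - z j|) ->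
  (forall y : R -> I -> R, (forall j, continuous (y ^~ j)) ->
     forall i, continuous (fun t => F t (y t) i)) ->
  exists y : R -> I -> R,
    (forall t i, is_derive t 1 (y ^~ i) (F t (y t) i)) /\ y t0 = y0.
Proof.
move=> L0 FB FL Fc.
have [/card0_eq I0|] := eqVneq #|I| 0%N.
  by exists (fun=> y0); split=> // t i; have := I0 i.
rewrite -lt0n => /card_gt0P[i0 _].
have B0 : 0 <= B by apply: le_trans (FB 0 i0); exact: normr_ge0.
(* [K] makes the contraction ratio [d * L / K] at most 1/2, and the [+ 1] keeps it positive when
   [L = 0]. *)
pose d : R := #|I|%:R; pose K := 2 * d * L + 1.
have dL0 : 0 <= d * L by rewrite mulr_ge0.
have K0 : 0 < K by rewrite /K; lra.
have dLK : d * L / K <= 2^-1 by rewrite ler_pdivrMr// /K; lra.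
pose h := weight K t0.
have h0 t : 0 < h t by apply: lt_le_trans (weight_gt1 _ _ _).
have ch : continuous h.
  have cl : continuous (fun t => K * (t - t0)).
    by move=> t; apply: cvgM; [exact: cvg_cst|apply: cvgB; [exact: cvg_id|exact: cvg_cst]].
  have ce (g : R -> R) : continuous g -> continuous (fun t => expR (g t)).
    move=> cg t; apply: (@continuous_comp _ _ _ g expR); first exact: cg.
    exact: continuous_expR.
  move=> t; apply: cvgD; first exact: (ce _ cl).
  by apply: (ce (fun t => - (K * (t - t0)))) => s; apply: cvgN; exact: cl.
have [P HP] : exists P : (R -> I -> R) -> (R -> I -> R), forall y,
    (forall j, continuous (y ^~ j)) ->
    (forall t i, is_derive t 1 (P y ^~ i) (F t (y t) i)) /\ P y t0 = y0.
  suff : forall y : R -> I -> R, exists z, (forall j, continuous (y ^~ j)) ->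
    (forall t i, is_derive t 1 (z ^~ i) (F t (y t) i)) /\ z t0 = y0.
    move=> /choice[P HP]; exists P; exact: HP.
  (* A discontinuous curve gets itself as a junk image; every iterate below is continuous. *)
  move=> y; have [cy|ncy] := pselect (forall j, continuous (y ^~ j)); last by exists y.
  have /choice[G HG] : forall i, exists G : R -> R,
      (forall t, is_derive t 1 G (F t (y t) i)) /\ G t0 = 0.
    by move=> i; apply: antiderivative; exact: Fc.
  exists (fun t i => y0 i + G i t) => _; split.
    move=> t i; have [/(_ t) Gd _] := HG i.
    by rewrite -[X in is_derive _ _ _ X]add0r; apply: is_deriveD.
  by apply/funext => i; have [_ ->] := HG i; rewrite addr0.
have Pc y : (forall j, continuous (y ^~ j)) -> forall j, continuous (P y ^~ j).
  by move=> cy j; apply: is_derive_continuous => t; have [+ _] := HP y cy; exact.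
have Pcontract y z c : 0 <= c -> (forall j, continuous (y ^~ j)) ->
    (forall j, continuous (z ^~ j)) -> (forall t i, `|y t i - z t i| <= c * h t) ->
    forall t i, `|P y t i - P z t i| <= c / 2 * h t.
  move=> c0 cy cz yz t i; have [dy iy] := HP y cy; have [dz iz] := HP z cz.
  apply: le_trans (_ : (d * L * c) / K * h t <= _); last first.
    by rewrite ler_pM2r// [c / 2]mulrC mulrAC ler_wpM2r.
  have fd s : is_derive s (1 : R) (fun t => P y t i - P z t i)
      (F s (y s) i - F s (z s) i).
    exact: (is_deriveB (dy s i) (dz s i)).
  have dLc : 0 <= d * L * c by rewrite mulr_ge0.
  apply: (@weight_dominates K t0 (d * L * c) t _ _ K0 dLc fd).
  - by rewrite iy iz subrr.
  - move=> s; apply: le_trans (FL _ _ _ _) _.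
    apply: (@le_trans _ _ (L * \sum_(j : I) (c * h s))).
      by rewrite ler_wpM2l// ler_sum.
    by rewrite sumr_const -mulr_natl -/d !mulrA [L * d]mulrC.
pose Y n := iter n P (fun=> y0).
have cY n j : continuous (Y n ^~ j).
  elim: n j => [|n IH] j; last exact: Pc.
  by move=> t; exact: cvg_cst.
pose C := B / K.
have C0 : 0 <= C by rewrite divr_ge0 ?(ltW K0).
have HY n t i : `|Y n.+1 t i - Y n t i| <= C * 2^-1 ^+ n * h t.
  elim: n t i => [|n IH] t i.
    rewrite expr0 mulr1 /C; have [dP iP] := HP (fun=> y0) (cY 0%N).
    have fd s : is_derive s (1 : R) (fun t => Y 1%N t i - y0 i) (F s y0 i).
      rewrite -[X in is_derive _ _ _ X]subr0.
      exact: (is_deriveB (dP s i) (is_derive_cst (y0 i) s 1)).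
    apply: (@weight_dominates K t0 B t _ _ K0 B0 fd).
    - by rewrite /Y/= iP subrr.
    - move=> s; apply: le_trans (FB _ _) _; rewrite ler_peMr//.
      exact: weight_gt1.
  rewrite exprSr mulrA; apply: Pcontract => //.
    by rewrite mulr_ge0 ?exprn_ge0.
  exact: (cY n.+1).
have Cn0 n : 0 <= C * 2^-1 ^+ n by rewrite mulr_ge0 ?exprn_ge0.
(* [e n] is the tail of the geometric series bounding the later steps. It makes [Y n - e n]
   nondecreasing and [Y n + e n] nonincreasing in [n], so the limit is obtained as a supremum of
   reals. *)
pose e n t := 2 * C * 2^-1 ^+ n * h t.
have [y Hy] : exists y : R -> I -> R, forall n t i, `|Y n t i - y t i| <= e n t.
  exists (fun t i => sup (range (fun n => Y n t i - e n t))).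
  move=> n t i.
  have eS m : e m.+1 t = e m t - C * 2^-1 ^+ m * h t.
    by rewrite /e exprSr; lra.
  have e0 m : 0 <= e m t by apply: mulr_ge0; [rewrite -mulrA; apply: mulr_ge0|exact/ltW/h0].
  have up a b : (a <= b)%N -> Y a t i - e a t <= Y b t i - e b t.
    move=> /subnKC <-; elim: (b - a)%N => [|k IH]; first by rewrite addn0.
    rewrite addnS; apply: le_trans IH _; rewrite eS.
    by have := HY (a + k)%N t i; rewrite ler_norml => /andP[? _]; lra.
  have dn a b : (a <= b)%N -> Y b t i + e b t <= Y a t i + e a t.
    move=> /subnKC <-; elim: (b - a)%N => [|k IH]; first by rewrite addn0.
    rewrite addnS; apply: le_trans IH; rewrite eS.
    by have := HY (a + k)%N t i; rewrite ler_norml => /andP[_ ?]; lra.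
  have ub a b : Y a t i - e a t <= Y b t i + e b t.
    apply: le_trans (up a (maxn a b) (leq_maxl _ _)) _.
    apply: le_trans (dn b (maxn a b) (leq_maxr _ _)).
    by have := e0 (maxn a b); lra.
  have s1 : Y n t i - e n t <= sup (range (fun n => Y n t i - e n t)).
    apply: ub_le_sup; last by exists n.
    by exists (Y n t i + e n t) => _ [m _ <-].
  have s2 : sup (range (fun n => Y n t i - e n t)) <= Y n t i + e n t.
    by apply: ge_sup; [exists (Y 0%N t i - e 0%N t), 0%N|move=> _ [m _ <-]].
  by rewrite ler_norml; lra.
have cy j : continuous (y ^~ j).
  move=> t; apply/cvgrPdist_le => eps eps0.
  have e30 : 0 < eps / 3 by rewrite divr_gt0.
  have [n hn] := @pow_half_small (2 * C * (h t + 1)) (eps / 3) e30.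
  have ht : \forall s \near t, h s < h t + 1.
    have := ch t; move=> /cvgrPdist_lt /(_ 1 ltr01); apply: filterS => s.
    by rewrite ltr_norml => /andP[+ _]; lra.
  have cn := cY n j t; move/cvgrPdist_lt : cn => /(_ (eps / 3) e30).
  apply: filterS2 ht => s hs hYn.
  have es u : h u < h t + 1 -> e n u <= eps / 3.
    move=> hu; apply: le_trans (ltW hn); rewrite /e mulrAC ler_wpM2r ?exprn_ge0//.
    by apply: ler_wpM2l; [apply: mulr_ge0|apply: ltW].
  have := le_trans (Hy n s j) (es s hs).
  have := le_trans (Hy n t j) (es t ltac:(by rewrite ltrDl)).
  move: hYn; rewrite ltr_norml !ler_norml => /andP[? ?] /andP[? ?] /andP[? ?]; lra.
exists y; have [dP iP] := HP y cy.
suff Py : P y = y by rewrite Py in dP iP.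
apply/funext => t; apply/funext => i; apply/eqP; rewrite -subr_eq0 -normr_eq0.
rewrite eq_le normr_ge0 andbT; apply/ler_addgt0Pl => eps eps0; rewrite addr0.
have [n hn] := @pow_half_small (2 * C * h t) eps eps0.
have h1 : `|P y t i - Y n.+1 t i| <= C * 2^-1 ^+ n * h t.
  have := @Pcontract y (Y n) (2 * C * 2^-1 ^+ n).
  have -> : 2 * C * 2^-1 ^+ n / 2 = C * 2^-1 ^+ n by rewrite -mulrA mulrCA mulrAC; lra.
  apply=> //; first by rewrite -mulrA; apply: mulr_ge0.
  by move=> s j; rewrite distrC; exact: Hy.
have h2 := Hy n.+1 t i.
rewrite -(subrKA (Y n.+1 t i)).
apply: le_trans (ler_normD _ _) _; apply: le_trans (lerD h1 h2) _.
apply: le_trans (ltW hn); rewrite /e exprSr; lra.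
Qed.

End Picard.

(** * Limits and derivatives of matrix-valued functions *)

Section ComplexParts.
Context {R : realType}.
Implicit Types x y : R[i].
Local Notation Re := complex.Re.
Local Notation Im := complex.Im.

Lemma cplx_eqP x y : Re x = Re y -> Im x = Im y -> x = y.
Proof. by case: x y => [a b] [c d] /= -> ->. Qed.
Lemma ReD x y : Re (x + y) = Re x + Re y. Proof. by case: x y => [a b] []. Qed.
Lemma ImD x y : Im (x + y) = Im x + Im y. Proof. by case: x y => [a b] []. Qed.
Lemma ReN x : Re (- x) = - Re x. Proof. by case: x. Qed.
Lemma ImN x : Im (- x) = - Im x. Proof. by case: x. Qed.
Lemma ReM x y : Re (x * y) = Re x * Re y - Im x * Im y.
Proof. by case: x y => [a b] []. Qed.
Lemma ImM x y : Im (x * y) = Re x * Im y + Im x * Re y.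
Proof. by case: x y => [a b] []. Qed.
Lemma ReJ x : Re (Num.conj x) = Re x. Proof. by case: x. Qed.
Lemma ImJ x : Im (Num.conj x) = - Im x. Proof. by case: x. Qed.
Lemma Re_sum I (r : seq I) (P : pred I) (F : I -> R[i]) :
  Re (\sum_(i <- r | P i) F i) = \sum_(i <- r | P i) Re (F i).
Proof. exact: (big_morph _ ReD erefl). Qed.
Lemma ReZ (a : R) x : Re (a%:C * x) = a * Re x.
Proof. by rewrite ReM/= mul0r subr0. Qed.
Lemma ImZ (a : R) x : Im (a%:C * x) = a * Im x.
Proof. by rewrite ImM/= mul0r addr0. Qed.
Lemma conjCR (a : R) : Num.conj (a%:C : R[i]) = a%:C.
Proof. by apply: cplx_eqP; rewrite ?ReJ ?ImJ//= oppr0. Qed.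

End ComplexParts.

Section Limits.
Context {R : realType} {T : Type} {F : set_system T} {FF : Filter F}.
Local Notation Re := complex.Re.
Local Notation Im := complex.Im.

(** Convergence by real and imaginary parts, matching [mx_is_derive]. The filter is arbitrary:
    neighbourhoods, sequences and an ultrafilter all occur. *)
Definition ccvg (f : T -> R[i]) (l : R[i]) :=
  (Re (f x) @[x --> F] --> Re l) /\ (Im (f x) @[x --> F] --> Im l).

Lemma ccvg_cst l : ccvg (fun=> l) l.
Proof. by split; exact: cvg_cst. Qed.

Lemma ccvgD f g l m : ccvg f l -> ccvg g m -> ccvg (fun x => f x + g x) (l + m).
Proof.
move=> [f1 f2] [g1 g2]; split; under eq_fun do rewrite ?ReD ?ImD.
  by rewrite ReD; apply: cvgD.
by rewrite ImD; apply: cvgD.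
Qed.

Lemma ccvgN f l : ccvg f l -> ccvg (fun x => - f x) (- l).
Proof.
move=> [f1 f2]; split; under eq_fun do rewrite ?ReN ?ImN.
  by rewrite ReN; apply: cvgN.
by rewrite ImN; apply: cvgN.
Qed.

Lemma ccvgM f g l m : ccvg f l -> ccvg g m -> ccvg (fun x => f x * g x) (l * m).
Proof.
move=> [f1 f2] [g1 g2]; split; under eq_fun do rewrite ?ReM ?ImM.
  by rewrite ReM; apply: cvgB; apply: cvgM.
by rewrite ImM; apply: cvgD; apply: cvgM.
Qed.

Lemma ccvgJ f l : ccvg f l -> ccvg (fun x => Num.conj (f x)) (Num.conj l).
Proof.
move=> [f1 f2]; split; under eq_fun do rewrite ?ReJ ?ImJ.
  by rewrite ReJ.
by rewrite ImJ; apply: cvgN.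
Qed.

Lemma ccvgR (f : T -> R) (l : R) : f x @[x --> F] --> l ->
  ccvg (fun x => (f x)%:C) l%:C.
Proof. by move=> fl; split=> //=; exact: cvg_cst. Qed.

Lemma ccvg_sum I (r : seq I) (f : I -> T -> R[i]) (l : I -> R[i]) :
  (forall i, ccvg (f i) (l i)) ->
  ccvg (fun x => \sum_(i <- r) f i x) (\sum_(i <- r) l i).
Proof.
move=> fl; elim: r => [|i r IH].
  by under eq_fun do rewrite big_nil; rewrite big_nil; exact: ccvg_cst.
by under eq_fun do rewrite big_cons; rewrite big_cons; exact: ccvgD.
Qed.

Lemma ccvg_prod I (r : seq I) (f : I -> T -> R[i]) (l : I -> R[i]) :
  (forall i, ccvg (f i) (l i)) ->
  ccvg (fun x => \prod_(i <- r) f i x) (\prod_(i <- r) l i).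
Proof.
move=> fl; elim: r => [|i r IH].
  by under eq_fun do rewrite big_nil; rewrite big_nil; exact: ccvg_cst.
by under eq_fun do rewrite big_cons; rewrite big_cons; exact: ccvgM.
Qed.

Context {n : nat}.
Implicit Types (A B : T -> 'M[R[i]]_n) (L M : 'M[R[i]]_n).

Definition mx_cvg A L := forall i j, ccvg (fun x => A x i j) (L i j).

Lemma mx_cvg_cst L : mx_cvg (fun=> L) L.
Proof. by move=> i j; exact: ccvg_cst. Qed.

Lemma mx_cvgD A B L M : mx_cvg A L -> mx_cvg B M -> mx_cvg (fun x => A x + B x) (L + M).
Proof.
by move=> AL BM i j; rewrite mxE; under eq_fun do rewrite mxE; exact: ccvgD.
Qed.

Lemma mx_cvgN A L : mx_cvg A L -> mx_cvg (fun x => - A x) (- L).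
Proof.
by move=> AL i j; rewrite mxE; under eq_fun do rewrite mxE; exact: ccvgN.
Qed.

Lemma mx_cvgM A B L M : mx_cvg A L -> mx_cvg B M ->
  mx_cvg (fun x => A x *m B x) (L *m M).
Proof.
move=> AL BM i j; rewrite mxE; under eq_fun do rewrite mxE.
by apply: ccvg_sum => k; exact: ccvgM.
Qed.

Lemma mx_cvgJ A L : mx_cvg A L -> mx_cvg (fun x => (A x) ^t*) (L ^t*).
Proof.
move=> AL i j; rewrite !mxE; under eq_fun do rewrite !mxE.
exact: ccvgJ.
Qed.

Lemma mx_cvgZ (a : T -> R) A (l : R) L : a x @[x --> F] --> l -> mx_cvg A L ->
  mx_cvg (fun x => (a x)%:C *: A x) (l%:C *: L).
Proof.
move=> al AL i j; rewrite mxE; under eq_fun do rewrite mxE.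
by apply: ccvgM => //; exact: ccvgR.
Qed.

Lemma mx_cvg_sum I (r : seq I) (A : I -> T -> 'M[R[i]]_n) (L : I -> 'M[R[i]]_n) :
  (forall i, mx_cvg (A i) (L i)) ->
  mx_cvg (fun x => \sum_(i <- r) A i x) (\sum_(i <- r) L i).
Proof.
move=> AL i j; rewrite summxE; under eq_fun do rewrite summxE.
by apply: ccvg_sum => k; exact: AL.
Qed.

Lemma V_cvg A L : mx_cvg A L -> V (A x) @[x --> F] --> V L.
Proof.
by move=> AL; have [] := @ccvg_sum _ (index_enum 'I_n) (fun i x => A x i i)
  (fun i => L i i) (fun i => AL i i).
Qed.

Lemma det_cvg A L : mx_cvg A L -> ccvg (fun x => \det (A x)) (\det L).
Proof.
move=> AL; apply: ccvg_sum => s; apply: ccvgM; first exact: ccvg_cst.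
by apply: ccvg_prod => i; exact: AL.
Qed.

Lemma mx_cvg_eq {PF : ProperFilter F} A L M : mx_cvg A L -> mx_cvg A M -> L = M.
Proof.
move=> AL AM; apply/matrixP => i j; have [l1 l2] := AL i j; have [m1 m2] := AM i j.
by apply: cplx_eqP; [exact: (cvg_unique _ l1 m1)|exact: (cvg_unique _ l2 m2)].
Qed.

End Limits.
Arguments ccvg {R T} F f l.
Arguments mx_cvg {R T} F {n} A L.

Section Derivatives.
Context {R : realType}.
Implicit Types (t : R) (f g : R -> R[i]).
Local Notation Re := complex.Re.
Local Notation Im := complex.Im.

Definition cder t f (l : R[i]) :=
  is_derive t 1 (fun s => Re (f s)) (Re l) /\ is_derive t 1 (fun s => Im (f s)) (Im l).

Lemma is_deriveM' t (u v : R -> R) (du dv : R) :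
  is_derive t 1 u du -> is_derive t 1 v dv ->
  is_derive t 1 (fun s => u s * v s) (du * v t + u t * dv).
Proof.
move=> hu hv; apply: (is_derive_eq (is_deriveM hu hv)).
by rewrite addrC /GRing.scale/= [v t * _]mulrC.
Qed.

Lemma cder_cst t l : cder t (fun=> l) 0.
Proof. by split; exact: is_derive_cst. Qed.

Lemma cderD t f g l m : cder t f l -> cder t g m -> cder t (fun x => f x + g x) (l + m).
Proof.
move=> [f1 f2] [g1 g2]; split; under eq_fun do rewrite ?ReD ?ImD.
  by rewrite ReD; exact: (is_deriveD f1 g1).
by rewrite ImD; exact: (is_deriveD f2 g2).
Qed.

Lemma cderN t f l : cder t f l -> cder t (fun x => - f x) (- l).
Proof.
move=> [f1 f2]; split; under eq_fun do rewrite ?ReN ?ImN.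
  by rewrite ReN; exact: (is_deriveN f1).
by rewrite ImN; exact: (is_deriveN f2).
Qed.

Lemma cderM t f g l m : cder t f l -> cder t g m ->
  cder t (fun x => f x * g x) (l * g t + f t * m).
Proof.
move=> [f1 f2] [g1 g2]; split; under eq_fun do rewrite ?ReM ?ImM.
  apply: (is_derive_eq (is_deriveB (is_deriveM' f1 g1) (is_deriveM' f2 g2))).
  by rewrite ReD !ReM; ring.
apply: (is_derive_eq (is_deriveD (is_deriveM' f1 g2) (is_deriveM' f2 g1))).
by rewrite ImD !ImM; ring.
Qed.

Lemma cderJ t f l : cder t f l -> cder t (fun x => Num.conj (f x)) (Num.conj l).
Proof.
move=> [f1 f2]; split; under eq_fun do rewrite ?ReJ ?ImJ.
  by rewrite ReJ.
by rewrite ImJ; exact: (is_deriveN f2).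
Qed.

Lemma cder_sum t I (r : seq I) (f : I -> R -> R[i]) (l : I -> R[i]) :
  (forall i, cder t (f i) (l i)) ->
  cder t (fun x => \sum_(i <- r) f i x) (\sum_(i <- r) l i).
Proof.
move=> fl; elim: r => [|i r IH].
  by under eq_fun do rewrite big_nil; rewrite big_nil; exact: cder_cst.
by under eq_fun do rewrite big_cons; rewrite big_cons; exact: cderD.
Qed.

Lemma cder_prod t (I : eqType) (r : seq I) (f : I -> R -> R[i]) (l : I -> R[i]) :
  uniq r -> (forall i, cder t (f i) (l i)) ->
  cder t (fun x => \prod_(i <- r) f i x)
    (\sum_(i <- r) l i * \prod_(j <- r | j != i) f j t).
Proof.
move=> + fl; elim: r => [_|i r IH /=/andP[ir ur]].
  by under eq_fun do rewrite big_nil; rewrite big_nil; exact: cder_cst.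
under eq_fun do rewrite big_cons.
have -> : \sum_(k <- i :: r) l k * \prod_(j <- i :: r | j != k) f j t =
  l i * \prod_(j <- r) f j t +
  f i t * \sum_(k <- r) l k * \prod_(j <- r | j != k) f j t; last first.
  by apply: cderM => //; exact: IH.
rewrite big_cons big_cons eqxx/=; congr (_ * _ + _).
  rewrite [LHS]big_seq_cond [RHS]big_seq; apply: eq_bigl => j.
  by case: (eqVneq j i) => [->|]; rewrite ?(negPf ir) ?andbT.
rewrite big_distrr/= [LHS]big_seq [RHS]big_seq; apply: eq_bigr => k kr.
rewrite big_cons (_ : i != k); first by rewrite mulrCA.
by apply: contraNneq ir => ->.
Qed.

Context {n : nat}.
Implicit Types (A B : R -> 'M[R[i]]_n) (L M : 'M[R[i]]_n).

Lemma mx_derP A t L : mx_is_derive A t L <->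
  forall i j, cder t (fun s => A s i j) (L i j).
Proof. by []. Qed.

Lemma mx_der_eq A t L M : mx_is_derive A t L -> L = M -> mx_is_derive A t M.
Proof. by move=> + <-. Qed.

Lemma mx_der_cst t L : mx_is_derive (fun=> L) t 0.
Proof. by apply/mx_derP => i j; rewrite mxE; exact: cder_cst. Qed.

Lemma mx_derD A B t L M : mx_is_derive A t L -> mx_is_derive B t M ->
  mx_is_derive (fun x => A x + B x) t (L + M).
Proof.
move=> /mx_derP AL /mx_derP BM; apply/mx_derP => i j.
by rewrite mxE; under eq_fun do rewrite mxE; exact: cderD.
Qed.

Lemma mx_derN A t L : mx_is_derive A t L -> mx_is_derive (fun x => - A x) t (- L).
Proof.
move=> /mx_derP AL; apply/mx_derP => i j.
by rewrite mxE; under eq_fun do rewrite mxE; exact: cderN.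
Qed.

Lemma mx_derM A B t L M : mx_is_derive A t L -> mx_is_derive B t M ->
  mx_is_derive (fun x => A x *m B x) t (L *m B t + A t *m M).
Proof.
move=> /mx_derP AL /mx_derP BM; apply/mx_derP => i j.
rewrite !mxE -big_split/=; under eq_fun do rewrite mxE.
by apply: cder_sum => k; exact: cderM.
Qed.

Lemma mx_derMl L B t M : mx_is_derive B t M ->
  mx_is_derive (fun x => L *m B x) t (L *m M).
Proof.
by move=> BM; apply: mx_der_eq (mx_derM (mx_der_cst t L) BM) _; rewrite mul0mx add0r.
Qed.

Lemma mx_derMr A L t M : mx_is_derive A t M ->
  mx_is_derive (fun x => A x *m L) t (M *m L).
Proof.
by move=> AM; apply: mx_der_eq (mx_derM AM (mx_der_cst t L)) _; rewrite mulmx0 addr0.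
Qed.

Lemma mx_derJ A t L : mx_is_derive A t L -> mx_is_derive (fun x => (A x) ^t*) t (L ^t*).
Proof.
move=> /mx_derP AL; apply/mx_derP => i j.
by rewrite !mxE; under eq_fun do rewrite !mxE; exact: cderJ.
Qed.

Lemma mx_der_cont A t L : mx_is_derive A t L -> mx_cvg (nbhs t) A (A t).
Proof.
move=> AL i j; have [[d1 _] [d2 _]] := AL i j.
by split; apply/differentiable_continuous/derivable1_diffP.
Qed.

Lemma V_der A t L : mx_is_derive A t L -> is_derive t 1 (fun s => V (A s)) (V L).
Proof.
by move=> /mx_derP AL; have [] := @cder_sum t _ (index_enum 'I_n) (fun i x => A x i i)
  (fun i => L i i) (fun i => AL i i).
Qed.

(** Jacobi's formula, from the product rule in each term of the permutation expansion; it will show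
    that flows generated by traceless matrices keep the determinant. *)
Lemma det_der A t L : mx_is_derive A t L ->
  cder t (fun s => \det (A s)) (\tr (L *m \adj (A t))).
Proof.
move=> AL.
have -> : \tr (L *m \adj (A t)) = \sum_(s : 'S_n) (-1) ^+ s *
    \sum_i L i (s i) * \prod_(j | j != i) A t j (s j).
  (* A diagonal entry of [L *m \adj (A t)] is the determinant of [A t] with row [i] taken from [L],
     since the cofactors along row [i] do not see that row. *)
  transitivity (\sum_i \det (\matrix_(k, j) if k == i then L k j else A t k j)).
    apply: eq_bigr => i _; rewrite mxE (expand_det_row _ i); apply: eq_bigr => j _.
    rewrite !mxE eqxx; congr (_ * _); rewrite /cofactor; congr (_ * \det _).
    by apply/matrixP => a b; rewrite !mxE eq_sym (negPf (neq_lift _ _)).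
  rewrite exchange_big/=; apply: eq_bigr => s _; rewrite -big_distrr/=.
  congr (_ * _); apply: eq_bigr => i _; rewrite (bigD1 i)//= mxE eqxx; congr (_ * _).
  by apply: eq_bigr => j ji; rewrite mxE (negPf ji).
rewrite /determinant; apply: cder_sum => s.
have := cderM (cder_cst t ((-1) ^+ s)) (@cder_prod t _ (index_enum 'I_n)
  (fun i x => A x i (s i)) (fun i => L i (s i)) (index_enum_uniq _)
  (fun i => AL i (s i))).
by rewrite mul0r add0r.
Qed.

End Derivatives.

(** * Norms and the special unitary group *)

Section Norms.
Context {R : realType} {n : nat}.
Implicit Types (x y : R[i]) (A B U : 'M[R[i]]_n).
Local Notation Re := complex.Re.
Local Notation Im := complex.Im.

(** An l1 norm with values in [R], unlike the norm of [R[i]]; it is submultiplicative, which passes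
    to [mxabs]. *)
Definition cabs x := `|Re x| + `|Im x|.

Lemma cabs_ge0 x : 0 <= cabs x. Proof. by rewrite addr_ge0. Qed.

Lemma cabsD x y : cabs (x + y) <= cabs x + cabs y.
Proof.
by rewrite /cabs ReD ImD addrACA; apply: lerD; exact: ler_normD.
Qed.

Lemma cabsM x y : cabs (x * y) <= cabs x * cabs y.
Proof.
rewrite /cabs ReM ImM.
apply: le_trans (lerD (ler_normB _ _) (ler_normD _ _)) _.
by rewrite !normrM; lra.
Qed.

Lemma cabsN x : cabs (- x) = cabs x.
Proof. by rewrite /cabs ReN ImN !normrN. Qed.

Lemma cabsJ x : cabs (Num.conj x) = cabs x.
Proof. by rewrite /cabs ReJ ImJ normrN. Qed.

Lemma cabs0 : cabs 0 = 0. Proof. by rewrite /cabs normr0 addr0. Qed.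

Lemma cabs_sum I (r : seq I) (P : pred I) (f : I -> R[i]) :
  cabs (\sum_(i <- r | P i) f i) <= \sum_(i <- r | P i) cabs (f i).
Proof.
elim/big_rec2 : _ => [|i y1 y2 _ h]; first by rewrite cabs0.
by apply: le_trans (cabsD _ _) _; rewrite lerD2l.
Qed.

Definition mxabs A := \sum_i \sum_j cabs (A i j).

Lemma mxabs_ge0 A : 0 <= mxabs A.
Proof. by apply: sumr_ge0 => i _; apply: sumr_ge0 => j _; exact: cabs_ge0. Qed.

Lemma cabs_le_mxabs A i j : cabs (A i j) <= mxabs A.
Proof.
rewrite /mxabs (bigD1 i)//= (bigD1 j)//= -addrA lerDl addr_ge0//.
  by apply: sumr_ge0 => k _; exact: cabs_ge0.
by apply: sumr_ge0 => k _; apply: sumr_ge0 => l _; exact: cabs_ge0.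
Qed.

Lemma mxabs0 : mxabs 0 = 0.
Proof. by rewrite /mxabs big1// => i _; rewrite big1// => j _; rewrite mxE cabs0. Qed.

Lemma mxabsD A B : mxabs (A + B) <= mxabs A + mxabs B.
Proof.
rewrite /mxabs -big_split/=; apply: ler_sum => i _.
by rewrite -big_split/=; apply: ler_sum => j _; rewrite mxE cabsD.
Qed.

Lemma mxabsN A : mxabs (- A) = mxabs A.
Proof. by apply: eq_bigr => i _; apply: eq_bigr => j _; rewrite mxE cabsN. Qed.

Lemma mxabsB A B : mxabs (A - B) = mxabs (B - A).
Proof. by rewrite -mxabsN opprB. Qed.

Lemma mxabsJ A : mxabs (A ^t*) = mxabs A.
Proof.
rewrite /mxabs exchange_big/=; apply: eq_bigr => i _; apply: eq_bigr => j _.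
by rewrite !mxE cabsJ.
Qed.

Lemma mxabs_sum I (r : seq I) (P : pred I) (f : I -> 'M[R[i]]_n) :
  mxabs (\sum_(i <- r | P i) f i) <= \sum_(i <- r | P i) mxabs (f i).
Proof.
elim/big_rec2 : _ => [|i y1 y2 _ h]; first by rewrite mxabs0.
by apply: le_trans (mxabsD _ _) _; rewrite lerD2l.
Qed.

Lemma mxabsZ (a : R) A : mxabs (a%:C *: A) = `|a| * mxabs A.
Proof.
rewrite /mxabs big_distrr/=; apply: eq_bigr => i _.
rewrite big_distrr/=; apply: eq_bigr => j _.
by rewrite mxE /cabs ReZ ImZ !normrM mulrDr.
Qed.

Lemma mxabsM A B : mxabs (A *m B) <= mxabs A * mxabs B.
Proof.
rewrite /mxabs.
apply: (@le_trans _ _ (\sum_i \sum_j \sum_k cabs (A i k) * cabs (B k j))).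
  apply: ler_sum => i _; apply: ler_sum => j _; rewrite mxE.
  by apply: le_trans (cabs_sum _ _ _) _; apply: ler_sum => k _; exact: cabsM.
rewrite big_distrl/=; apply: ler_sum => i _.
rewrite exchange_big/= big_distrl/=; apply: ler_sum => k _.
rewrite -big_distrr/= ler_wpM2l ?cabs_ge0// [leRHS](bigD1 k)//= lerDl.
by apply: sumr_ge0 => l _; apply: sumr_ge0 => j _; exact: cabs_ge0.
Qed.

Lemma mxabsM_le A B (a b : R) : mxabs A <= a -> mxabs B <= b ->
  mxabs (A *m B) <= a * b.
Proof.
move=> Aa Bb; apply: le_trans (mxabsM A B) _.
by apply: ler_pM => //; exact: mxabs_ge0.
Qed.

Lemma V_D A B : V (A + B) = V A + V B.
Proof. by rewrite /V mxtraceD ReD. Qed.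
Lemma V_N A : V (- A) = - V A.
Proof. by rewrite /V (raddfN (mxtrace : {additive 'M[R[i]]_n -> R[i]})) ReN. Qed.
Lemma V_B A B : V (A - B) = V A - V B.
Proof. by rewrite V_D V_N. Qed.
Lemma V_Z (a : R) A : V (a%:C *: A) = a * V A.
Proof. by rewrite /V mxtraceZ ReZ. Qed.
Lemma V_sum I (r : seq I) (P : pred I) (f : I -> 'M[R[i]]_n) :
  V (\sum_(i <- r | P i) f i) = \sum_(i <- r | P i) V (f i).
Proof.
apply: (big_morph _ V_D); rewrite /V (raddf0 (mxtrace : {additive 'M[R[i]]_n -> R[i]})).
by [].
Qed.
Lemma V_J A : V (A ^t*) = V A.
Proof.
rewrite /V /mxtrace !Re_sum; apply: eq_bigr => i _.
by rewrite !mxE ReJ.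
Qed.
Lemma V_C A B : V (A *m B) = V (B *m A).
Proof. by rewrite /V mxtrace_mulC. Qed.

Lemma V_le_mxabs A : `|V A| <= mxabs A.
Proof.
rewrite /V /mxtrace Re_sum; apply: le_trans (ler_norm_sum _ _ _) _.
apply: ler_sum => i _; rewrite (bigD1 i)//= /cabs -addrA lerDl.
by rewrite addr_ge0//; apply: sumr_ge0 => j _; exact: cabs_ge0.
Qed.

Lemma mxJM A B : (A *m B) ^t* = B ^t* *m A ^t*.
Proof. by rewrite trmx_mul map_mxM. Qed.
Lemma mxJD A B : (A + B) ^t* = A ^t* + B ^t*.
Proof. by rewrite linearD/= map_mxD. Qed.
Lemma mxJN A : (- A) ^t* = - A ^t*.
Proof. by rewrite linearN/= map_mxN. Qed.
Lemma mxJB A B : (A - B) ^t* = A ^t* - B ^t*.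
Proof. by rewrite mxJD mxJN. Qed.
Lemma mxJZ (a : R) A : (a%:C *: A) ^t* = a%:C *: A ^t*.
Proof. by apply/matrixP => i j; rewrite !mxE rmorphM/= conjCR. Qed.
Lemma mxJ1 : (1%:M : 'M[R[i]]_n) ^t* = 1%:M.
Proof. by rewrite trmx1 map_mx1. Qed.

(** The square of [enorm], differentiable everywhere and expressible through [V]. *)
Definition nsq A := \sum_i \sum_j (Re (A i j) ^+ 2 + Im (A i j) ^+ 2).

Lemma nsq_ge0 A : 0 <= nsq A.
Proof.
by apply: sumr_ge0 => i _; apply: sumr_ge0 => j _; rewrite addr_ge0// sqr_ge0.
Qed.

Lemma nsqE A : nsq A = V (A ^t* *m A).
Proof.
rewrite /nsq exchange_big/= /V /mxtrace Re_sum; apply: eq_bigr => j _.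
rewrite mxE Re_sum; apply: eq_bigr => i _.
by rewrite !mxE ReM ReJ ImJ; ring.
Qed.

Lemma nsq_eq0 A : nsq A = 0 -> A = 0.
Proof.
move=> /eqP; rewrite psumr_eq0; last first.
  by move=> i _; apply: sumr_ge0 => j _; rewrite addr_ge0// sqr_ge0.
move=> /allP A0; apply/matrixP => i j; move: (A0 i (mem_index_enum _)) => /=.
rewrite psumr_eq0; last by move=> k _; rewrite addr_ge0// sqr_ge0.
move=> /allP /(_ j (mem_index_enum _)) /=; rewrite paddr_eq0 ?sqr_ge0// !sqrf_eq0.
by move=> /andP[/eqP a /eqP b]; rewrite mxE; apply: cplx_eqP.
Qed.

(** Cauchy-Schwarz costs a factor [n] for each of the two sums and 2 for the real and imaginary
    parts. *)
Lemma mxabs_sqr_le A : mxabs A ^+ 2 <= (2 * n%:R ^+ 2) * nsq A.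
Proof.
have sqs (I : finType) (f : I -> R) :
    (\sum_i f i) ^+ 2 <= #|I|%:R * \sum_i f i ^+ 2.
  have -> : (\sum_i f i) ^+ 2 = \sum_i \sum_j f i * f j.
    by rewrite expr2 big_distrl/=; apply: eq_bigr => i _; rewrite big_distrr.
  have -> : #|I|%:R * \sum_i f i ^+ 2 = \sum_i \sum_j (f i ^+ 2 + f j ^+ 2) / 2.
    under [RHS]eq_bigr do rewrite -big_distrl/= big_split/= sumr_const.
    rewrite -big_distrl/= big_split/= sumr_const -mulr_natl -[X in _ + X]mulr_natl.
    under [X in X + _]eq_bigr do rewrite -mulr_natl.
    by rewrite -big_distrr/=; lra.
  apply: ler_sum => i _; apply: ler_sum => j _.
  by have := sqr_ge0 (f i - f j); rewrite sqrrB; lra.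
have cs x : cabs x ^+ 2 <= 2 * (Re x ^+ 2 + Im x ^+ 2).
  rewrite /cabs -[X in _ <= 2 * (X + _)](real_normK (num_real _)) -[X in _ <= 2 * (_ + X)](real_normK (num_real _)).
  by have := sqr_ge0 (`|Re x| - `|Im x|); rewrite sqrrB sqrrD; lra.
rewrite /mxabs /nsq; apply: le_trans (sqs _ _) _; rewrite card_ord.
rewrite expr2 [2 * _]mulrC -!mulrA ler_wpM2l// big_distrr/= big_distrr/=.
apply: ler_sum => i _; apply: le_trans (sqs _ _) _; rewrite card_ord ler_wpM2l//.
by rewrite big_distrr/=; apply: ler_sum => j _.
Qed.

Lemma enormE A : enorm A = Num.sqrt (nsq A). Proof. by []. Qed.

Lemma nsqUl U A : U \is unitarymx -> nsq (U *m A) = nsq A.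
Proof.
move=> /mulmxKtV h; rewrite !nsqE mxJM mulmxA.
by congr (V (_ *m _)); apply: h.
Qed.

End Norms.

(** * SU(n), its Lie algebra and invariance under flows *)

Section SpecialUnitary.
Context {R : realType} {n : nat}.
Implicit Types (A B U : 'M[R[i]]_n).

Lemma unitaryP U : U *m U ^t* = 1%:M -> U ^t* *m U = 1%:M.
Proof. by move=> h; apply: mulmx1C. Qed.

Lemma SU_mulJ U : SU U -> U *m U ^t* = 1%:M.
Proof. by move=> [/unitarymxP]. Qed.

Lemma SU_Jmul U : SU U -> U ^t* *m U = 1%:M.
Proof. by move=> /SU_mulJ/unitaryP. Qed.

Lemma SU1 : SU (1%:M : 'M[R[i]]_n).
Proof. by split; rewrite ?det1//; apply/unitarymxP; rewrite mxJ1 mulmx1. Qed.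

Lemma SU_J U : SU U -> SU (U ^t*).
Proof.
move=> [uU dU]; split; first by rewrite trmxC_unitary.
by rewrite det_map_mx det_tr dU rmorph1.
Qed.

Lemma SU_M U B : SU U -> SU B -> SU (U *m B).
Proof.
move=> [uU dU] [uB dB]; split; first exact: mul_unitarymx.
by rewrite det_mulmx dU dB mulr1.
Qed.

Lemma SU_nsq U : SU U -> nsq U = n%:R.
Proof. by move=> /SU_Jmul h; rewrite nsqE h /V mxtrace1 raddfMn. Qed.

(** [mxabs_sqr_le] bounds the square by [2 n ^ 3]; the rougher [2 n ^ 2] is chosen because it is
    also the constant of that lemma, so a single [b] serves both estimates later. *)
Lemma SU_mxabs U : SU U -> mxabs U <= 2 * n%:R ^+ 2.
Proof.
move=> sU; have := mxabs_sqr_le U; rewrite (SU_nsq sU) => h.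
have [n0|n0] := posnP n.
  by move: U sU h; rewrite n0 => U _ _; rewrite /mxabs big_ord0 expr0n mulr0.
have n1 : 1 <= n%:R :> R by rewrite ler1n.
rewrite -(@ler_pXn2r _ 2) ?nnegrE ?mxabs_ge0 ?mulr_ge0 ?exprn_ge0//.
apply: le_trans h _; rewrite exprMn.
have : 0 <= (n%:R : R) ^+ 2 * (n%:R ^+ 2 * 4 - n%:R * 2).
  by apply: mulr_ge0; [rewrite exprn_ge0|nra].
lra.
Qed.

Lemma V_le_n U : SU U -> V U <= n%:R.
Proof.
move=> sU; have := nsq_ge0 (U - 1%:M).
rewrite nsqE mxJB mulmxBr !mulmxBl mxJ1 SU_Jmul// !mul1mx mulmx1 !V_B V_J.
by rewrite /V mxtrace1 raddfMn/=; lra.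
Qed.

(** [n - V] is thus half the squared distance to the identity, and [V U] tending to [n] means that
    [U] tends to 1. *)
Lemma nsq_sub1 U : SU U -> nsq (U - 1%:M) = 2 * (n%:R - V U).
Proof.
move=> sU; rewrite nsqE mxJB mulmxBr !mulmxBl mxJ1 SU_Jmul// !mul1mx mulmx1 !V_B V_J.
by rewrite /V mxtrace1 raddfMn/=; lra.
Qed.

Lemma su_Z (a : R) A : su A -> su (a%:C *: A).
Proof. by move=> [h t]; split; rewrite ?mxJZ ?h ?scalerN// mxtraceZ t mulr0. Qed.

Lemma su_D A B : su A -> su B -> su (A + B).
Proof.
by move=> [h t] [h' t']; split; rewrite ?mxJD ?h ?h' -?opprD// mxtraceD t t' addr0.
Qed.

Lemma su_N A : su A -> su (- A).
Proof. by move=> /(su_Z (-1)); rewrite rmorphN rmorph1 scaleN1r. Qed.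

Lemma su_0 : su (0 : 'M[R[i]]_n).
Proof. by split; rewrite ?trmx0 ?map_mx0 ?oppr0//; exact: mxtrace0. Qed.

Lemma su_sum I (r : seq I) (f : I -> 'M[R[i]]_n) :
  (forall i, su (f i)) -> su (\sum_(i <- r) f i).
Proof.
by move=> h; elim/big_ind : _ => [||i _]; [exact: su_0|exact: su_D|exact: h].
Qed.

Lemma su_conj U A : SU U -> su A -> su (U ^t* *m A *m U).
Proof.
move=> sU [h t]; split.
  by rewrite !mxJM trmxCK h mulNmx mulmxN mulmxA.
by rewrite mxtrace_mulC mulmxA SU_mulJ// mul1mx.
Qed.

Lemma su_generator m (H : 'I_m -> 'M[R[i]]_n) (u : 'I_m -> R -> R) (t : R) :
  (forall k, su (H k)) -> su (generator H u t).
Proof. by move=> sH; apply: su_sum => k; exact: su_Z. Qed.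

(** Taking adjoints changes the sign. This removes the unbounded drift term in the uniqueness proof
    for the closed loop. *)
Lemma V_skew_cst (S P : 'M[R[i]]_n) : S ^t* = - S -> P ^t* = P -> V (P *m S) = 0.
Proof.
move=> hS hP; have : V (P *m S) = - V (P *m S).
  by rewrite -{1}V_J mxJM hS hP mulNmx V_N V_C.
by move=> ?; lra.
Qed.

Lemma cder0_cst (f : R -> R[i]) : (forall t, cder t f 0) -> forall s t, f s = f t.
Proof.
move=> f0 s t; apply: cplx_eqP.
  exact: (@is_derive_0_is_cst _ (fun s => complex.Re (f s)) s t (fun r => (f0 r).1)).
exact: (@is_derive_0_is_cst _ (fun s => complex.Im (f s)) s t (fun r => (f0 r).2)).
Qed.

Lemma mx_der0_cst (A : R -> 'M[R[i]]_n) :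
  (forall t, mx_is_derive A t 0) -> forall s t, A s = A t.
Proof.
move=> A0 s t; apply/matrixP => i j.
apply: (@cder0_cst (fun s => A s i j)) => r.
by have := A0 r i j; rewrite mxE.
Qed.

(* (X^* X)' = X^* (A^* + A) X = 0 and (det X)' = det X tr A = 0. *)
Lemma SU_preserved (A X : R -> 'M[R[i]]_n) (t0 : R) :
  (forall t, su (A t)) -> solves_line (fun t Y => A t *m Y) X -> SU (X t0) ->
  forall t, SU (X t).
Proof.
move=> sA sX X0 t.
have unit_ s : (X s) ^t* *m X s = 1%:M.
  have d r : mx_is_derive (fun s => (X s) ^t* *m X s) r 0.
    apply: mx_der_eq (mx_derM (mx_derJ (sX r)) (sX r)) _.
    by have [h _] := sA r; rewrite mxJM h mulmxN mulNmx mulmxA addNr.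
  by rewrite -(SU_Jmul X0); exact: (mx_der0_cst d s t0).
split; first by apply/unitarymxP; exact: mulmx1C.
have d r : cder r (fun s => \det (X s)) 0.
  have := det_der (sX r); rewrite -mulmxA mul_mx_adj mul_mx_scalar mxtraceZ.
  by have [_ ->] := sA r; rewrite mulr0.
by have [_ <-] := X0; exact: (cder0_cst d t t0).
Qed.

Lemma SU_preserved_right (A X : R -> 'M[R[i]]_n) (t0 : R) :
  (forall t, su (A t)) -> solves_line (fun t Y => Y *m A t) X -> SU (X t0) ->
  forall t, SU (X t).
Proof.
move=> sA sX X0 t; rewrite -[X t]trmxCK; apply: SU_J.
apply: (@SU_preserved (fun t => - A t) (fun t => (X t) ^t*) t0) => //.
- by move=> s; exact: su_N.
- move=> s; apply: mx_der_eq (mx_derJ (sX s)) _.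
  by have [h _] := sA s; rewrite mxJM h.
- exact: SU_J.
Qed.

Lemma SU_cvg {T : Type} (F : set_system T) {FF : ProperFilter F}
    (X : T -> 'M[R[i]]_n) (L : 'M[R[i]]_n) :
  (forall x, SU (X x)) -> mx_cvg F X L -> SU L.
Proof.
move=> sX XL; split.
  have h1 : mx_cvg F (fun x => X x *m (X x) ^t*) (L *m L ^t*).
    by apply: mx_cvgM => //; exact: mx_cvgJ.
  have h2 : mx_cvg F (fun x => X x *m (X x) ^t*) 1%:M.
    by under eq_fun do rewrite (SU_mulJ (sX _)); exact: mx_cvg_cst.
  by apply/unitarymxP; exact: mx_cvg_eq h1 h2.
have [d1 d2] := det_cvg XL.
apply: cplx_eqP.
  have e1 : complex.Re (\det (X x)) @[x --> F] --> complex.Re (1 : R[i]).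
    by under eq_fun do rewrite (sX _).2; exact: cvg_cst.
  exact: cvg_unique d1 e1.
have e2 : complex.Im (\det (X x)) @[x --> F] --> complex.Im (1 : R[i]).
  by under eq_fun do rewrite (sX _).2; exact: cvg_cst.
exact: cvg_unique d2 e2.
Qed.

End SpecialUnitary.

(** * The number delta *)

Section DeltaSpec.
Context {R : realType}.
Local Notation Re := complex.Re.
Local Notation Im := complex.Im.

Lemma finite_max (s : seq R) (P : set R) :
  (forall x, P x -> x \in s) -> P !=set0 -> exists d, P d /\ ubound P d.
Proof.
elim: s P => [|x s IH] P Ps [y Py]; first by have := Ps y Py.
have [e|/existsNP[z /not_implyP[Pz zx]]] := pselect (forall z, P z -> z = x).
  exists y; split=> // z Pz; by rewrite (e z Pz) (e y Py).
have [||d [[Pd dx] ub]] := IH (fun z => P z /\ z <> x).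
- by move=> w [/Ps]; rewrite inE => /predU1P[].
- by exists z.
have ub' w : P w -> w <= Num.max d x.
  move=> Pw; rewrite le_max; have [->|wx] := eqVneq w x; first by rewrite lexx orbT.
  by rewrite ub//; split=> //; exact/eqP.
have [Px|nPx] := pselect (P x).
  exists (Num.max d x); split; last exact: ub'.
  by case: (leP x d).
exists d; split=> // w Pw; apply: ub; split=> // wx.
by apply: nPx; rewrite -wx.
Qed.

Lemma norm1P (z : R[i]) : `|z| = 1 <-> Re z ^+ 2 + Im z ^+ 2 = 1.
Proof.
have e := add_Re2_Im2 z; split=> h.
  by move: e; rewrite h expr1n => /(congr1 (@complex.Re R)).
by move: e; rewrite h => /esym/eqP; rewrite (_ : 1%:C = 1)// sqrp_eq1// => /eqP.
Qed.

Lemma norm1_mulJ (z : R[i]) : `|z| = 1 -> z * Num.conj z = 1.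
Proof. by move=> h; rewrite -normCK h expr1n. Qed.

(* With equal imaginary parts each lam j is z or - conj z, so prod lam j = 1
   makes z a root of unity of order dividing 2 n! unless the two values occur
   equally often, in which case the sum vanishes. *)
Lemma Gset_finite n : (2 <= n)%N -> exists s : seq R, forall g, @Gset R n g -> g \in s.
Proof.
move=> n2; pose K := (2 * n`!)%N.
have K0 : (0 < K)%N by rewrite muln_gt0 fact_gt0.
have [rs rsE] := closed_field_poly_normal ('X^K - 1 : {poly R[i]}).
exists (0 :: [seq (ab.1%:R - ab.2%:R) * Re z |
  ab <- [seq (a, b) | a <- iota 0 n.+1, b <- iota 0 n.+1], z <- rs]).
move=> g [lam [lam1 lamP lamI ->]].
pose i0 : 'I_n := Ordinal (ltn_trans (ltnSn 0) n2); pose z := lam i0.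
pose P j := lam j == z; pose p := #|P|; pose q := #|predC P|.
have pq : (p + q)%N = n by rewrite cardC card_ord.
have nP j : ~~ P j -> lam j = - Num.conj z.
  move=> jP; have Ij := lamI j i0.
  have /norm1P := lam1 j; have /norm1P := lam1 i0; rewrite Ij -/z => h1 h2.
  have : Re (lam j) ^+ 2 = Re z ^+ 2 by lra.
  move=> /eqP; rewrite eqf_sqr => /orP[/eqP Rj|/eqP Rj].
    by exfalso; move/negP: jP; apply; apply/eqP/cplx_eqP.
  by apply: cplx_eqP; rewrite ?ReN ?ImN ?ReJ ?ImJ ?opprK.
have -> : \sum_i Re (lam i) = (p%:R - q%:R) * Re z.
  rewrite (bigID P)/= mulrBl; congr (_ + _).
    rewrite (eq_bigr (fun=> Re z)); last by move=> j /eqP ->.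
    by rewrite sumr_const mulr_natl.
  rewrite (eq_bigr (fun=> - Re z)); last by move=> j /nP ->; rewrite ReN ReJ.
  by rewrite sumr_const mulNrn mulr_natl.
(* The product condition reads [z ^ p (- conj z) ^ q = 1]. Multiplying by [z ^ q] leaves
   [z ^ p (-1) ^ q = z ^ q], and squaring removes the sign. *)
have zpq : z ^+ (2 * p) = z ^+ (2 * q).
  move: lamP; rewrite (bigID P)/= (eq_bigr (fun=> z)); last by move=> j /eqP ->.
  rewrite [X in _ * X](eq_bigr (fun=> - Num.conj z)); last by move=> j /nP ->.
  rewrite !prodr_const -/p => h.
  have {}h : z ^+ p * (- 1) ^+ q = z ^+ q.
    rewrite -[RHS]mul1r -[in RHS]h -mulrA -exprMn mulNr [Num.conj z * z]mulrC.
    by rewrite norm1_mulJ//; exact: lam1.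
  have e2 m : z ^+ (2 * m) = (z ^+ m) ^+ 2 by rewrite mulnC exprM.
  by rewrite !e2 -h exprMn -[X in _ * X]exprM [(q * 2)%N]mulnC exprM sqrrN !expr1n mulr1.
have z1 : `|z| = 1 by exact: lam1.
have z0 : z != 0 by rewrite -normr_eq0 z1 oner_eq0.
have cancel a b : (a < b <= n)%N -> z ^+ (2 * a) = z ^+ (2 * b) -> z ^+ K = 1.
  move=> /andP[ab bn] h.
  have h1 : z ^+ (2 * (b - a)) = 1.
    apply: (@mulfI _ (z ^+ (2 * a))); first by rewrite expf_neq0.
    by rewrite mulr1 -exprD -mulnDr subnKC ?h// ltnW.
  have /dvdnP[k kE] : (2 * (b - a) %| K)%N.
    rewrite dvdn_pmul2l// dvdn_fact// subn_gt0 ab/=.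
    by apply: leq_trans (leq_subr _ _) bn.
  by rewrite kE mulnC exprM h1 expr1n.
have [pqE|pqN] := eqVneq p q.
  by rewrite pqE subrr mul0r inE eqxx.
have zK : z ^+ K = 1.
  move: pqN; rewrite neq_ltn => /orP[h|h].
    by apply: (cancel p q) => //; rewrite h -pq leq_addl.
  by apply: (cancel q p) => //; rewrite h -pq leq_addr.
have zrs : z \in rs.
  have : root ('X^K - 1) z by rewrite rootE !hornerE zK subrr.
  rewrite rsE rootZ; first by rewrite root_prod_XsubC.
  by rewrite lead_coef_eq0 -size_poly_eq0 size_XnsubC.
rewrite inE; apply/orP; right; apply/allpairsP; exists ((p, q), z); split=> //.
apply/allpairsP; exists (p, q); split=> //; by rewrite mem_iota/= add0n ltnS -pq ?leq_addr ?leq_addl.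
Qed.

(** A root z of [1 + X + ... + X ^ (n - 1)] is an n-th root of unity other than 1. Taking all
    [lam j] equal to z gives [n Re z], and [Re z = 1] with modulus 1 would force z = 1. *)
Lemma Gset_lt_n n : (2 <= n)%N -> (@Gset R n `\ n%:R) !=set0.
Proof.
move=> n2; pose p : {poly R[i]} := \poly_(i < n) 1.
have sp : size p = n.
  by apply: size_poly_eq; rewrite oner_eq0.
have /closed_rootP[z rz] : size p != 1%N by rewrite sp gtn_eqF.
have {}rz : \sum_(i < n) z ^+ i = 0.
  move: rz; rewrite rootE horner_poly => /eqP h; rewrite -[RHS]h.
  by apply: eq_bigr => i _; rewrite mul1r.
have zn : z ^+ n = 1 by apply/eqP; rewrite -subr_eq0 subrX1 rz mulr0.
have n0 : (0 < n)%N by exact: ltn_trans n2.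
have z1 : `|z| = 1.
  by apply/eqP; rewrite -(@pexpr_eq1 _ _ n)// -normrX zn normr1.
exists (n%:R * Re z); split.
  exists (fun=> z); split=> //.
    by rewrite prodr_const card_ord.
  by rewrite sumr_const card_ord mulr_natl.
have nR0 : (n%:R : R) != 0 by rewrite pnatr_eq0 -lt0n.
move=> /= h; have Rz : Re z = 1.
  by apply: (mulfI nR0); rewrite mulr1.
have Iz : Im z = 0.
  have /norm1P := z1; rewrite Rz => h1; apply/eqP; rewrite -sqrf_eq0; apply/eqP; lra.
have ze : z = 1 by apply: cplx_eqP.
move: rz; rewrite ze; under eq_bigr do rewrite expr1n.
by rewrite sumr_const card_ord => /eqP; rewrite pnatr_eq0 -[_ == _]negbK -lt0n n0.
Qed.

Lemma deltaP n : (2 <= n)%N ->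
  (@Gset R n `\ n%:R) (delta R n) /\ ubound (@Gset R n `\ n%:R) (delta R n).
Proof.
move=> n2; have [s hs] := Gset_finite n2.
have [|d hd] := @finite_max s _ _ (Gset_lt_n n2).
  by move=> x [/hs].
by have := @getPex _ [set d | (@Gset R n `\ n%:R) d /\ ubound (@Gset R n `\ n%:R) d]
  (ex_intro _ d hd).
Qed.

Lemma delta_lt n : (2 <= n)%N -> delta R n < n%:R.
Proof.
move=> n2; have [[[lam [l1 _ _ ->]]] dn _] := deltaP n2.
rewrite lt_neqAle; apply/andP; split; first exact/eqP.
have -> : n%:R = \sum_(i < n) (1 : R) by rewrite sumr_const card_ord.
apply: ler_sum => i _; have /norm1P h := l1 i.
have := sqr_ge0 (Im (lam i)); move: (Re _) (Im _) h => a b; nra.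
Qed.

Lemma delta_max n (g : R) : (2 <= n)%N -> @Gset R n g -> delta R n < g -> g = n%:R.
Proof.
move=> n2 Gg dg; apply/eqP; apply: contraTT dg => gn.
by rewrite -leNgt; have [_] := deltaP n2; apply; split=> //; exact/eqP.
Qed.

End DeltaSpec.

(** * Diagonalization and critical points of V *)

Section Spectral.
Context {R : realType} {n : nat}.
Implicit Types (Y P : 'M[R[i]]_n).
Local Notation Re := complex.Re.
Local Notation Im := complex.Im.

Lemma SU_diag Y : SU Y -> exists P (d : 'rV[R[i]]_n),
  [/\ P \is unitarymx, Y = P ^t* *m diag_mx d *m P,
      forall j, `|d 0 j| = 1 & \prod_j d 0 j = 1].
Proof.
move=> sY; have nY : Y \is normalmx by apply/normalmxP; rewrite SU_mulJ// SU_Jmul.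
have uP := spectral_unitarymx Y.
have /orthomx_spectralP YE := nY.
rewrite /= invmx_unitary// in YE.
set P := spectralmx Y in uP YE; set d := spectral_diag Y in YE.
have PP : P *m P ^t* = 1%:M by exact/unitarymxP.
have PP' := unitaryP PP.
have dE : diag_mx d = P *m Y *m P ^t*.
  by rewrite YE !mulmxA PP mul1mx -mulmxA PP mulmx1.
exists P, d; split=> //.
  move=> j; have : diag_mx d *m (diag_mx d) ^t* = 1%:M.
    rewrite dE !mxJM trmxCK -!mulmxA [P ^t* *m (P *m _)]mulmxA PP' mul1mx.
    by rewrite [Y *m (_ *m _)]mulmxA SU_mulJ// mul1mx PP.
  move=> /matrixP /(_ j j); rewrite mxE (bigD1 j)//= big1.
    rewrite !mxE eqxx !mulr1n addr0 -normCK => /eqP.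
    by rewrite sqrp_eq1// => /eqP.
  by move=> k kj; rewrite !mxE eq_sym (negPf kj) mulr0n mul0r.
have := det_diag d; rewrite dE !det_mulmx mulrAC -det_mulmx PP det1 mul1r.
by case: sY => _ -> <-.
Qed.

Lemma V_diag P (d : 'rV[R[i]]_n) : P \is unitarymx ->
  V (P ^t* *m diag_mx d *m P) = \sum_j Re (d 0 j).
Proof.
move=> /unitarymxP PP; rewrite V_C mulmxA PP mul1mx /V mxtrace_diag Re_sum.
by apply: eq_bigr.
Qed.

(* [V (Y A) = 0] for all A in su(n), applied to the traceless part A of Y - Y^*,
   gives nsq A = 0. *)
Lemma Gset_critical Y : (2 <= n)%N -> SU Y -> (forall A, su A -> V (Y *m A) = 0) ->
  @Gset R n (V Y).
Proof.
move=> n2 sY Y0; pose K := Y - Y ^t*.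
pose c := \tr K / n%:R; pose A := K - c%:M.
have n0 : (n%:R : R[i]) != 0 by rewrite pnatr_eq0 -lt0n (ltn_trans _ n2).
have KJ : K ^t* = - K by rewrite mxJB trmxCK opprB.
have cJ : Num.conj c = - c.
  rewrite /c rmorphM/= fmorphV/= rmorph_nat -mulNr; congr (_ / _).
  have -> : Num.conj (\tr K) = \tr (K ^t*).
    by rewrite /mxtrace rmorph_sum/=; apply: eq_bigr => j _; rewrite !mxE.
  by rewrite KJ; exact: (raddfN (mxtrace : {additive 'M[R[i]]_n -> R[i]})).
have cMJ : (c%:M : 'M[R[i]]_n) ^t* = - c%:M.
  by rewrite tr_scalar_mx map_scalar_mx/= cJ raddfN.
have sA : su A.
  split; first by rewrite /A (mxJB K) KJ cMJ opprK (opprB K) addrC.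
  have trB : \tr A = \tr K - \tr (c%:M : 'M[R[i]]_n).
    exact: (raddfB (mxtrace : {additive 'M[R[i]]_n -> R[i]})).
  apply: (eq_trans trB); by rewrite mxtrace_scalar -mulr_natr /c mulfVK// subrr.
have A0 : A = 0.
  (* [nsq A = - V (A A)] with [A A = K A - c A]: the hypothesis on [Y] and its adjoint kill
     [V (K A)], and [\tr A = 0] kills the other term. *)
  apply: nsq_eq0; rewrite nsqE; have [AJ At] := sA; rewrite AJ mulNmx V_N.
  have h1 : V (Y *m A) = 0 by exact: Y0.
  have h2 : V (Y ^t* *m A) = 0.
    by rewrite -V_J mxJM trmxCK AJ mulNmx V_N V_C h1 oppr0.
  have -> : A *m A = K *m A - c *: A by rewrite {1}/A mulmxBl mul_scalar_mx.
  rewrite V_B mulmxBl V_B h1 h2 subrr sub0r opprK.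
  by rewrite /V mxtraceZ At mulr0.
have [P [d [uP YE d1 dp]]] := SU_diag sY.
exists (fun j => d 0 j); split=> //; last by rewrite {1}YE V_diag.
have PP : P *m P ^t* = 1%:M by exact/unitarymxP.
have PP' := unitaryP PP.
(* Conjugated by [P], the identity [Y - Y^* = c] says that each eigenvalue minus its conjugate is
   [c], so all imaginary parts agree. *)
have hI j : Im (d 0 j) = Im c / 2.
  have : diag_mx d - (diag_mx d) ^t* = c%:M.
    have -> : diag_mx d = P *m Y *m P ^t*.
      by rewrite YE !mulmxA PP mul1mx -mulmxA PP mulmx1.
    rewrite !mxJM trmxCK -mulmxA -mulmxBr -mulmxBl -/K.
    have -> : K = c%:M by apply/eqP; rewrite -subr_eq0; apply/eqP.
    by rewrite mulmxA mul_mx_scalar -scalemxAl PP scale_scalar_mx mulr1.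
  move=> /matrixP/(_ j j)/(congr1 (@complex.Im R)).
  by rewrite !mxE eqxx !mulr1n ImD ImN ImJ; lra.
by move=> i j; rewrite !hI.
Qed.

End Spectral.

(** * Smoothness *)

Section Smoothness.
Context {R : realType}.
Local Notation Re := complex.Re.
Local Notation Im := complex.Im.

(** The algebra generated by [S] and the constants. If the generators have their derivatives in it,
    it is stable under differentiation, so all its members are smooth and no formula for higher
    derivatives is required. *)
Inductive gen (S : set (R -> R)) : (R -> R) -> Prop :=
| gen_in g of S g : gen S g
| gen_cst c : gen S (fun=> c)
| genD f g of gen S f & gen S g : gen S (fun t => f t + g t)
| genM f g of gen S f & gen S g : gen S (fun t => f t * g t).

Variable S : set (R -> R).

Lemma genN f : gen S f -> gen S (fun t => - f t).
Proof.
move=> Sf; have := genM (gen_cst S (-1)) Sf.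
by under eq_fun do rewrite mulN1r.
Qed.

Definition genc (f : R -> R[i]) :=
  gen S (fun t => Re (f t)) /\ gen S (fun t => Im (f t)).

Lemma genc_cst c : genc (fun=> c).
Proof. by split; exact: gen_cst. Qed.

Lemma gencD f g : genc f -> genc g -> genc (fun t => f t + g t).
Proof.
move=> [f1 f2] [g1 g2]; split; under eq_fun do rewrite ?ReD ?ImD; exact: genD.
Qed.

Lemma gencM f g : genc f -> genc g -> genc (fun t => f t * g t).
Proof.
move=> [f1 f2] [g1 g2]; split; under eq_fun do rewrite ?ReM ?ImM; apply: genD.
- exact: genM.
- by apply: genN; exact: genM.
- exact: genM.
- exact: genM.
Qed.

Lemma gencJ f : genc f -> genc (fun t => Num.conj (f t)).
Proof.
move=> [f1 f2]; split.
  by under eq_fun do rewrite ReJ.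
by under eq_fun do rewrite ImJ; exact: genN.
Qed.

Lemma genc_sum I (r : seq I) (f : I -> R -> R[i]) :
  (forall i, genc (f i)) -> genc (fun t => \sum_(i <- r) f i t).
Proof.
move=> fg; elim: r => [|i r IH].
  by under eq_fun do rewrite big_nil; exact: genc_cst.
by under eq_fun do rewrite big_cons; exact: gencD.
Qed.

Context {n : nat}.
Implicit Types (A B : R -> 'M[R[i]]_n).

Definition genmx A := forall i j, genc (fun t => A t i j).

Lemma genmx_cst L : genmx (fun=> L).
Proof. by move=> i j; exact: genc_cst. Qed.

Lemma genmxD A B : genmx A -> genmx B -> genmx (fun t => A t + B t).
Proof.
by move=> gA gB i j; under eq_fun do rewrite mxE; exact: gencD.
Qed.

Lemma genmxM A B : genmx A -> genmx B -> genmx (fun t => A t *m B t).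
Proof.
move=> gA gB i j; under eq_fun do rewrite mxE.
by apply: genc_sum => k; exact: gencM.
Qed.

Lemma genmxN A : genmx A -> genmx (fun t => - A t).
Proof.
move=> gA; have := genmxM (genmx_cst (- 1%:M)) gA.
by under eq_fun do rewrite mulNmx mul1mx.
Qed.

Lemma genmxJ A : genmx A -> genmx (fun t => (A t) ^t*).
Proof. by move=> gA i j; under eq_fun do rewrite !mxE; exact: gencJ. Qed.

Lemma genmxZ a A : gen S a -> genmx A -> genmx (fun t => (a t)%:C *: A t).
Proof.
move=> ga gA i j; under eq_fun do rewrite mxE; apply: gencM => //.
by split=> //=; exact: gen_cst.
Qed.

Lemma genmx_sum I (r : seq I) (A : I -> R -> 'M[R[i]]_n) :
  (forall i, genmx (A i)) -> genmx (fun t => \sum_(i <- r) A i t).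
Proof.
move=> gA i j; under eq_fun do rewrite summxE.
by apply: genc_sum => k; exact: gA.
Qed.

Lemma gen_V A : genmx A -> gen S (fun t => V (A t)).
Proof.
by move=> gA; have [] := @genc_sum _ (index_enum 'I_n) (fun i t => A t i i)
  (fun i => gA i i).
Qed.

Hypothesis S_derivable : forall g, S g ->
  exists2 dg : R -> R, (forall t : R, is_derive t 1 g (dg t)) & gen S dg.

Lemma gen_derivable g : gen S g ->
  exists2 dg : R -> R, (forall t : R, is_derive t 1 g (dg t)) & gen S dg.
Proof.
elim=> {g} [g /S_derivable//|c|f g Sf [df fd gdf] Sg [dg gd gdg]|
  f g Sf [df fd gdf] Sg [dg gd gdg]].
- by exists (fun=> 0) => [t|]; [exact: is_derive_cst|exact: gen_cst].
- exists (fun t => df t + dg t); last exact: genD.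
  by move=> t; exact: (is_deriveD (fd t) (gd t)).
- exists (fun t => df t * g t + f t * dg t).
    by move=> t; exact: is_deriveM'.
  by apply: genD; exact: genM.
Qed.

Lemma gen_derive1 g : gen S g ->
  (forall t : R, is_derive t 1 g (derive1 g t)) /\ gen S (derive1 g).
Proof.
move=> /gen_derivable[dg gd gdg].
have e : derive1 g = dg.
  by apply/funext => t; rewrite derive1E; have [] := gd t.
by rewrite e.
Qed.

Lemma gen_smooth g : gen S g -> smooth g.
Proof.
move=> Sg j; suff Sj : gen S (derive1n j g).
  by move=> t; have [/(_ t)[]] := gen_derive1 Sj.
elim: j => // j IH; rewrite derive1nS; exact: (gen_derive1 IH).2.
Qed.

Lemma genmx_derive A : genmx A ->
  (forall t, mx_is_derive A t (mx_derive A t)) /\ genmx (mx_derive A).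
Proof.
move=> gA; split.
  move=> t i j; have [g1 g2] := gA i j; rewrite mxE/=.
  by split; [exact: (gen_derive1 g1).1|exact: (gen_derive1 g2).1].
move=> i j; have [g1 g2] := gA i j; split; under eq_fun do rewrite mxE/=.
  exact: (gen_derive1 g1).2.
exact: (gen_derive1 g2).2.
Qed.

End Smoothness.

Section Base.
Context {R : realType} {n m : nat} {I : Type}.
Variables (u : 'I_m -> R -> R) (X : I -> R -> 'M[R[i]]_n).

(** All derivatives of the controls, and the entries of a family of curves; the curves need no
    derivatives among the generators because each one satisfies an equation polynomial in the
    generators. *)
Definition gbase : set (R -> R) := [set g |
  (exists k j, g = derive1n j (u k)) \/
  (exists a i j, g = (fun t => complex.Re (X a t i j)) \/
                 g = (fun t => complex.Im (X a t i j)))].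

Lemma gbase_u k : gen gbase (u k).
Proof. by apply: gen_in; left; exists k, 0%N. Qed.

Lemma gbase_X a : genmx gbase (X a).
Proof.
by move=> i j; split; apply: gen_in; right; exists a, i, j; [left|right].
Qed.

Lemma gbase_derivable : (forall k, smooth (u k)) ->
  (forall a, exists2 Y, (forall t, mx_is_derive (X a) t (Y t)) & genmx gbase Y) ->
  forall g, gbase g -> exists2 dg : R -> R, (forall t : R, is_derive t 1 g (dg t)) & gen gbase dg.
Proof.
move=> su sX g [[k [j ->]]|[a [i [j gE]]]].
  exists (derive1n j.+1 (u k)); last by apply: gen_in; left; exists k, j.+1.
  by move=> t; apply: DeriveDef; [exact: su|rewrite derive1nS derive1E].
have [Y XY gY] := sX a; have [g1 g2] := gY i j.
case: gE => ->.
  by exists (fun t => complex.Re (Y t i j)) => // t; have [] := XY t i j.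
by exists (fun t => complex.Im (Y t i j)) => // t; have [] := XY t i j.
Qed.

Lemma gbase_generator (H : 'I_m -> 'M[R[i]]_n) : genmx gbase (generator H u).
Proof.
apply: genmx_sum => k; apply: genmxZ; [exact: gbase_u|exact: genmx_cst].
Qed.

End Base.

(** [mx_derive] has a meaning only for differentiable entries; every [Bmx] lies in the generated
    algebra, so in the recursion defining it [mx_derive] is a genuine derivative. *)
Lemma Bmx_derive {R : realType} {n m : nat} (H : 'I_m -> 'M[R[i]]_n)
    (u : 'I_m -> R -> R) (X : R -> 'M[R[i]]_n) k j t :
  (forall k, smooth (u k)) -> solves_line (fun t Y => generator H u t *m Y) X ->
  mx_is_derive (Bmx H u X k j) t (mx_derive (Bmx H u X k j) t).
Proof.
move=> su sX; pose S := gbase u (fun _ : unit => X).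
have gA : genmx S (generator H u) by exact: gbase_generator.
have gX : genmx S X by exact: (@gbase_X _ _ _ _ u (fun _ : unit => X) tt).
have dS : forall g, S g -> exists2 dg : R -> R, (forall t : R, is_derive t 1 g (dg t)) & gen S dg.
  apply: gbase_derivable => // _; exists (fun t => generator H u t *m X t) => //.
  exact: genmxM.
suff gB : genmx S (Bmx H u X k j) by exact: (genmx_derive dS gB).1.
elim: j => [|j IH]; first by apply: genmxM => //; exact: genmx_cst.
apply: genmxD; last exact: (genmx_derive dS IH).2.
by apply: genmxN; exact: genmxM.
Qed.

(** * The auxiliary system with time-varying gains *)

(** The scalar part of [damped_lipschitz]: [w], [z], [d] stand for [mxabs] of W, Z, W - Z, [NW] and
    [NZ] for [nsq], and [a / (1 + NW)] for the damping. The point is that [w / (1 + NW)] and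
    [z ^ 2 / (1 + NZ)] stay bounded; the two terms contribute [1 + b] and [(1 + b) b], whose sum is
    [(1 + b) ^ 2]. *)
Lemma damping_arith {R : realType} (w z d b c NW NZ a p q : R) :
  0 <= w -> 0 <= z -> 0 <= d -> z <= w -> 0 <= b -> 0 <= c ->
  0 <= NW -> 0 <= NZ -> w ^+ 2 <= b * NW -> z ^+ 2 <= b * NZ ->
  `|NW - NZ| <= (w + z) * d ->
  0 <= p -> p <= w * (c * d) + d * (c * z) -> 0 <= q -> q <= z * (c * z) -> 0 < a ->
  `|a / (1 + NW)| * p + `|a / (1 + NW) - a / (1 + NZ)| * q <=
  2 * a * c * (1 + b) ^+ 2 * d.
Proof.
move=> w0 z0 d0 zw b0 c0 NW0 NZ0 hw hz hN p0 hp q0 hq a0.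
have pW : 0 < 1 + NW by lra.
have pZ : 0 < 1 + NZ by lra.
have bNW : 0 <= b * NW by rewrite mulr_ge0.
have iw : w / (1 + NW) <= 1 + b.
  by rewrite ler_pdivrMr//; clear -hw b0 NW0 bNW; have := sqr_ge0 (w - 1); nra.
have iz : z ^+ 2 / (1 + NZ) <= b.
  by rewrite ler_pdivrMr//; lra.
have acd : 0 <= 2 * a * c * d by rewrite !mulr_ge0// ltW.
have h1 : `|a / (1 + NW)| * p <= 2 * a * c * d * (1 + b).
  rewrite ger0_norm; last by rewrite divr_ge0 ?ltW.
  apply: (@le_trans _ _ (a / (1 + NW) * (2 * w * (c * d)))).
    apply: ler_wpM2l; first by rewrite divr_ge0 ?ltW.
    apply: le_trans hp _.
    rewrite [leLHS](_ : _ = (w + z) * (c * d)); last by ring.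
    by rewrite ler_wpM2r ?mulr_ge0//; lra.
  rewrite [leLHS](_ : _ = (2 * a * c * d) * (w / (1 + NW))); last by ring.
  by rewrite ler_wpM2l.
have h2 : `|a / (1 + NW) - a / (1 + NZ)| * q <= 2 * a * c * d * ((1 + b) * b).
  have -> : a / (1 + NW) - a / (1 + NZ) = a * (NZ - NW) / ((1 + NW) * (1 + NZ)).
    by field; rewrite !gt_eqF.
  rewrite normrM normfV normrM (gtr0_norm a0) (gtr0_norm (mulr_gt0 pW pZ)) distrC.
  apply: (@le_trans _ _ (a * (2 * w * d) / ((1 + NW) * (1 + NZ)) * (c * z ^+ 2))).
    apply: ler_pM => //.
    - by rewrite divr_ge0 ?mulr_ge0// ltW.
    - apply: ler_wpM2r; first by rewrite invr_ge0 mulr_ge0// ltW.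
      apply: ler_wpM2l; first exact: ltW.
      by apply: le_trans hN _; rewrite ler_wpM2r//; lra.
    - by apply: le_trans hq _; rewrite expr2 mulrCA.
  rewrite [leLHS](_ : _ = 2 * a * c * d * ((w / (1 + NW)) * (z ^+ 2 / (1 + NZ)))).
    by rewrite ler_wpM2l// ler_pM// divr_ge0 ?exprn_ge0// ltW.
  by rewrite invfM; ring.
apply: le_trans (lerD h1 h2) _.
by rewrite le_eqVlt; apply/orP; left; apply/eqP; ring.
Qed.

Section GainAuxiliary.
Context {R : realType} {n m : nat}.
Variables (H : 'I_m -> 'M[R[i]]_n) (g : 'I_m -> R -> R) (Xr : R -> 'M[R[i]]_n).
Implicit Types (W Z : 'M[R[i]]_n) (t : R).
Local Notation Re := complex.Re.
Local Notation Im := complex.Im.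

Definition out k t W : R := V (W *m (Xr t) ^t* *m H k *m Xr t).

Definition gcontrol t W := (Xr t) ^t* *m (\sum_k (g k t * out k t W)%:C *: H k) *m Xr t.

(** With the constant gains [f k ^ 2] this is [aux]; gains depending on time may also vanish at the
    switching times. *)
Definition gaux t W := W *m gcontrol t W.

Hypothesis H_su : forall k, su (H k).
Hypothesis Xr_SU : forall t, SU (Xr t).

Lemma outB k t W Z : out k t (W - Z) = out k t W - out k t Z.
Proof. by rewrite /out !mulmxBl V_B. Qed.

Lemma gcontrolB t W Z : gcontrol t (W - Z) = gcontrol t W - gcontrol t Z.
Proof.
rewrite /gcontrol -mulmxBl -mulmxBr -sumrB; congr (_ *m _ *m _).
by apply: eq_bigr => k _; rewrite outB mulrBr rmorphB/= scalerBl.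
Qed.

Lemma gcontrol_su t W : su (gcontrol t W).
Proof. by apply: su_conj => //; apply: su_sum => k; exact: su_Z. Qed.

Lemma gaux_SU (W : R -> 'M[R[i]]_n) t0 : solves_line gaux W -> SU (W t0) -> forall t, SU (W t).
Proof.
move=> sW; pose A t := gcontrol t (W t).
have sA t : su (A t) by exact: gcontrol_su.
have sW' : solves_line (fun t Y => Y *m A t) W by move=> t; exact: sW.
exact: SU_preserved_right sA sW'.
Qed.

Lemma gauxE t W : gaux t W = W *m (Xr t) ^t* *m
  (\sum_k (g k t * out k t W)%:C *: H k) *m Xr t.
Proof. by rewrite /gaux /gcontrol !mulmxA. Qed.

Lemma V_gaux t W : V (gaux t W) = \sum_k g k t * out k t W ^+ 2.
Proof.
rewrite gauxE mulmx_sumr mulmx_suml V_sum; apply: eq_bigr => k _.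
by rewrite -scalemxAr -scalemxAl V_Z -/(out k t W) expr2 mulrA.
Qed.

Variable G : R.
Hypothesis g_bound : forall k t, `|g k t| <= G.

Let b : R := 2 * n%:R ^+ 2.
Let b0 : 0 <= b. Proof. by rewrite /b mulr_ge0// exprn_ge0. Qed.

Lemma out_bound k t W : `|out k t W| <= mxabs W * b * mxabs (H k) * b.
Proof.
apply: le_trans (V_le_mxabs _) _.
apply: mxabsM_le; last exact: SU_mxabs.
apply: mxabsM_le => //; apply: mxabsM_le => //.
by rewrite mxabsJ; exact: SU_mxabs.
Qed.

Lemma gcontrol_bound :
  exists2 c, 0 <= c & forall t W, mxabs (gcontrol t W) <= c * mxabs W.
Proof.
pose c := b * (\sum_k (G * (b * mxabs (H k) * b) * mxabs (H k))) * b.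
suff h t W : mxabs (gcontrol t W) <= c * mxabs W.
  exists `|c| => // t W; apply: le_trans (h t W) _.
  by rewrite ler_wpM2r ?mxabs_ge0 ?ler_norm.
have -> : c * mxabs W = b * (\sum_k G * (mxabs W * b * mxabs (H k) * b) * mxabs (H k)) * b.
  rewrite /c mulrAC; congr (_ * _); rewrite -mulrA; congr (_ * _).
  by rewrite big_distrl/=; apply: eq_bigr => k _; ring.
apply: mxabsM_le; last exact: SU_mxabs.
apply: mxabsM_le; first by rewrite mxabsJ; exact: SU_mxabs.
apply: le_trans (mxabs_sum _ _ _) _; apply: ler_sum => k _.
rewrite mxabsZ ler_wpM2r ?mxabs_ge0// normrM ler_pM//.
exact: out_bound.
Qed.

(* nsq is conserved along solutions, so this factor, which makes the quadratic
   field globally Lipschitz, equals 1 on the solutions starting in SU(n). *)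
Definition damping W : R := (1 + n%:R) / (1 + nsq W).

Lemma nsq_diff W Z : `|nsq W - nsq Z| <= (mxabs W + mxabs Z) * mxabs (W - Z).
Proof.
have -> : nsq W - nsq Z = V (W ^t* *m (W - Z)) + V ((W - Z) ^t* *m Z).
  have e1 : V (W ^t* *m (W - Z)) = nsq W - V (W ^t* *m Z).
    by rewrite (mulmxBr (W ^t*) W Z) (V_B (W ^t* *m W) (W ^t* *m Z)) -(nsqE W).
  have e2 : V ((W - Z) ^t* *m Z) = V (W ^t* *m Z) - nsq Z.
    by rewrite (mxJB W Z) (mulmxBl _ _ Z) (V_B (W ^t* *m Z) (Z ^t* *m Z)) -(nsqE Z).
  by rewrite e1 e2 addrA subrK.
apply: le_trans (ler_normD _ _) _; rewrite mulrDl; apply: lerD.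
  by apply: le_trans (V_le_mxabs _) _; apply: le_trans (mxabsM _ _) _; rewrite mxabsJ.
apply: le_trans (V_le_mxabs _) _; apply: le_trans (mxabsM _ _) _.
by rewrite mxabsJ mulrC.
Qed.

Lemma damped_lipschitz c t W Z : 0 <= c ->
  (forall t W, mxabs (gcontrol t W) <= c * mxabs W) ->
  mxabs ((damping W)%:C *: gaux t W - (damping Z)%:C *: gaux t Z) <=
  2 * (1 + n%:R) * c * (1 + b) ^+ 2 * mxabs (W - Z).
Proof.
move=> c0 /(_ t) gc; wlog ZW : W Z / mxabs Z <= mxabs W.
  move=> h; have [/h//|/ltW/h hZW] := leP (mxabs Z) (mxabs W).
  have sym A B : mxabs (A - B : 'M[R[i]]_n) <= mxabs (B - A) by rewrite mxabsB.
  apply: le_trans (sym _ _) _; apply: le_trans hZW _.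
  apply: ler_wpM2l; last exact: sym.
  by rewrite !mulr_ge0 ?exprn_ge0// addr_ge0.
(* The quadratic part is split bilinearly with the damping of the larger matrix [W] in front, and
   the change of damping is charged to the field at the smaller matrix [Z]. *)
have -> : (damping W)%:C *: gaux t W - (damping Z)%:C *: gaux t Z =
    (damping W)%:C *: (W *m gcontrol t (W - Z) + (W - Z) *m gcontrol t Z) +
    (damping W - damping Z)%:C *: gaux t Z.
  have split (x y : R) (P Q A B : 'M[R[i]]_n) : x%:C *: (A *m P) - y%:C *: (B *m Q) =
      x%:C *: (A *m (P - Q) + (A - B) *m Q) + (x - y)%:C *: (B *m Q).
    have -> : A *m (P - Q) + (A - B) *m Q = A *m P - B *m Q.
      by rewrite mulmxBr mulmxBl; move: (A *m P) (A *m Q) => C D; rewrite addrA subrK.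
    by rewrite rmorphB/= scalerBl; move: (A *m P) (B *m Q) => C D; rewrite scalerBr addrA subrK.
  by rewrite (gcontrolB t W Z); exact: split.
apply: le_trans (mxabsD _ _) _; rewrite !mxabsZ.
apply: (damping_arith (mxabs_ge0 W) (mxabs_ge0 Z) (mxabs_ge0 (W - Z)) ZW b0 c0
  (nsq_ge0 W) (nsq_ge0 Z) (mxabs_sqr_le W) (mxabs_sqr_le Z)).
- exact: nsq_diff.
- exact: mxabs_ge0.
- apply: le_trans (mxabsD _ _) (lerD _ _).
    exact: mxabsM_le (lexx _) (gc _).
  exact: mxabsM_le (lexx _) (gc _).
- exact: mxabs_ge0.
- exact: mxabsM_le (lexx _) (gc _).
- by rewrite ltr_pwDl.
Qed.

Hypothesis g_cont : forall k, continuous (g k).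
Hypothesis Xr_cont : forall t, mx_cvg (nbhs t) Xr (Xr t).

Lemma out_cvg {T : Type} (F : set_system T) {FF : Filter F} k
    (s : T -> R) (t : R) (W : T -> 'M[R[i]]_n) (W0 : 'M[R[i]]_n) :
  s x @[x --> F] --> t -> mx_cvg F W W0 ->
  out k (s x) (W x) @[x --> F] --> out k t W0.
Proof.
move=> st WW0.
have Xs : mx_cvg F (fun x => Xr (s x)) (Xr t).
  by move=> i j; have [h1 h2] := Xr_cont t i j;
    split; [exact: (cvg_comp _ _ st h1)|exact: (cvg_comp _ _ st h2)].
apply: V_cvg; apply: mx_cvgM => //; apply: mx_cvgM; last exact: mx_cvg_cst.
by apply: mx_cvgM => //; exact: mx_cvgJ.
Qed.

Lemma gaux_cvg {T : Type} (F : set_system T) {FF : Filter F}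
    (s : T -> R) (t : R) (W : T -> 'M[R[i]]_n) (W0 : 'M[R[i]]_n) :
  s x @[x --> F] --> t -> mx_cvg F W W0 ->
  mx_cvg F (fun x => gaux (s x) (W x)) (gaux t W0).
Proof.
move=> st WW0.
have Xs : mx_cvg F (fun x => Xr (s x)) (Xr t).
  by move=> i j; have [h1 h2] := Xr_cont t i j;
    split; [exact: (cvg_comp _ _ st h1)|exact: (cvg_comp _ _ st h2)].
apply: mx_cvgM => //; apply: mx_cvgM => //; apply: mx_cvgM; first exact: mx_cvgJ.
apply: mx_cvg_sum => k; apply: mx_cvgZ; last exact: mx_cvg_cst.
apply: cvgM; last exact: out_cvg.
exact: (cvg_comp _ _ st (g_cont (k := k) (x := t))).
Qed.

Theorem gaux_exists (t0 : R) (W0 : 'M[R[i]]_n) : SU W0 ->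
  exists2 W, solves_line gaux W & W t0 = W0.
Proof.
move=> sW0; pose I : finType := ('I_n * 'I_n * bool)%type.
pose toM (y : I -> R) : 'M[R[i]]_n := \matrix_(i, j) Complex (y (i, j, false)) (y (i, j, true)).
pose ofM (A : 'M[R[i]]_n) : I -> R := fun p =>
  if p.2 then Im (A p.1.1 p.1.2) else Re (A p.1.1 p.1.2).
have ofMK A : toM (ofM A) = A.
  by apply/matrixP => i j; rewrite mxE; apply: cplx_eqP.
have ofMB A B p : `|ofM A p - ofM B p| <= mxabs (A - B).
  apply: le_trans (cabs_le_mxabs (A - B) p.1.1 p.1.2).
  rewrite /cabs !mxE ReD ImD ReN ImN /ofM; case: p => [[i j] []]/=.
    by rewrite lerDr.
  by rewrite lerDl.
have toMB y z : mxabs (toM y - toM z) = \sum_p `|y p - z p|.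
  transitivity (\sum_(q : 'I_n * 'I_n * bool) `|y (q.1, q.2) - z (q.1, q.2)|); last first.
    by apply: eq_bigr => -[].
  rewrite /mxabs pair_bigA/= -(pair_bigA _ (fun ij s => `|y (ij, s) - z (ij, s)|))/=.
  apply: eq_bigr => -[i j] _/=; rewrite big_bool/= /cabs !mxE ReD ImD ReN ImN/=.
  exact: addrC.
pose r t W := (damping W)%:C *: gaux t W.
pose F t y := ofM (r t (toM y)).
have [c c0 gc] := gcontrol_bound.
pose L := 2 * (1 + n%:R) * c * (1 + b) ^+ 2.
have L0 : 0 <= L by rewrite !mulr_ge0 ?exprn_ge0// addr_ge0.
pose B := `|damping W0| * (mxabs W0 * (c * mxabs W0)).
have FB t p : `|F t (ofM W0) p| <= B.
  rewrite /F ofMK; have := ofMB (r t W0) 0 p; rewrite subr0.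
  have -> : ofM 0 p = 0 by rewrite /ofM mxE; case: ifP.
  rewrite subr0 => h; apply: le_trans h _; rewrite mxabsZ ler_wpM2l//.
  by apply: mxabsM_le => //; exact: gc.
have FL t y z p : `|F t y p - F t z p| <= L * \sum_j `|y j - z j|.
  by rewrite /F -toMB; apply: le_trans (ofMB _ _ _) _; exact: damped_lipschitz.
have Fc (y : R -> I -> R) : (forall j, continuous (y ^~ j)) ->
    forall p, continuous (fun t => F t (y t) p).
  move=> cy p; have cM (t : R) : mx_cvg (nbhs t) (fun t => toM (y t)) (toM (y t)).
    move=> i j; rewrite mxE; under eq_fun do rewrite mxE.
    by split; [exact: cy|exact: cy].
  have cr (t : R) : mx_cvg (nbhs t) (fun t => r t (toM (y t))) (r t (toM (y t))).
    apply: mx_cvgZ; last by apply: gaux_cvg => //; exact: cvg_id.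
    apply: cvgM; first exact: cvg_cst.
    apply: cvgV; first by rewrite gt_eqF// ltr_pwDl// nsq_ge0.
    apply: cvgD; first exact: cvg_cst.
    rewrite nsqE; under eq_fun do rewrite nsqE.
    by apply: V_cvg; apply: mx_cvgM => //; exact: mx_cvgJ.
  move=> t; have [h1 h2] := cr t p.1.1 p.1.2.
  by rewrite /F /ofM; case: p.2.
have [y [yd y0]] := global_picard t0 L0 FB FL Fc.
pose W t := toM (y t).
have sW : solves_line r W.
  move=> t i j; have dF := yd t; rewrite /W.
  split; under eq_fun do rewrite mxE/=.
    exact: (dF (i, j, false)).
  exact: (dF (i, j, true)).
have Wt0 : W t0 = W0 by rewrite /W y0 ofMK.
(* The damped field is still [W] times an element of su(n), so [W] stays in SU(n); there [nsq] is
   [n], the damping is 1 and the original equation holds. *)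
have SW : forall t, SU (W t).
  pose A t := (damping (W t))%:C *: gcontrol t (W t).
  have sA t : su (A t) by apply: su_Z; exact: gcontrol_su.
  have sW' : solves_line (fun t Y => Y *m A t) W.
    by move=> t; apply: mx_der_eq (sW t) _; rewrite -scalemxAr.
  by apply: (@SU_preserved_right _ _ A W t0) => //; rewrite Wt0.
exists W => // t; apply: mx_der_eq (sW t) _; rewrite /r /damping SU_nsq// divff ?scale1r//.
Qed.

End GainAuxiliary.

(** * Convergence of the auxiliary system *)

Section Ultra.
Context {R : realType}.

Lemma cvg_uniqueR {I : Type} {U : set_system I} {PU : ProperFilter U} (f : I -> R)
    (a b : R) : f j @[j --> U] --> a -> f j @[j --> U] --> b -> a = b.
Proof. by move=> h1 h2; exact: (cvg_unique _ h1 h2). Qed.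

Lemma ultra_bounded_cvg (U : set_system nat) (x : nat -> R) (a b : R) :
  UltraFilter U -> (forall j, a <= x j <= b) ->
  exists2 l, a <= l <= b & x j @[j --> U] --> l.
Proof.
move=> uU xab; have PU : ProperFilter U by exact: ultra_proper.
have UA : U (x @^-1` `[a, b]) by apply: filterE => j; rewrite /= in_itv/=.
have [l [lab lU]] := @segment_compact R a b (fmap x U) (fmap_proper_filter x PU) UA.
exists l; first by move: lab; rewrite /= in_itv.
move=> N Nl; have [//|h] := in_ultra_setVsetC (x @^-1` N) uU.
by have [y []] := lU (~` N) N h Nl.
Qed.

Lemma cvg_finer (U : set_system nat) (x : nat -> R) (l : R) :
  \oo `<=` U -> x @ \oo --> l -> x j @[j --> U] --> l.
Proof. by move=> oU xl N /xl; exact: oU. Qed.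

End Ultra.

(** * The invariance argument for periodic gains *)

Section LaSalle.
Context {R : realType} {n m : nat}.
Variables (H : 'I_m -> 'M[R[i]]_n) (Xinf : 'M[R[i]]_n) (T : R).
Variables (u : 'I_m -> R -> R) (XrT : R -> 'M[R[i]]_n).
Hypothesis n2 : (2 <= n)%N.
Hypothesis H_su : forall k, su (H k).
Hypothesis Xinf_SU : SU Xinf.
Hypothesis T0 : 0 < T.
Hypothesis ref : regular_reference H T u XrT.

Variable Xr : R -> 'M[R[i]]_n.
Hypothesis XrE : forall t, Xr t = XrT t *m Xinf.

Lemma XrT_SU t : SU (XrT t).
Proof.
have [_ [sX X0] _ _] := ref.
apply: (@SU_preserved _ _ (generator H u) XrT 0) => //.
  by move=> s; exact: su_generator.
by rewrite X0; exact: SU1.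
Qed.

Lemma Xr_SU t : SU (Xr t).
Proof. by rewrite XrE; apply: SU_M => //; exact: XrT_SU. Qed.

Lemma Xr_der t : mx_is_derive Xr t (generator H u t *m Xr t).
Proof.
have [_ [sX _] _ _] := ref.
have -> : Xr = fun t => XrT t *m Xinf by apply/funext.
by apply: mx_der_eq (mx_derMr Xinf (sX t)) _; rewrite mulmxA.
Qed.

Lemma Xr_cont t : mx_cvg (nbhs t) Xr (Xr t).
Proof. exact: mx_der_cont (Xr_der t). Qed.

Lemma Xr_periodic t (j : nat) : Xr (t + j%:R * T) = Xr t.
Proof.
have [_ _ XT _] := ref.
elim: j => [|j IH]; first by rewrite mul0r addr0.
by rewrite -natr1 mulrDl mul1r addrA XrE XT -XrE.
Qed.

(** Since the generator A is skew-Hermitian, differentiating [XrT^* B] gives [XrT^* (B' - A B)],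
    which is the recursion for the next [Bmx]. All orders thus vanish, and at time 0, where [XrT] is
    1, they span su(n). *)
Lemma span_critical Y :
  (forall k s, V (Y *m ((XrT s) ^t* *m (H k *m XrT s))) = 0) ->
  forall A, su A -> V (Y *m A) = 0.
Proof.
move=> Y0; have [hu [sX X0] XT spanE] := ref.
have su_ k : smooth (u k) by have [] := hu k.
have B0 j k s : V (Y *m ((XrT s) ^t* *m Bmx H u XrT k j s)) = 0.
  elim: j k s => [//|j IH] k s.
  have d := mx_derMl Y (mx_derM (mx_derJ (sX s)) (Bmx_derive k j s su_ sX)).
  have := V_der d; under eq_fun do rewrite IH.
  move=> [_]; rewrite derive_cst => h; rewrite [RHS]h; congr V; congr (_ *m _).
  rewrite [Bmx _ _ _ _ _ _]/= mxJM; have [-> _] := su_generator u s H_su.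
  by rewrite mulmxN mulNmx mulmxDr mulmxN mulmxA.
move=> A; rewrite -spanE => -[s ->]; rewrite mulmx_sumr V_sum big1// => p _.
by rewrite -scalemxAr V_Z; have := B0 p.2.2 p.2.1 0; rewrite X0 mxJ1 mul1mx => ->; rewrite mulr0.
Qed.

(** Regularity concerns [XrT], whereas the outputs involve [XrT *m Xinf]; conjugating by [Xinf]
    moves this factor onto [W] and leaves [V] unchanged. *)
Lemma Gset_limit W : SU W -> (forall k s, out H Xr k s W = 0) -> @Gset R n (V W).
Proof.
move=> sW W0; pose Y := Xinf *m W *m Xinf ^t*.
have VY : V Y = V W.
  by rewrite /Y V_C mulmxA SU_Jmul// mul1mx.
rewrite -VY; apply: Gset_critical => //.
  by apply: SU_M; [exact: SU_M|exact: SU_J].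
apply: span_critical => k s; rewrite -(W0 k s) /out XrE /Y mxJM.
rewrite [RHS](_ : _ = V ((W *m Xinf ^t* *m (XrT s) ^t* *m H k *m XrT s) *m Xinf)); last first.
  by rewrite !mulmxA.
by rewrite [RHS]V_C !mulmxA.
Qed.

Variables (g : 'I_m -> R -> R) (G : R).
Hypothesis g_cont : forall k, continuous (g k).
Hypothesis g_bound : forall k t, 0 <= g k t <= G.
Hypothesis g_periodic : forall k t, g k (t + T) = g k t.
(** A vanishing derivative of V says nothing about [out k] where [g k] is zero; density and the
    continuity of [out k] recover those times. *)
Hypothesis g_dense : forall k (t r : R), 0 < r -> exists s, t < s < t + r /\ g k s != 0.

Lemma g_periodic_nat k t (j : nat) : g k (t + j%:R * T) = g k t.
Proof.
elim: j => [|j IH]; first by rewrite mul0r addr0.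
by rewrite -natr1 mulrDl mul1r addrA g_periodic.
Qed.

Lemma out_periodic k t (j : nat) W : out H Xr k (t + j%:R * T) W = out H Xr k t W.
Proof. by rewrite /out Xr_periodic. Qed.

Lemma gaux_periodic t (j : nat) W : gaux H g Xr (t + j%:R * T) W = gaux H g Xr t W.
Proof.
have e : \sum_k (g k (t + j%:R * T) * out H Xr k (t + j%:R * T) W)%:C *: H k =
    \sum_k (g k t * out H Xr k t W)%:C *: H k.
  by apply: eq_bigr => k _; rewrite g_periodic_nat out_periodic.
by rewrite /gaux /gcontrol e Xr_periodic.
Qed.

Lemma V_gaux_ge0 t W : 0 <= V (gaux H g Xr t W).
Proof.
rewrite V_gaux; apply: sumr_ge0 => k _; rewrite mulr_ge0 ?sqr_ge0//.
by case/andP: (g_bound k t).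
Qed.

(* |g out| <= g (e + out ^ 2 / e), and the sum of the g out ^ 2 is (V W)'. *)
Lemma gaux_amgm : exists2 D : R, 0 <= D & forall t W (e : R), SU W -> 0 < e ->
  mxabs (gaux H g Xr t W) <= D * (e + V (gaux H g Xr t W) / e).
Proof.
pose b : R := 2 * n%:R ^+ 2; pose h := \sum_k mxabs (H k).
have b0 : 0 <= b by rewrite /b mulr_ge0// exprn_ge0.
have h0 : 0 <= h by apply: sumr_ge0 => k _; exact: mxabs_ge0.
pose a := m%:R * `|G| + 1.
have a1 : 1 <= a by rewrite /a lerDr mulr_ge0.
exists (b * (b * h * b) * a).
  by rewrite !mulr_ge0//; lra.
move=> t W e sW e0; set q := V _.
have q0 : 0 <= q by exact: V_gaux_ge0.
have step : \sum_k `|g k t * out H Xr k t W| <= a * (e + q / e).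
  apply: (@le_trans _ _ (\sum_(k < m) (`|G| * e + g k t * out H Xr k t W ^+ 2 / e))).
    apply: ler_sum => k _; rewrite normrM; have /andP[g0 gG] := g_bound k t.
    rewrite (ger0_norm g0); have := ler_norm G; move: (out _ _ _ _ _) (g k t) g0 gG => o gk g0 gG GG.
    apply: (@le_trans _ _ (gk * (e + o ^+ 2 / e))); last first.
      by rewrite mulrDr mulrA lerD2r ler_wpM2r ?(ltW e0)//; exact: le_trans gG GG.
    rewrite ler_wpM2l// -(ler_pM2r e0) mulrDl divfK ?gt_eqF//.
    have := sqr_ge0 (e - `|o|); rewrite sqrrB (real_normK (num_real o)).
    by have := normr_ge0 o; move: (`|o|) => x x0 h'; have := sqr_ge0 e; have := sqr_ge0 o; nra.
  rewrite big_split/= sumr_const card_ord -big_distrl/= -V_gaux -/q.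
  rewrite mulrDr; apply: lerD.
    by rewrite -mulr_natl mulrA ler_wpM2r ?(ltW e0)// /a lerDl.
  by rewrite ler_peMl// divr_ge0// ltW.
rewrite -mulrA -[leRHS]mulrA; apply: mxabsM_le; first exact: SU_mxabs.
rewrite [leRHS](_ : _ = b * (h * (a * (e + q / e))) * b); last by ring.
apply: mxabsM_le; last by apply: SU_mxabs; exact: Xr_SU.
apply: mxabsM_le; first by rewrite mxabsJ; apply: SU_mxabs; exact: Xr_SU.
apply: le_trans (mxabs_sum _ _ _) _.
apply: (@le_trans _ _ (\sum_k `|g k t * out H Xr k t W| * h)).
  apply: ler_sum => k _; rewrite mxabsZ ler_wpM2l//.
  by rewrite /h (bigD1 k)//= lerDl; apply: sumr_ge0 => l _; exact: mxabs_ge0.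
by rewrite -big_distrl/= mulrC ler_wpM2l.
Qed.

Variables (W : R -> 'M[R[i]]_n) (t0 : R).
Hypothesis W_sol : solves_line (gaux H g Xr) W.
Hypothesis W_SU0 : SU (W t0).

Lemma W_SU t : SU (W t).
Proof. by apply: (gaux_SU H_su Xr_SU W_sol W_SU0). Qed.

Lemma VW_der (t : R) : is_derive t 1 (fun s => V (W s)) (V (gaux H g Xr t (W t))).
Proof. exact: V_der (W_sol t). Qed.

Lemma VW_ndecr s t : s <= t -> V (W s) <= V (W t).
Proof.
move=> st; apply: (ndecr_of_derive st (is_derive_continuous VW_der)).
  by move=> r _; exact: VW_der.
by move=> r _; exact: V_gaux_ge0.
Qed.

Let c := sup (range (fun t => V (W t))).

Let VW_sup : has_sup (range (fun t => V (W t))).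
Proof.
split; first by exists (V (W 0)), 0.
by exists n%:R => _ [t _ <-]; exact/V_le_n/W_SU.
Qed.

Lemma VW_le t : V (W t) <= c.
Proof. by apply: sup_upper_bound => //; exists t. Qed.

Lemma VW_near e : 0 < e -> exists t1, forall t, t1 <= t -> c - e < V (W t).
Proof.
move=> e0; have [_ [t1 _ <-] h] := sup_adherent e0 VW_sup.
by exists t1 => t t1t; apply: lt_le_trans h (VW_ndecr t1t).
Qed.

Lemma VW_cvg : V (W t) @[t --> +oo] --> c.
Proof.
apply/cvgrPdist_lt => e e0; have [t1 h] := VW_near e0.
near=> t; rewrite ltr_norml; have := VW_le t.
have : c - e < V (W t) by apply: h; near: t; apply: nbhs_pinfty_ge; exact: num_real.
by move=> ? ?; lra.
Unshelve. all: by end_near. Qed.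

Lemma times_near (t1 : R) : \forall j \near \oo, t1 <= j%:R * T.
Proof.
exists (Num.bound `|t1 / T|) => // j /= hj.
rewrite -ler_pdivrMr//; apply: le_trans (ler_norm _) _.
by apply: le_trans (ltW (archi_boundP (normr_ge0 (t1 / T)))) _; rewrite ler_nat.
Qed.

Lemma VW_times_cvg (xi : nat -> R) : (forall j, 0 <= xi j) ->
  V (W (xi j + j%:R * T)) @[j --> \oo] --> c.
Proof.
move=> xi0; apply/cvgrPdist_lt => e e0; have [t1 h] := VW_near e0.
near=> j; rewrite ltr_norml; have := VW_le (xi j + j%:R * T).
have : c - e < V (W (xi j + j%:R * T)).
  apply: h; apply: (@le_trans _ _ (j%:R * T)); last by rewrite lerDr.
  by near: j; exact: times_near.
by move=> ? ?; lra.
Unshelve. all: by end_near. Qed.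

(** Integrating [gaux_amgm] bounds the displacement after time [j T] by a multiple of
    [e B + (c - V) / e], with V taken at [j T]: [e] is fixed small first, then [j] is taken
    large. *)
Lemma W_slow (xi : nat -> R) (B : R) : (forall j, 0 <= xi j <= B) ->
  mx_cvg \oo (fun j : nat => W (xi j + j%:R * T) - W (j%:R * T)) 0.
Proof.
move=> xiB; have [D D0 hD] := gaux_amgm.
have B0 : 0 <= B by have /andP[] := xiB 0%N; exact: le_trans.
have bound (j : nat) (e : R) i k : 0 < e ->
    cabs ((W (xi j + j%:R * T) - W (j%:R * T)) i k) <=
    2 * (D * (e * B + (c - V (W (j%:R * T))) / e)).
  move=> e0; have /andP[x0 xB] := xiB j.
  set a := j%:R * T; set b := xi j + a.
  have ab : a <= b by rewrite /b lerDr.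
  pose q t := V (gaux H g Xr t (W t)).
  have dG (t : R) : is_derive t 1 (fun t => D * (e * t + e^-1 * V (W t)))
      (D * (e + e^-1 * q t)).
    have d1 : is_derive t 1 (fun t : R => e * t) e.
      by apply: (is_derive_eq (is_deriveZ e (is_derive_id t 1))); rewrite /GRing.scale/= mulr1.
    exact: (is_deriveZ D (is_deriveD d1 (is_deriveZ (e^-1) (VW_der t)))).
  have dle (t : R) (f : R[i] -> R) : (forall x, `|f x| <= cabs x) ->
      `|f (gaux H g Xr t (W t) i k)| <= D * (e + e^-1 * q t).
    move=> hf; apply: le_trans (hf _) _; apply: le_trans (cabs_le_mxabs _ _ _) _.
    by rewrite [e^-1 * _]mulrC; apply: hD => //; exact: W_SU.
  have fin : D * (e * b + e^-1 * V (W b)) - D * (e * a + e^-1 * V (W a)) <=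
      D * (e * B + (c - V (W a)) / e).
    rewrite -mulrBr ler_wpM2l//.
    rewrite [leLHS](_ : _ = e * xi j + (V (W b) - V (W a)) / e); last by rewrite /b; ring.
    by apply: lerD; [rewrite ler_pM2l|rewrite ler_pM2r ?invr_gt0// lerB// VW_le].
  have d1 (t : R) := (W_sol t i k).1; have d2 (t : R) := (W_sol t i k).2.
  have hRe (x : R[i]) : `|complex.Re x| <= cabs x by rewrite /cabs lerDl.
  have hIm (x : R[i]) : `|complex.Im x| <= cabs x by rewrite /cabs lerDr.
  have h1 := derive_dominated ab d1 dG (fun t _ => dle t _ hRe).
  have h2 := derive_dominated ab d2 dG (fun t _ => dle t _ hIm).
  rewrite /cabs !mxE ReD ImD ReN ImN mulrDl mul1r.
  by apply: lerD; [apply: le_trans h1 fin|apply: le_trans h2 fin].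
have main i k : forall eps, 0 < eps -> \forall j \near \oo,
    cabs ((W (xi j + j%:R * T) - W (j%:R * T)) i k) <= eps.
  (* Each of the two terms is to be at most [eps / 4]; the remaining factor 2 counts the real and
     the imaginary part. The [+ 1] guards against a zero divisor. *)
  move=> eps eps0; pose e := eps / (4 * (D * B + 1)).
  have DB : 0 < 4 * (D * B + 1) by rewrite mulr_gt0// ltr_wpDl// mulr_ge0.
  have e0 : 0 < e by rewrite divr_gt0.
  have D4 : 0 < 4 * (D + 1) by rewrite mulr_gt0// ltr_wpDl.
  have [t1 h] := VW_near (divr_gt0 (mulr_gt0 eps0 e0) D4).
  near=> j; apply: le_trans (bound j e i k e0) _.
  have hj : c - V (W (j%:R * T)) <= eps * e / (4 * (D + 1)).
    have : t1 <= j%:R * T by near: j; exact: times_near.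
    by move=> /h; lra.
  have h1 : D * (e * B) <= eps / 4.
    rewrite mulrCA /e -mulrA [_^-1 * _]mulrC mulrA ler_pdivrMr//.
    have : 0 <= D * B by rewrite mulr_ge0.
    by move: (D * B) => x x0; lra.
  have h2 : D * ((c - V (W (j%:R * T))) / e) <= eps / 4.
    apply: (@le_trans _ _ (D * (eps / (4 * (D + 1))))).
      rewrite ler_wpM2l// ler_pdivrMr//; apply: le_trans hj _.
      by rewrite mulrAC.
    by rewrite mulrA ler_pdivrMr//; lra.
  by rewrite mulrDr; lra.
move=> i k; split; rewrite mxE; apply/cvgrPdist_le => eps eps0.
  apply: filterS (main i k eps eps0) => j; apply: le_trans.
  by rewrite sub0r normrN lerDl.
apply: filterS (main i k eps eps0) => j; apply: le_trans.
by rewrite sub0r normrN lerDr.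
Unshelve. all: by end_near. Qed.

(* An ultrafilter on the times j T replaces the extraction of subsequences, and
   W moves by o(1) over a period, so the mean value points of V over
   [s + j T, s + h + j T] give zeros of V (gaux _ Wlim) in [s, s + h]. *)
Lemma limit_point : exists Wlim : 'M[R[i]]_n,
  [/\ SU Wlim, V Wlim = c & forall k s, out H Xr k s Wlim = 0].
Proof.
have [U [uU oU]] := @ultraFilterLemma nat \oo _.
have PU : ProperFilter U by exact: ultra_proper.
have ex i k : exists z : R[i], ccvg U (fun j => W (j%:R * T) i k) z.
  pose b : R := 2 * n%:R ^+ 2.
  have hb j : cabs (W (j%:R * T) i k) <= b.
    by apply: le_trans (cabs_le_mxabs _ _ _) _; apply: SU_mxabs; exact: W_SU.
  have [|x _ hx] := @ultra_bounded_cvg R U (fun j => complex.Re (W (j%:R * T) i k)) (- b) b uU.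
    by move=> j; rewrite -ler_norml; apply: le_trans (hb j); rewrite /cabs lerDl.
  have [|y _ hy] := @ultra_bounded_cvg R U (fun j => complex.Im (W (j%:R * T) i k)) (- b) b uU.
    by move=> j; rewrite -ler_norml; apply: le_trans (hb j); rewrite /cabs lerDr.
  by exists (Complex x y).
have [w hw] := choice (fun p : 'I_n * 'I_n => ex p.1 p.2).
pose Wl : 'M[R[i]]_n := \matrix_(i, k) w (i, k).
have Wcvg : mx_cvg U (fun j : nat => W (j%:R * T)) Wl.
  by move=> i k; rewrite mxE; exact: (hw (i, k)).
have Wxi (xi : nat -> R) B : (forall j, 0 <= xi j <= B) ->
    mx_cvg U (fun j : nat => W (xi j + j%:R * T)) Wl.
  move=> /W_slow h; rewrite -[Wl]add0r.
  have h' : mx_cvg U (fun j : nat => W (xi j + j%:R * T) - W (j%:R * T)) 0.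
    by move=> i k; have [h1 h2] := h i k; split; apply: cvg_finer.
  have -> : (fun j : nat => W (xi j + j%:R * T)) =
      (fun j : nat => W (xi j + j%:R * T) - W (j%:R * T) + W (j%:R * T)).
    by apply/funext => j; rewrite subrK.
  exact: mx_cvgD h' Wcvg.
exists Wl.
have sWl : SU Wl by apply: (@SU_cvg _ _ _ U _ (fun j : nat => W (j%:R * T))) => // j; exact: W_SU.
have VWl : V Wl = c.
  have h1 : V (W (j%:R * T)) @[j --> U] --> V Wl by exact: V_cvg Wcvg.
  have h2 : V (W (j%:R * T)) @[j --> U] --> c.
    have -> : (fun j : nat => V (W (j%:R * T))) = (fun j : nat => V (W (0 + j%:R * T))).
      by apply/funext => j; rewrite add0r.
    exact: cvg_finer oU (@VW_times_cvg (fun=> 0) (fun=> lexx _)).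
  exact: (cvg_uniqueR h1 h2).
split=> //.
pose q s := V (gaux H g Xr s Wl).
have qzero s h : 0 <= s -> 0 < h -> exists2 xi, s <= xi <= s + h & q xi = 0.
  move=> s0 h0.
  have mvt (j : nat) : exists x, s < x < s + h /\
      V (W (s + h + j%:R * T)) - V (W (s + j%:R * T)) =
      V (gaux H g Xr x (W (x + j%:R * T))) * h.
    have ab : s + j%:R * T < s + h + j%:R * T by rewrite ltrD2r ltrDl.
    have [x] := MVT ab (fun x _ => VW_der x)
      (continuous_subspaceT (is_derive_continuous VW_der)).
    rewrite in_itv/= => /andP[x1 x2] e; exists (x - j%:R * T); split.
      by rewrite ltrBrDr x1 ltrBlDr.
    rewrite e -(gaux_periodic (x - j%:R * T) j) subrK; congr (_ * _).
    by rewrite opprD addrACA subrr addr0 addrAC subrr add0r.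
  have [x hx] := choice mvt.
  have [|xl xlB xU] := @ultra_bounded_cvg R U x s (s + h) uU.
    by move=> j; have [/andP[/ltW -> /ltW ->]] := hx j.
  exists xl => //.
  have hW : mx_cvg U (fun j => W (x j + j%:R * T)) Wl.
    apply: (Wxi x (s + h)) => j; have [/andP[x1 x2] _] := hx j.
    by rewrite (le_trans s0 (ltW x1)) ltW.
  have c1 : V (gaux H g Xr (x j) (W (x j + j%:R * T))) @[j --> U] --> V (gaux H g Xr xl Wl).
    by apply: V_cvg; exact: (gaux_cvg H g_cont Xr_cont xU hW).
  have c2 : V (gaux H g Xr (x j) (W (x j + j%:R * T))) @[j --> U] --> 0.
    have d0 : (V (W (s + h + j%:R * T)) - V (W (s + j%:R * T))) / h @[j --> \oo] --> (0 : R).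
      rewrite -(mul0r h^-1) -(subrr c); apply: cvgM; last exact: cvg_cst.
      apply: cvgB; first by apply: (@VW_times_cvg (fun=> s + h)) => _; rewrite addr_ge0// ltW.
      exact: (@VW_times_cvg (fun=> s)).
    have -> : (fun j => V (gaux H g Xr (x j) (W (x j + j%:R * T)))) =
        (fun j : nat => (V (W (s + h + j%:R * T)) - V (W (s + j%:R * T))) / h).
      by apply/funext => j; have [_ ->] := hx j; rewrite mulfK// gt_eqF.
    exact: cvg_finer oU d0.
  exact: (cvg_uniqueR c1 c2).
(* If [q s] were positive, [q] would be positive on some [[s, s + r / 2]] by continuity, against the
   zero found there. *)
have q0 s : 0 <= s -> q s = 0.
  move=> s0; apply/eqP; apply: contrapT => /negP qs.
  have qs0 : 0 < q s by rewrite lt_neqAle eq_sym qs V_gaux_ge0.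
  have cq : q r @[r --> s] --> q s.
    have ci : r @[r --> s] --> s by exact: cvg_id.
    by apply: V_cvg; exact: (gaux_cvg H g_cont Xr_cont ci (mx_cvg_cst Wl)).
  have /cvgrPdist_lt/(_ _ qs0) := cq.
  move=> /nbhs_ballP[r /= r0 hr].
  have [x /andP[x1 x2] qx] := qzero s (r / 2) s0 (divr_gt0 r0 (ltr0Sn R 1)).
  have bx : `|s - x| < r by rewrite distrC ger0_norm ?subr_ge0// ltrBlDl (le_lt_trans x2)// ltrD2l gtr_pMr// invf_lt1// ltr1n.
  by have := hr x bx; rewrite /= qx subr0 ger0_norm ?(ltW qs0)// ltxx.
(* [q] is a sum of nonnegative terms, so [out k] vanishes wherever [g k] does not; such times
   accumulate at [s] from the right. *)
have out0 k s : 0 <= s -> out H Xr k s Wl = 0.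
  move=> s0; apply/eqP; apply: contrapT => /negP os.
  have co : out H Xr k r Wl @[r --> s] --> out H Xr k s Wl.
    have ci : r @[r --> s] --> s by exact: cvg_id.
    exact: (@out_cvg _ _ _ H Xr Xr_cont R (nbhs s) _ k id s (fun=> Wl) Wl ci (mx_cvg_cst Wl)).
  have on : 0 < `|out H Xr k s Wl| by rewrite normr_gt0.
  have /cvgrPdist_lt/(_ _ on) := co.
  move=> /nbhs_ballP[r /= r0 hr].
  have [x [/andP[x1 x2] gx]] := g_dense k s r0.
  have x0 : 0 <= x by rewrite (le_trans s0)// ltW.
  have := q0 x x0; rewrite /q V_gaux => /eqP; rewrite psumr_eq0; last first.
    by move=> l _; rewrite mulr_ge0 ?sqr_ge0//; case/andP: (g_bound l x).
  move=> /allP/(_ k (mem_index_enum _)); rewrite mulf_eq0 (negPf gx)/= sqrf_eq0 => /eqP ox.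
  have bx : `|s - x| < r by rewrite distrC ger0_norm ?subr_ge0 ?(ltW x1)// ltrBlDl.
  by have := hr x bx; rewrite /= ox subr0 ltxx.
(* Negative times are shifted by enough periods to become nonnegative. *)
move=> k s; rewrite -(out_periodic k s (Num.bound `|s / T|)); apply: out0.
rewrite addrC -[s]opprK subr_ge0 -ler_pdivrMr// opprK.
apply: le_trans (ltW (archi_boundP (normr_ge0 (s / T)))).
by rewrite mulNr; apply: le_trans (ler_norm _) _; rewrite normrN.
Qed.

Theorem V_tends : delta R n < V (W t0) -> V (W t) @[t --> +oo] --> (n%:R : R).
Proof.
move=> dW; have [Wl [sWl VWl out0]] := limit_point.
have <- : c = n%:R; last exact: VW_cvg.
rewrite -VWl; apply: delta_max => //; first exact: Gset_limit.
by rewrite VWl; apply: lt_le_trans dW (VW_le t0).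
Qed.

End LaSalle.

(** * The geodesic from Xinf to the identity *)

Section Diagonal.
Context {R : realType}.
Local Notation Re := complex.Re.
Local Notation Im := complex.Im.

Definition cexp (a : R) : R[i] := Complex (cos a) (sin a).

Lemma cexpD a b : cexp (a + b) = cexp a * cexp b.
Proof.
by apply: cplx_eqP; rewrite ?ReM ?ImM/= ?cosD ?sinD// addrC [sin a * _]mulrC [cos a * sin b]mulrC.
Qed.

Lemma cexp0 : cexp 0 = 1.
Proof. by apply: cplx_eqP; rewrite /= ?cos0 ?sin0. Qed.

Lemma cexpJ a : Num.conj (cexp a) = cexp (- a).
Proof. by apply: cplx_eqP; rewrite ?ReJ ?ImJ/= ?cosN ?sinN. Qed.

Lemma cexp_sum I (r : seq I) (F : I -> R) :
  cexp (\sum_(i <- r) F i) = \prod_(i <- r) cexp (F i).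
Proof. exact: (big_morph _ cexpD cexp0). Qed.

Lemma cexp_surj (z : R[i]) : `|z| = 1 -> exists a, z = cexp a.
Proof.
move=> /norm1P h.
have hR : -1 <= Re z <= 1.
  by rewrite -ler_norml -(@ler_pXn2r _ 2) ?nnegrE// expr1n (real_normK (num_real _));
    have := sqr_ge0 (Im z); lra.
have hs : sin (acos (Re z)) = `|Im z|.
  rewrite sin_acos//; have -> : 1 - Re z ^+ 2 = Im z ^+ 2 by lra.
  by rewrite sqrtr_sqr.
have [i0|i0] := leP 0 (Im z).
  by exists (acos (Re z)); apply: cplx_eqP; rewrite /= ?acosK// hs ger0_norm.
exists (- acos (Re z)); apply: cplx_eqP; rewrite /= ?cosN ?sinN ?acosK//.
by rewrite hs ltr0_norm// opprK.
Qed.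

Lemma cos_ge (x : R) : 1 - `|x| <= cos x.
Proof.
wlog x0 : x / 0 <= x.
  move=> h; have [/h//|/ltW x0] := leP 0 x.
  by rewrite -normrN -cosN; apply: h; rewrite oppr_ge0.
have dc (t : R) : is_derive t 1 cos (- sin t) by exact: is_derive_cos.
have di (t : R) : is_derive t 1 id (1 : R) by exact: is_derive_id.
have := derive_dominated x0 dc di => /(_ _)/= h.
have {}h : `|cos x - cos 0| <= x - 0.
  by apply: h => t _; rewrite normrN ler_norml sin_geN1 sin_le1.
by move: h; rewrite cos0 (ger0_norm x0) ler_norml => /andP[]; lra.
Qed.

Context {n : nat}.
Implicit Types (M : 'M[R[i]]_n) (lam : 'I_n -> R).

(** The arguments of the eigenvalues sum to some [S] with [cexp S = 1], because the determinant is
    1; subtracting [S] from a single argument makes the sum zero without changing the eigenvalue. *)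
Lemma diagonalizes_exists (X : 'M[R[i]]_n) : (2 <= n)%N -> SU X ->
  exists M lam, diagonalizes X M lam.
Proof.
move=> n2 sX; have [P [d [uP XE d1 dp]]] := SU_diag sX.
have [l0 hl0] := choice (fun j => cexp_surj (d1 j)).
pose i0 : 'I_n := Ordinal (ltn_trans (ltnSn 0) n2).
pose S := \sum_j l0 j.
have eS : cexp S = 1.
  by rewrite /S cexp_sum -[RHS]dp; apply: eq_bigr => j _; rewrite hl0.
exists P, (fun j => if j == i0 then l0 j - S else l0 j); split; first exact: uP.
  rewrite (bigD1 i0)//= (eq_bigr l0); last by move=> j /negPf ->.
  by rewrite /S (bigD1 i0)//= addrAC subrr.
have e : d = \row_j cexp ((if j == i0 then l0 j - S else l0 j) * (1 - 0)).
  apply/rowP => j; rewrite mxE subr0 mulr1 hl0; case: ifP => // _.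
  by rewrite cexpD -cexpJ eS conjC1 mulr1.
by rewrite XE {1}e.
Qed.

Variables (M : 'M[R[i]]_n) (lam : 'I_n -> R).
Hypothesis uM : M \is unitarymx.
Hypothesis lam0 : \sum_j lam j = 0.

Let MM : M *m M ^t* = 1%:M. Proof. exact/unitarymxP. Qed.

Lemma ZbarE theta : Zbar M lam theta =
  M ^t* *m diag_mx (\row_j cexp (lam j * (1 - theta))) *m M.
Proof. by []. Qed.

Lemma diagJ (d : 'rV[R[i]]_n) : (diag_mx d) ^t* = diag_mx (\row_j Num.conj (d 0 j)).
Proof. by rewrite tr_diag_mx map_diag_mx; congr diag_mx; apply/rowP => j; rewrite !mxE. Qed.

Lemma ZbarJM a b : (Zbar M lam a) ^t* *m Zbar M lam b =
  M ^t* *m diag_mx (\row_j cexp (lam j * (a - b))) *m M.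
Proof.
rewrite !ZbarE !mxJM trmxCK diagJ -!mulmxA; congr (_ *m _).
rewrite [M *m (M ^t* *m _)]mulmxA MM mul1mx mulmxA mulmx_diag.
congr (diag_mx _ *m _); apply/rowP => j; rewrite !mxE cexpJ -cexpD; congr cexp.
by ring.
Qed.

(** Here the normalisation [\sum_j lam j = 0] enters: it keeps the determinant equal to 1 along the
    whole path. *)
Lemma Zbar_SU theta : SU (Zbar M lam theta).
Proof.
split.
  apply/unitarymxP; apply: mulmx1C; rewrite ZbarJM subrr.
  have -> : \row_j cexp (lam j * 0) = const_mx 1.
    by apply/rowP => j; rewrite !mxE mulr0 cexp0.
  by rewrite diag_const_mx mulmx1; exact: unitaryP.
rewrite ZbarE !det_mulmx mulrAC -det_mulmx (unitaryP MM) det1 mul1r det_diag.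
rewrite (eq_bigr (fun j => cexp (lam j * (1 - theta)))); last by move=> j _; rewrite mxE.
by rewrite -cexp_sum -big_distrl/= lam0 mul0r cexp0.
Qed.

Lemma Zbar1 : Zbar M lam 1 = 1%:M.
Proof.
rewrite ZbarE subrr.
have -> : \row_j cexp (lam j * 0) = const_mx 1.
  by apply/rowP => j; rewrite !mxE mulr0 cexp0.
by rewrite diag_const_mx mulmx1; exact: unitaryP.
Qed.

Lemma Zl_SU N l : SU (Zl M lam N l).
Proof. exact: Zbar_SU. Qed.

Lemma Zl0 N : Zl M lam N 0 = Zbar M lam 0.
Proof. by rewrite /Zl mul0r. Qed.

Lemma ZlN N : (0 < N)%N -> Zl M lam N N = 1%:M.
Proof. by move=> N0; rewrite /Zl divff ?Zbar1// pnatr_eq0 -lt0n. Qed.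

Lemma V_Zl N l : (0 < N)%N ->
  V ((Zl M lam N l.+1) ^t* *m Zl M lam N l) = \sum_j cos (lam j / N%:R).
Proof.
move=> N0; rewrite ZbarJM V_diag//; apply: eq_bigr => j _; rewrite mxE/=.
congr cos; congr (_ * _).
by rewrite -mulrBl -natr1 [_ + 1]addrC addrK mul1r.
Qed.

(** By [cos_ge] the sum of cosines is at least [n - s / N], which exceeds delta once
    [N > s / (n - delta)]; the divisor is positive by [delta_lt]. *)
Lemma fine_enough_exists : (2 <= n)%N -> exists N, fine_enough M lam N.
Proof.
move=> n2; have dn := @delta_lt R n n2.
pose s := \sum_j `|lam j|.
have s0 : 0 <= s by exact: sumr_ge0.
have e0 : 0 < n%:R - delta R n by rewrite subr_gt0.
pose N := (Num.bound (s / (n%:R - delta R n))).+1.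
exists N; split=> // l _; rewrite V_Zl//.
apply: (@lt_le_trans _ _ (\sum_j (1 - `|lam j / N%:R|))); last first.
  by apply: ler_sum => j _; exact: cos_ge.
rewrite sumrB sumr_const card_ord ltrBrDl -ltrBrDr.
under eq_bigr do rewrite normrM normfV normr_nat.
rewrite -big_distrl/= -/s ltr_pdivrMr ?ltr0n//.
rewrite -ltr_pdivrMl// mulrC; apply: lt_trans (archi_boundP _) _.
  by rewrite divr_ge0// ltW.
by rewrite ltr_nat.
Qed.

End Diagonal.

(** * Tracking *)

Section HalfLine.
Context {R : realType}.
Implicit Types (s t : R).

Lemma within_half_extend (g : R -> R) : {within `[0, +oo[, continuous g} ->
  continuous (fun t => g (Num.max 0 t)).
Proof.
move=> /subspace_continuousP cg t.
have mt : `[0, +oo[%classic (Num.max 0 t) by rewrite /= in_itv/= andbT le_max lexx.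
have cm : Num.max 0 s @[s --> t] --> Num.max 0 t.
  by apply: (@continuous_max _ _ (cst 0) id); [exact: cvg_cst|exact: cvg_id].
move=> N /(cg _ mt) hN.
have h : \forall s \near t, `[0, +oo[%classic (Num.max 0 s) -> N (g (Num.max 0 s)).
  exact: cm _ hN.
have : \forall s \near t, N (g (Num.max 0 s)); last by [].
by apply: filterS h => s; apply; rewrite /= in_itv/= andbT le_max lexx.
Qed.

Lemma is_derive_rderive (g : R -> R) (t l : R) : is_derive t 1 g l -> is_rderive g t l.
Proof.
move=> [dg <-]; rewrite /is_rderive.
have h : h^-1 *: (g (h *: (1 : R) + t) - g t) @[h --> 0^'] --> 'D_1 g t by exact: dg.
have e : (fun h : R => h^-1 * (g (t + h) - g t)) =
    (fun h : R => h^-1 *: (g (h *: (1 : R) + t) - g t)).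
  by apply/funext => x; rewrite /GRing.scale/= mulr1 [t + x]addrC.
rewrite e => N /h hN.
have h' : \forall x \near (0 : R), x != 0 ->
    N (x^-1 *: (g (x *: (1 : R) + t) - g t)) by exact: hN.
have : \forall x \near (0 : R), 0 < x ->
    N (x^-1 *: (g (x *: (1 : R) + t) - g t)); last by [].
by apply: filterS h' => x xN x0; apply: xN; rewrite gt_eqF.
Qed.

Lemma near_rderive (f g : R -> R) (t l : R) : f t = g t ->
  (\forall s \near t^'+, f s = g s) -> is_rderive f t l -> is_rderive g t l.
Proof.
move=> ft fg; rewrite /is_rderive; apply: cvg_trans; apply: near_eq_cvg.
have : \forall h \near 0^'+, f (t + h) = g (t + h).
  have : \forall s \near t, t < s -> f s = g s by exact: fg.
  move=> /nbhs_ballP[e /= e0 he].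
  suff : \forall h \near (0 : R), 0 < h -> f (t + h) = g (t + h) by [].
  apply/nbhs_ballP; exists e => //= h hb h0.
  by apply: he; rewrite /ball/= ?ltrDl//; move: hb; rewrite /ball/= sub0r opprD addNKr.
by apply: filterS => h e; rewrite ft e.
Qed.

(** [exp (- c t) phi t] is nonincreasing on the half line. *)
Lemma gronwall0 (phi dphi : R -> R) (c : R) : continuous phi ->
  (forall t, 0 < t -> is_derive t 1 phi (dphi t)) ->
  (forall t, 0 < t -> dphi t <= c * phi t) ->
  phi 0 <= 0 -> forall t, 0 <= t -> phi t <= 0.
Proof.
move=> cphi dp h p0 t t0.
pose E (s : R) := expR (- c * s).
have dE (s : R) : is_derive s 1 E (E s * (- c)).
  have d1 : is_derive s 1 (fun s : R => - c * s) (- c).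
    by apply: (is_derive_eq (is_deriveZ (- c) (is_derive_id s 1)));
      rewrite /GRing.scale/= mulr1.
  exact: (@is_derive1_comp _ expR).
have cE : continuous E := is_derive_continuous dE.
have : - (E 0 * phi 0) <= - (E t * phi t).
  apply: (ndecr_of_derive (f := fun s => - (E s * phi s))
      (df := fun s => - (E s * (- c) * phi s + E s * dphi s)) t0).
  - by move=> s; apply: cvgN; apply: cvgM; [exact: cE|exact: cphi].
  - move=> s /andP[s0 _]; exact: (is_deriveN (is_deriveM' (dE s) (dp s s0))).
  - move=> s /andP[s0 _]; rewrite -mulrA -mulrDr -mulrN mulr_ge0 ?expR_ge0//.
    by have := h s s0; lra.
rewrite lerN2 {2}/E mulr0 expR0 mul1r => h1.
by rewrite -(pmulr_rle0 _ (expR_gt0 (- c * t))); exact: le_trans h1 p0.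
Qed.

Context {n : nat}.
Implicit Types (X Y : R -> 'M[R[i]]_n).

Definition mx_continuous X := forall t, mx_cvg (nbhs t) X (X t).

Lemma mx_continuous_halfW X : mx_continuous X -> mx_continuous_half X.
Proof.
by move=> cX i j; split; apply: continuous_subspaceT => t; have [] := cX t i j.
Qed.

(** Freezing a half-line solution at its initial value for negative times makes it continuous on the
    line, so that the whole-line lemmas apply to an arbitrary solution. *)
Lemma solves_half_extend J rhs X : solves_half J rhs X ->
  let Y := fun t => X (Num.max 0 t) in
  mx_continuous Y /\ forall t, 0 < t -> ~ J t -> mx_is_derive Y t (rhs t (Y t)).
Proof.
move=> [cX _ dX] Y; split.
  by move=> t i j; have [c1 c2] := cX i j; split; [exact: (within_half_extend c1)|
    exact: (within_half_extend c2)].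
move=> t t0 Jt; have tm : Num.max 0 t = t by apply/max_idPr/ltW.
rewrite {2}/Y tm.
have nr : \forall s \near t, X s = Y s.
  near=> s; rewrite /Y (max_idPr _)// ltW//; near: s; exact: lt_nbhsr.
move=> i j; have [d1 d2] := dX t t0 Jt i j.
split; [apply: near_eq_is_derive d1|apply: near_eq_is_derive d2];
  by apply: filterS nr => s ->.
Unshelve. all: by end_near. Qed.

Lemma mx_cst_off_finite Y (s : seq R) : mx_continuous Y ->
  (forall t, 0 < t -> t \notin s -> mx_is_derive Y t 0) ->
  forall t, 0 <= t -> Y t = Y 0.
Proof.
move=> cY dY t t0; apply/matrixP => i j; apply/esym.
apply: cplx_eqP.
  apply: (cst_off_finite (f := fun t => complex.Re (Y t i j)) (s := s)) => //.
    by move=> r; have [] := cY r i j.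
  by move=> r /andP[r0 _] rs; have [+ _] := dY r r0 rs i j; rewrite mxE.
apply: (cst_off_finite (f := fun t => complex.Im (Y t i j)) (s := s)) => //.
  by move=> r; have [] := cY r i j.
by move=> r /andP[r0 _] rs; have [_] := dY r r0 rs i j; rewrite mxE.
Qed.

End HalfLine.

(** * From the error Z back to the state X *)

Section Tracking.
Context {R : realType} {n m : nat}.
Implicit Types t : R.
Variables (H : 'I_m -> 'M[R[i]]_n) (uT : 'I_m -> R -> R) (Xr : R -> 'M[R[i]]_n).
Hypothesis H_su : forall k, su (H k).
Hypothesis Xr_SU : forall t, SU (Xr t).
Hypothesis Xr_der : forall t, mx_is_derive Xr t (generator H uT t *m Xr t).

Lemma generatorB (u v : 'I_m -> R -> R) t :
  generator H (fun k t => u k t - v k t) t = generator H u t - generator H v t.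
Proof.
by rewrite /generator -sumrB; apply: eq_bigr => k _; rewrite rmorphB/= scalerBl.
Qed.

Lemma steers_ext J (u v : 'I_m -> R -> R) Y : (forall k t, 0 <= t -> u k t = v k t) ->
  steers H J u Y -> steers H J v Y.
Proof.
have sol (a b : 'I_m -> R -> R) X : (forall k t, 0 <= t -> a k t = b k t) ->
    solution H J a X -> solution H J b X.
  move=> ab [[cX rX dX] X0].
  have ge t : 0 <= t -> generator H b t = generator H a t.
    by move=> t0; apply: eq_bigr => k _; rewrite ab.
  split; last exact: X0.
  split; first exact: cX.
    by rewrite (ge 0 (lexx _)); exact: rX.
  by move=> t t0 Jt; rewrite (ge t (ltW t0)); exact: dX.
move=> uv [[X sX] h]; split; first by exists X; exact: sol uv sX.
by move=> X' sX'; apply: h; apply: sol sX' => k t t0; rewrite uv.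
Qed.

Lemma tracking_alg (A K X Z : 'M[R[i]]_n) : K ^t* = - K -> X *m X ^t* = 1%:M ->
  A *m X *m Z ^t* + X *m (Z *m X ^t* *m K *m X) ^t* = (A - K) *m (X *m Z ^t*).
Proof.
move=> hK hX; rewrite !mxJM trmxCK hK [X *m (X ^t* *m _)]mulmxA hX mul1mx.
by rewrite mulNmx mulmxBl (mulmxA A).
Qed.

(* Z = X^* Xr turns the tracking problem into driving Z to the identity. *)
Lemma tracking_der (v : 'I_m -> R -> R) (Z : R -> 'M[R[i]]_n) t :
  mx_is_derive Z t (Z t *m (Xr t) ^t* *m generator H v t *m Xr t) ->
  mx_is_derive (fun t => Xr t *m (Z t) ^t*) t
    (generator H (fun k t => uT k t - v k t) t *m (Xr t *m (Z t) ^t*)).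
Proof.
move=> dZ; apply: mx_der_eq (mx_derM (Xr_der t) (mx_derJ dZ)) _.
have [hv _] := su_generator v t H_su.
by rewrite generatorB; apply: tracking_alg => //; exact: SU_mulJ.
Qed.

(** [Z] is differentiated at positive times only; [Z0] agrees with it just after 0 and supplies the
    one-sided derivative there. *)
Lemma tracking_steers (J : set R) (s : seq R) (v : 'I_m -> R -> R)
    (Z Z0 : R -> 'M[R[i]]_n) :
  (forall t, J t -> t \in s) ->
  mx_continuous Z -> Z 0 = Xr 0 ->
  (forall t, 0 < t -> ~ J t ->
     mx_is_derive Z t (Z t *m (Xr t) ^t* *m generator H v t *m Xr t)) ->
  mx_is_derive Z0 0 (Z0 0 *m (Xr 0) ^t* *m generator H v 0 *m Xr 0) ->
  Z0 0 = Z 0 -> (\forall t \near 0^'+, Z0 t = Z t) ->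
  (forall t, 0 <= t -> SU (Z t)) ->
  V (Z t) @[t --> +oo] --> (n%:R : R) ->
  steers H J (fun k t => uT k t - v k t) Xr.
Proof.
move=> Js cZ ZX dZ dZ0 Z00 nZ sZ VZ.
pose u k t := uT k t - v k t; pose X t := Xr t *m (Z t) ^t*.
have sX t : 0 <= t -> SU (X t).
  by move=> t0; apply: SU_M => //; apply: SU_J; exact: sZ.
have cX : mx_continuous X.
  by move=> t; apply: mx_cvgM; [exact: mx_der_cont (Xr_der t)|exact: mx_cvgJ].
have dX t : 0 < t -> ~ J t -> mx_is_derive X t (generator H u t *m X t).
  by move=> t0 Jt; apply: tracking_der; exact: dZ.
have X0 : X 0 = 1%:M by rewrite /X ZX SU_mulJ.
have solX : solution H J u X.
  split=> //; split=> //; first exact: mx_continuous_halfW.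
  have d0 := tracking_der dZ0.
  have e0 : generator H u 0 *m X 0 = generator H u 0 *m (Xr 0 *m (Z0 0) ^t*).
    by rewrite /X Z00.
  rewrite e0 => i j; have [r1 r2] := d0 i j; split.
    apply: near_rderive (is_derive_rderive r1); first by rewrite /X Z00.
    by apply: filterS nZ => t e; rewrite /X e.
  apply: near_rderive (is_derive_rderive r2); first by rewrite /X Z00.
  by apply: filterS nZ => t e; rewrite /X e.
split; first by exists X.
move=> Y [sY Y0]; have [cY' dY'] := solves_half_extend sY.
set Y' := (fun t => Y (Num.max 0 t)) in cY' dY'.
(* Uniqueness: with the same skew-Hermitian generator, [X^* Y] has derivative zero off [s]; being
   continuous, it keeps its initial value 1. *)
have YE t : 0 <= t -> Y t = X t.
  move=> t0; have eY : Y t = Y' t by rewrite /Y' (max_idPr t0).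
  have cP : mx_continuous (fun t => (X t) ^t* *m Y' t).
    by move=> r; apply: mx_cvgM => //; apply: mx_cvgJ; exact: cX.
  have dP r : 0 < r -> r \notin s -> mx_is_derive (fun t => (X t) ^t* *m Y' t) r 0.
    move=> r0 rs; have Jr : ~ J r by move=> /Js; rewrite (negPf rs).
    apply: mx_der_eq (mx_derM (mx_derJ (dX r r0 Jr)) (dY' r r0 Jr)) _.
    by have [hu _] := su_generator u r H_su; rewrite mxJM hu mulmxN mulNmx mulmxA addNr.
  have := mx_cst_off_finite cP dP t0.
  rewrite /= X0 mxJ1 mul1mx {2}/Y' maxxx Y0 -eY => h.
  by rewrite -[RHS]mulmx1 -h mulmxA SU_mulJ ?mul1mx//; exact: sX.
split; first by move=> t t0; rewrite YE//; exact: sX.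
(* [X - Xr] is [Xr] times [Z^* - 1], and the unitary factor preserves the norm. *)
have eE t : 0 <= t -> enorm (Y t - Xr t) = Num.sqrt (2 * (n%:R - V (Z t))).
  move=> t0; rewrite YE// /X -[X in _ - X]mulmx1 -mulmxBr enormE nsqUl; last by case: (Xr_SU t).
  by rewrite nsq_sub1 ?V_J//; apply: SU_J; exact: sZ.
have lim : Num.sqrt (2 * (n%:R - V (Z t))) @[t --> +oo] --> (0 : R).
  rewrite -[X in _ --> X](sqrtr0 R) -(mulr0 (2 : R)) -(subrr (n%:R : R)).
  apply: (cvg_comp (fun t => 2 * (n%:R - V (Z t))) Num.sqrt); last exact: sqrt_continuous.
  by apply: cvgM; [exact: cvg_cst|apply: cvgB => //; exact: cvg_cst].
apply: cvg_trans lim; apply: near_eq_cvg.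
near=> t; rewrite eE//; near: t; apply: nbhs_pinfty_ge; exact: num_real.
Unshelve. all: by end_near. Qed.

Variable f : 'I_m -> R.

(** Gronwall for [nsq D]. The difference satisfies [D' = S(Y) D - R]: the first term contributes
    nothing because [S(Y)] is skew-Hermitian, and R is bounded by a multiple of D using only that
    [X] and [Xr] lie in SU(n), so no a priori bound on [Y] enters. *)
Lemma closed_loop_unique (X Y : R -> 'M[R[i]]_n) :
  (forall t, SU (X t)) ->
  (forall t, 0 < t -> mx_is_derive X t (closed_loop H f Xr uT t (X t))) ->
  mx_continuous X -> mx_continuous Y ->
  (forall t, 0 < t -> mx_is_derive Y t (closed_loop H f Xr uT t (Y t))) ->
  X 0 = Y 0 -> forall t, 0 <= t -> Y t = X t.
Proof.
move=> sX dX cX cY dY XY0.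
pose D t := Y t - X t.
pose b : R := 2 * n%:R ^+ 2.
have b0 : 0 <= b by rewrite /b mulr_ge0// exprn_ge0.
pose a k t (A : 'M[R[i]]_n) := f k ^+ 2 * V (A ^t* *m H k *m Xr t).
pose S t (A : 'M[R[i]]_n) := generator H uT t - \sum_k (a k t A)%:C *: H k.
have clE t A : closed_loop H f Xr uT t A = S t A *m A.
  rewrite /closed_loop; congr (_ *m _).
  exact: (generatorB uT (fun k s => f k ^+ 2 * V (A ^t* *m H k *m Xr s)) t).
have SJ t A : (S t A) ^t* = - S t A.
  have : su (S t A).
    apply: su_D; first exact: su_generator.
    by apply: su_N; apply: su_sum => k; exact: su_Z.
  by case.
have cD : mx_continuous D by move=> t; apply: mx_cvgD => //; apply: mx_cvgN; exact: cX.
pose dD t := closed_loop H f Xr uT t (Y t) - closed_loop H f Xr uT t (X t).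
have dDE t : 0 < t -> mx_is_derive D t (dD t).
  by move=> t0; apply: mx_derD; [exact: dY|apply: mx_derN; exact: dX].
have aB k t : a k t (Y t) - a k t (X t) = f k ^+ 2 * V ((D t) ^t* *m H k *m Xr t).
  by rewrite /a -mulrBr -V_B -!mulmxBl -mxJB.
have dDS t : dD t = S t (Y t) *m D t -
    \sum_k (a k t (Y t) - a k t (X t))%:C *: (H k *m X t).
  have split (P Q A B : 'M[R[i]]_n) : P *m A - Q *m B = P *m (A - B) - (Q - P) *m B.
    by rewrite mulmxBr mulmxBl opprB addrA subrK.
  rewrite /dD !clE split; congr (_ - _).
  have -> : S t (X t) - S t (Y t) = \sum_k (a k t (Y t) - a k t (X t))%:C *: H k.
    have sub2 (A P Q : 'M[R[i]]_n) : (A - P) - (A - Q) = Q - P.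
      by rewrite opprB addrC addrA subrK.
    rewrite /S sub2 -sumrB; apply: eq_bigr => k _.
    by rewrite rmorphB/= scalerBl.
  by rewrite mulmx_suml; apply: eq_bigr => k _; rewrite scalemxAl.
pose phi t := nsq (D t).
have phiE : phi = fun t => V ((D t) ^t* *m D t) by apply/funext => t; rewrite /phi nsqE.
have cphi : continuous phi.
  by rewrite phiE => t; exact: (V_cvg (mx_cvgM (mx_cvgJ (cD t)) (cD t))).
pose dphi t := 2 * V ((D t) ^t* *m dD t).
have dphiE (t : R) : 0 < t -> is_derive t 1 phi (dphi t).
  move=> t0; rewrite phiE.
  apply: (is_derive_eq (V_der (mx_derM (mx_derJ (dDE t t0)) (dDE t t0)))).
  rewrite V_D -[V ((dD t) ^t* *m _)]V_J mxJM trmxCK /dphi.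
  by move: (V _) => x; lra.
pose c0 := \sum_k f k ^+ 2 * (mxabs (H k) * b) ^+ 2.
have c00 : 0 <= c0.
  by apply: sumr_ge0 => k _; rewrite mulr_ge0 ?sqr_ge0.
have ineq t : dphi t <= 2 * c0 * b * phi t.
  have h1 : V ((D t) ^t* *m dD t) =
      - \sum_k f k ^+ 2 * V ((D t) ^t* *m H k *m Xr t) * V ((D t) ^t* *m (H k *m X t)).
    rewrite dDS mulmxBr V_B mulmxA V_C mulmxA.
    rewrite (V_skew_cst (SJ t (Y t))); last by rewrite mxJM trmxCK.
    rewrite sub0r mulmx_sumr V_sum; congr (- _); apply: eq_bigr => k _.
    by rewrite -scalemxAr V_Z aB.
  have h2 : `|V ((D t) ^t* *m dD t)| <= c0 * mxabs (D t) ^+ 2.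
    rewrite h1 normrN; apply: le_trans (ler_norm_sum _ _ _) _.
    rewrite /c0 big_distrl/=; apply: ler_sum => k _.
    rewrite normrM [X in X * _]normrM (ger0_norm (sqr_ge0 (f k))).
    rewrite -mulrA -[leRHS](mulrA (f k ^+ 2)); apply: ler_wpM2l; first exact: sqr_ge0.
    have mD (A : 'M[R[i]]_n) : SU A -> mxabs ((D t) ^t* *m (H k *m A)) <=
        mxabs (D t) * (mxabs (H k) * b).
      move=> sA; apply: mxabsM_le; first by rewrite mxabsJ.
      by apply: mxabsM_le => //; exact: SU_mxabs.
    rewrite [leRHS](_ : _ = (mxabs (D t) * (mxabs (H k) * b)) *
      (mxabs (D t) * (mxabs (H k) * b))); last by ring.
    apply: ler_pM => //.
      by apply: le_trans (V_le_mxabs _) _; rewrite -mulmxA; exact: mD.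
    by apply: le_trans (V_le_mxabs _) _; exact: mD.
  rewrite /dphi -(mulrA 2) -(mulrA 2); apply: ler_wpM2l => //.
  apply: le_trans (ler_norm _) _.
  apply: le_trans h2 _; rewrite -mulrA; apply: ler_wpM2l => //; exact: mxabs_sqr_le.
move=> t t0; have : phi t <= 0.
  apply: (@gronwall0 R phi dphi _ cphi dphiE (fun t _ => ineq t) _ t t0).
  by rewrite /phi /D XY0 subrr nsqE mulmx0 /V mxtrace0.
move=> p0; apply/eqP; rewrite -subr_eq0; apply/eqP; apply: nsq_eq0.
by apply/eqP; rewrite eq_le nsq_ge0 andbT.
Qed.

End Tracking.

(** * Gluing *)

Section Glue.
Context {R : realType}.
Implicit Types (s t tau : R).

Definition glue {A : Type} tau (f g : R -> A) t := if tau <= t then g t else f t.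

Lemma near_glue_l {A : Type} tau (f g : R -> A) t : t < tau ->
  \forall s \near t, f s = glue tau f g s.
Proof.
by move=> tt; near=> s; rewrite /glue leNgt ifF//; apply/negbTE/negPn; near: s; exact: lt_nbhsl.
Unshelve. all: by end_near. Qed.

Lemma near_glue_r {A : Type} tau (f g : R -> A) t : tau < t ->
  \forall s \near t, g s = glue tau f g s.
Proof.
by move=> tt; near=> s; rewrite /glue ltW//; near: s; exact: lt_nbhsr.
Unshelve. all: by end_near. Qed.

Lemma glue_cvg tau (f g : R -> R) (F : set_system R) {FF : Filter F} (l : R) :
  f s @[s --> F] --> l -> g s @[s --> F] --> l -> glue tau f g s @[s --> F] --> l.
Proof.
move=> fl gl N Nl; have := fl N Nl; have := gl N Nl => h1 h2.
have k1 : \forall s \near F, N (g s) by exact: h1.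
have k2 : \forall s \near F, N (f s) by exact: h2.
have : \forall s \near F, N (glue tau f g s); last by [].
by apply: filterS2 k1 k2 => s; rewrite /glue; case: ifP.
Qed.

Lemma glue_continuous tau (f g : R -> R) : continuous f -> continuous g ->
  f tau = g tau -> continuous (glue tau f g).
Proof.
move=> cf cg fg t; have [tt|tt|->] := ltgtP t tau.
- have e : glue tau f g t = f t by rewrite /glue leNgt tt.
  by rewrite /continuous_at e; apply: cvg_trans (cf t); apply: near_eq_cvg; exact: near_glue_l.
- have e : glue tau f g t = g t by rewrite /glue ltW.
  by rewrite /continuous_at e; apply: cvg_trans (cg t); apply: near_eq_cvg; exact: near_glue_r.
- have e : glue tau f g tau = g tau by rewrite /glue lexx.
  rewrite /continuous_at e; apply: glue_cvg; last exact: cg.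
  by rewrite -fg; exact: cf.
Qed.

(** In Caratheodory's form the derivative is a slope function continuous at [tau]; both slope
    functions take the value [df] there, so they can be glued as well. *)
Lemma glue_derive tau (f g : R -> R) (df : R) : is_derive tau 1 f df ->
  is_derive tau 1 g df -> f tau = g tau -> is_derive tau 1 (glue tau f g) df.
Proof.
move=> /is_derive1_caratheodory[hf [fE cf hfE]] /is_derive1_caratheodory[hg [gE cg hgE]] fg.
apply/is_derive1_caratheodory; exists (glue tau hf hg); split.
- move=> z; have -> : glue tau f g tau = g tau by rewrite /glue lexx.
  by rewrite /glue; case: ifP => _; [exact: gE|rewrite -fg; exact: fE].
- have e : glue tau hf hg tau = df by rewrite /glue lexx.
  have : glue tau hf hg s @[s --> tau] --> glue tau hf hg tau; last by [].
  rewrite e; apply: glue_cvg; first by rewrite -hfE; exact: cf.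
  by rewrite -hgE; exact: cg.
- by rewrite /glue lexx.
Qed.

Context {n : nat}.
Implicit Types (A B : R -> 'M[R[i]]_n).

Lemma glue_entry (p : R[i] -> R) tau A B i j :
  (fun s => p (glue tau A B s i j)) = glue tau (fun s => p (A s i j)) (fun s => p (B s i j)).
Proof. by apply/funext => s; rewrite /glue; case: ifP. Qed.

Lemma glue_mx_continuous tau A B : mx_continuous A -> mx_continuous B ->
  A tau = B tau -> mx_continuous (glue tau A B).
Proof.
move=> cA cB AB t i j; split.
  rewrite (glue_entry (@complex.Re R)).
  have -> : complex.Re (glue tau A B t i j) =
      glue tau (fun s => complex.Re (A s i j)) (fun s => complex.Re (B s i j)) t.
    by rewrite /glue; case: ifP.
  apply: glue_continuous; last by rewrite AB.
    by move=> s; have [] := cA s i j.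
  by move=> s; have [] := cB s i j.
rewrite (glue_entry (@complex.Im R)).
have -> : complex.Im (glue tau A B t i j) =
    glue tau (fun s => complex.Im (A s i j)) (fun s => complex.Im (B s i j)) t.
  by rewrite /glue; case: ifP.
apply: glue_continuous; last by rewrite AB.
  by move=> s; have [] := cA s i j.
by move=> s; have [] := cB s i j.
Qed.

Lemma near_mx_is_derive A B t L : (\forall s \near t, A s = B s) ->
  mx_is_derive A t L -> mx_is_derive B t L.
Proof.
move=> AB dA i j; have [d1 d2] := dA i j; split.
  by apply: near_eq_is_derive d1; apply: filterS AB => s ->.
by apply: near_eq_is_derive d2; apply: filterS AB => s ->.
Qed.

Lemma glue_mx_der tau A B L : mx_is_derive A tau L -> mx_is_derive B tau L ->
  A tau = B tau -> mx_is_derive (glue tau A B) tau L.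
Proof.
move=> dA dB AB i j; have [a1 a2] := dA i j; have [b1 b2] := dB i j; split.
  by rewrite (glue_entry (@complex.Re R)); apply: glue_derive => //; rewrite AB.
by rewrite (glue_entry (@complex.Im R)); apply: glue_derive => //; rewrite AB.
Qed.

(* Stage l (from 1 on) takes over at time T l; the first one also covers the
   times before T 1. *)
Fixpoint glued {A : Type} (T : nat -> R) (F : nat -> R -> A) (L : nat) : R -> A :=
  if L is L'.+1 then glue (T L) (glued T F L') (F L) else F 1%N.

Lemma glued_last {A : Type} (T : nat -> R) (F : nat -> R -> A) L t : (0 < L)%N ->
  T L <= t -> glued T F L t = F L t.
Proof. by case: L => // L _ tt; rewrite /= /glue tt. Qed.

Lemma glued_stage {A : Type} (T : nat -> R) (F : nat -> R -> A) N l t :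
  (forall a b, (1 <= a <= b)%N -> (b <= N)%N -> T a <= T b) ->
  (1 <= l < N)%N -> T l <= t < T l.+1 -> glued T F N t = F l t.
Proof.
move=> Tm /andP[l1 lN] /andP[t1 t2].
have : forall L, (l <= L <= N)%N -> glued T F L t = F l t; last first.
  by apply; rewrite (ltnW lN) leqnn.
elim=> [|L IH]; first by rewrite leqn0; case: l l1 {lN t1 t2}.
move=> /andP[]; rewrite leq_eqVlt => /predU1P[e _|].
  by rewrite -e; exact: glued_last.
rewrite ltnS => lL LN; rewrite /= /glue ifF; first by rewrite IH// lL ltnW.
apply/negbTE; rewrite -ltNge; apply: lt_le_trans t2 _.
by apply: Tm => //; rewrite ltnS lL.
Qed.

Lemma glued_all {A : Type} (P : A -> Prop) (T : nat -> R) (F : nat -> R -> A) L t :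
  (0 < L)%N -> (forall l, (1 <= l <= L)%N -> P (F l t)) -> P (glued T F L t).
Proof.
move=> L0 hF; have : forall K, (K <= L)%N -> P (glued T F K t); last by apply.
elim=> [|K IH] KL; first by apply: hF; rewrite L0.
rewrite /= /glue; case: ifP => _; first by apply: hF; rewrite KL.
by apply: IH; exact: ltnW.
Qed.

Lemma glued_mx_continuous (T : nat -> R) (F : nat -> R -> 'M[R[i]]_n) N :
  (0 < N)%N ->
  (forall a b, (1 <= a <= b)%N -> (b <= N)%N -> T a <= T b) ->
  (forall l, (1 <= l <= N)%N -> mx_continuous (F l)) ->
  (forall l, (1 <= l < N)%N -> F l (T l.+1) = F l.+1 (T l.+1)) ->
  mx_continuous (glued T F N).
Proof.
move=> N0 Tm cF FF.
have : forall L, (L <= N)%N -> mx_continuous (glued T F L); last by apply.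
elim=> [|L IH] LN; first by apply: cF; rewrite N0.
apply: (@glue_mx_continuous (T L.+1) (glued T F L) (F L.+1));
  [by apply: IH; exact: ltnW|by apply: cF; rewrite LN|].
have [->//|L0] := posnP L.
by rewrite glued_last ?FF ?L0//; apply: Tm => //; rewrite L0 leqnSn.
Qed.

Lemma switching_timesS (T : nat -> R) N t : ~ switching_times N.+1 T t -> ~ switching_times N T t.
Proof.
by move=> h [l /andP[l2 lN] tE]; apply: h; exists l => //; rewrite l2 leqW.
Qed.

(** Switching times are numbered from 2, so for [L = 0] the conclusion rests on [t] being positive
    and [T 1] zero. *)
Lemma switching_timesN (T : nat -> R) L t : 0 < t -> T 1%N = 0 ->
  ~ switching_times L.+1 T t -> t != T L.+1.
Proof.
move=> t0 T1 h; apply/eqP => tE; apply: h; case: L tE => [|L] tE.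
  by move: t0; rewrite tE T1 ltxx.
by exists L.+2; rewrite ?leqnn.
Qed.

Lemma glued_piecewise (T : nat -> R) (F : nat -> R -> R) N :
  (0 < N)%N -> T 1%N = 0 -> (forall l, (1 <= l <= N)%N -> continuous (F l)) ->
  piecewise_continuous_half (switching_times N T) (glued T F N).
Proof.
move=> N0 T1 cF.
have : forall L, (L <= N)%N -> piecewise_continuous_half (switching_times L T) (glued T F L); last by apply.
have right_ (f : R -> R) (t : R) : continuous f -> f s @[s --> t^'+] --> f t.
  by move=> cf; apply: cvg_at_right_filter; exact: cf.
have left_ (f : R -> R) (t : R) : continuous f -> f s @[s --> t^'-] --> f t.
  by move=> cf; apply: cvg_at_left_filter; exact: cf.
elim=> [|L IH] LN.
  have c1 : continuous (F 1%N) by apply: cF; rewrite N0.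
  split=> [t _|t _|t _ _]; [exact: right_| |exact: c1].
  by apply: cvgP; exact: left_.
have [r l c] := IH (ltnW LN); have cL : continuous (F L.+1) by apply: cF; rewrite LN.
split=> [t t0|t t0|t t0 Jt].
- have [tt|tt] := leP (T L.+1) t.
    have -> : glued T F L.+1 t = F L.+1 t by rewrite glued_last.
    apply: cvg_trans (right_ _ t cL); apply: near_eq_cvg.
    near=> s; have ts : t <= s by near: s; exact: nbhs_right_ge.
    by rewrite /= /glue (le_trans tt).
  have -> : glued T F L.+1 t = glued T F L t by rewrite /= /glue leNgt tt.
  apply: cvg_trans (r t t0); apply: near_eq_cvg; apply: cvg_within.
  exact: near_glue_l.
- have [tt|tt] := leP t (T L.+1).
    have /cvg_ex[x hx] := l t t0; apply/cvg_ex; exists x.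
    apply: cvg_trans hx; apply: near_eq_cvg.
    near=> s; have ts : s < t by near: s; exact: nbhs_left_lt.
    by rewrite /= /glue leNgt (lt_le_trans ts tt).
  apply/cvg_ex; exists (F L.+1 t).
  apply: cvg_trans (left_ _ t cL); apply: near_eq_cvg; apply: cvg_within.
  exact: near_glue_r.
- have tN := switching_timesN t0 T1 Jt; have [tt|tt|tE] := ltgtP t (T L.+1).
  + have e : glued T F L.+1 t = glued T F L t by rewrite /= /glue leNgt tt.
    have : glued T F L.+1 s @[s --> t] --> glued T F L.+1 t; last by [].
    rewrite e; apply: cvg_trans (c t t0 (switching_timesS Jt)).
    by apply: near_eq_cvg; exact: near_glue_l.
  + have e : glued T F L.+1 t = F L.+1 t by rewrite /= /glue ltW.
    have : glued T F L.+1 s @[s --> t] --> glued T F L.+1 t; last by [].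
    rewrite e; apply: cvg_trans (cL t).
    by apply: near_eq_cvg; exact: near_glue_r.
  + by move: tN; rewrite tE eqxx.
Unshelve. all: by end_near. Qed.

Lemma glued_mx_der (B : Type) (T : nat -> R) (F : nat -> R -> 'M[R[i]]_n)
    (v : nat -> R -> B) (rhs : R -> B -> 'M[R[i]]_n -> 'M[R[i]]_n) N :
  (0 < N)%N -> T 1%N = 0 ->
  (forall l, (1 <= l <= N)%N -> forall t, mx_is_derive (F l) t (rhs t (v l t) (F l t))) ->
  forall t, 0 < t -> ~ switching_times N T t ->
    mx_is_derive (glued T F N) t (rhs t (glued T v N t) (glued T F N t)).
Proof.
move=> N0 T1 dF t t0.
have : forall L, (L <= N)%N -> ~ switching_times L T t ->
  mx_is_derive (glued T F L) t (rhs t (glued T v L t) (glued T F L t)); last by apply.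
elim=> [|L IH] LN Jt; first by apply: dF; rewrite N0.
have tN := switching_timesN t0 T1 Jt; have [tt|tt|tE] := ltgtP t (T L.+1).
- have e (A : Type) (G : nat -> R -> A) : glued T G L.+1 t = glued T G L t.
    by rewrite /= /glue leNgt tt.
  rewrite !e; apply: near_mx_is_derive (IH (ltnW LN) (switching_timesS Jt)).
  exact: near_glue_l.
- have e (A : Type) (G : nat -> R -> A) : glued T G L.+1 t = G L.+1 t.
    by rewrite /= /glue ltW.
  rewrite !e; apply: near_mx_is_derive (dF L.+1 LN t).
  exact: near_glue_r.
- by move: tN; rewrite tE eqxx.
Qed.

End Glue.

(** * The three controls *)

Section Main.
Context {R : realType} {n m : nat}.
Variables (H : 'I_m -> 'M[R[i]]_n) (Xinf : 'M[R[i]]_n) (T : R).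
Variables (uT : 'I_m -> R -> R) (XrT : R -> 'M[R[i]]_n).
Implicit Types (s t : R) (g : 'I_m -> R -> R).
Hypothesis n2 : (2 <= n)%N.
Hypothesis H_su : forall k, su (H k).
Hypothesis Xinf_SU : SU Xinf.
Hypothesis T0 : 0 < T.
Hypothesis ref : regular_reference H T uT XrT.
Variable Xr : R -> 'M[R[i]]_n.
Hypothesis XrE : forall t, Xr t = XrT t *m Xinf.

(** The conditions that the limit argument puts on a gain, shared by [f k ^ 2] and [sine_gain]. *)
Definition admissible_gain g := exists G,
  [/\ forall k, continuous (g k), forall k t, 0 <= g k t <= G,
      forall k t, g k (t + T) = g k t &
      forall k t (r : R), 0 < r -> exists s, t < s < t + r /\ g k s != 0].

Lemma const_gain (f : 'I_m -> R) : (forall k, 0 < f k ^+ 2) ->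
  admissible_gain (fun k _ => f k ^+ 2).
Proof.
move=> f0; exists (\sum_k f k ^+ 2); split=> [k t|k t|//|k t r r0].
- exact: cvg_cst.
- rewrite ltW//= (bigD1 k)//= lerDl; apply: sumr_ge0 => j _; exact: ltW.
- by exists (t + r / 2); rewrite gt_eqF//; split=> //; lra.
Qed.

Definition sine_gain (k : 'I_m) t := sin (pi / T * t) ^+ 2.

Lemma sine_gain_switch k (j : nat) : sine_gain k (j%:R * T) = 0.
Proof.
rewrite /sine_gain mulrCA divfK ?gt_eqF//.
elim: j => [|j IH]; first by rewrite mul0r sin0 expr0n.
by rewrite -natr1 mulrDl mul1r sinDpi sqrrN.
Qed.

(* Two zeros of sin at distance less than pi cannot both occur. *)
Lemma sine_gain_admissible : admissible_gain sine_gain.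
Proof.
exists 1; split=> [k t|k t|k t|k t r r0].
- have cs : continuous (fun t => sin (pi / T * t)).
    move=> s; apply: (@continuous_comp _ _ _ (fun s : R => pi / T * s) sin).
      by apply: cvgM; [exact: cvg_cst|exact: cvg_id].
    exact: continuous_sin.
  by rewrite /sine_gain; under eq_fun do rewrite expr2; apply: cvgM; exact: cs.
- rewrite /sine_gain sqr_ge0/= -(expr1n _ 2) -ler_sqrt ?expr1n// sqrtr1 sqrtr_sqr.
  by rewrite ler_norml sin_geN1 sin_le1.
- by rewrite /sine_gain mulrDr divfK ?gt_eqF// sinDpi sqrrN.
(* The bound [r / 3] puts both [t + d] and [t + 2 d] in the window, and [T / 2] makes their phases
   differ by less than pi. *)
- pose d := Num.min (r / 3) (T / 2).
  have d0 : 0 < d by rewrite lt_min !divr_gt0.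
  have dr : d <= r / 3 by rewrite ge_min lexx.
  have dT : d < T by apply: (@le_lt_trans _ _ (T / 2)); [rewrite ge_min lexx orbT|rewrite ltr_pdivrMr// ltr_pMr// ltr1n].
  have [s1|s1] := eqVneq (sin (pi / T * (t + d))) 0; last first.
    by exists (t + d); split; [lra|rewrite /sine_gain sqrf_eq0].
  exists (t + 2 * d); split; first lra.
  rewrite /sine_gain sqrf_eq0; apply/eqP => s2.
  have : 0 < sin (pi / T * d).
    apply: sin_gt0_pi; rewrite mulr_gt0 ?divr_gt0 ?pi_gt0//=.
    by rewrite -mulrA gtr_pMr ?pi_gt0// mulrC ltr_pdivrMr// mul1r.
  have -> : pi / T * d = pi / T * (t + 2 * d) - pi / T * (t + d) by ring.
  by rewrite sinB s1 s2 mul0r mulr0 subrr ltxx.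
Qed.

Let XrS := Xr_SU H_su Xinf_SU ref XrE.
Let XrD := Xr_der ref XrE.
Let XrC := Xr_cont ref XrE.

Lemma Xr_0 : Xr 0 = Xinf.
Proof. by rewrite XrE; have [_ [_ ->] _ _] := ref; rewrite mul1mx. Qed.

Lemma sol_exists g t0 W0 : admissible_gain g -> SU W0 ->
  exists2 W, solves_line (gaux H g Xr) W & W t0 = W0.
Proof.
move=> [G [gc gb _ _]] sW0.
apply: (gaux_exists H_su XrS (G := G) _ gc XrC) => //.
by move=> k t; have /andP[g0 gG] := gb k t; rewrite ger0_norm.
Qed.

Lemma sol_SU g W t0 : solves_line (gaux H g Xr) W -> SU (W t0) -> forall t, SU (W t).
Proof. exact: (gaux_SU H_su XrS). Qed.

Lemma sol_limit g W t0 : admissible_gain g -> solves_line (gaux H g Xr) W ->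
  SU (W t0) -> delta R n < V (W t0) -> V (W t) @[t --> +oo] --> (n%:R : R).
Proof.
move=> [G [gc gb gp gd]].
exact: (V_tends n2 H_su Xinf_SU T0 ref XrE gc gb gp gd).
Qed.

Lemma sol_continuous g W : solves_line (gaux H g Xr) W -> mx_continuous W.
Proof. by move=> sW t; exact: mx_der_cont (sW t). Qed.

Lemma sol_out_continuous g W k : solves_line (gaux H g Xr) W ->
  continuous (fun t => out H Xr k t (W t)).
Proof.
move=> sW t.
have ci : s @[s --> t] --> t by exact: cvg_id.
exact: (@out_cvg _ _ _ H Xr XrC R (nbhs t) _ k id t W (W t) ci (sol_continuous sW t)).
Qed.

Lemma sol_mul_der g W (C : 'M[R[i]]_n) (v : 'I_m -> R -> R) t :
  solves_line (gaux H g Xr) W -> (forall k, v k t = g k t * out H Xr k t (W t)) ->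
  mx_is_derive (fun t => C *m W t) t
    (C *m W t *m (Xr t) ^t* *m generator H v t *m Xr t).
Proof.
move=> sW vE; apply: mx_der_eq (mx_derMl C (sW t)) _.
have -> : generator H v t = \sum_k (g k t * out H Xr k t (W t))%:C *: H k.
  by apply: eq_bigr => k _; rewrite vE.
by rewrite gauxE !(mulmxA C).
Qed.

(** This lets a stage end: [W] tends to 1, so [V (C *m W t)] tends to [V C], and the next stage
    starts where its own convergence is guaranteed. *)
Lemma V_mul_near W (C : 'M[R[i]]_n) (d : R) : (forall t, SU (W t)) ->
  V (W t) @[t --> +oo] --> (n%:R : R) -> d < V C ->
  exists t1, forall t, t1 <= t -> d < V (C *m W t).
Proof.
move=> sW VW dC; pose a := V C - d; pose b : R := 2 * n%:R ^+ 2; pose c := mxabs C ^+ 2 * b + 1.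
have a0 : 0 < a by rewrite subr_gt0.
have b0 : 0 <= b by rewrite /b mulr_ge0// exprn_ge0.
have c0 : 0 < c by rewrite ltr_wpDl// mulr_ge0// sqr_ge0.
(* The squared error in V is at most [mxabs C ^ 2 * b * 2 (n - V W)], whence this threshold for
   [n - V W]; the [+ 1] in [c] keeps it well defined for [C = 0]. *)
have e0 : 0 < a ^+ 2 / (2 * c) by rewrite divr_gt0 ?exprn_gt0 ?mulr_gt0.
have /cvgrPdist_lt/(_ _ e0)[t1 [_ h]] := VW.
exists (t1 + 1) => t tt; have t1t : t1 < t by apply: lt_le_trans tt; rewrite ltrDl.
have {}h := h t t1t.
have hV : V C - V (C *m W t) = - V (C *m (W t - 1%:M)).
  by rewrite mulmxBr mulmx1 V_B opprB.
have hn : `|V (C *m (W t - 1%:M))| ^+ 2 < a ^+ 2.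
  have k1 : `|V (C *m (W t - 1%:M))| <= mxabs C * mxabs (W t - 1%:M).
    by apply: le_trans (V_le_mxabs _) (mxabsM _ _).
  have k2 : `|V (C *m (W t - 1%:M))| ^+ 2 <= (mxabs C * mxabs (W t - 1%:M)) ^+ 2.
    by rewrite ler_pXn2r ?nnegrE ?mulr_ge0 ?mxabs_ge0.
  apply: le_lt_trans k2 _; rewrite exprMn.
  have k3 := mxabs_sqr_le (W t - 1%:M); rewrite nsq_sub1// in k3.
  apply: le_lt_trans (ler_wpM2l (sqr_ge0 _) k3) _.
  have vn : V (W t) <= n%:R by exact: V_le_n.
  move: h; rewrite /= ger0_norm ?subr_ge0// ltr_pdivlMr ?mulr_gt0// -/b => h.
  move: (V (W t)) vn h => w vn h.
  have k4 : (n%:R - w) * (2 * (mxabs C ^+ 2 * b)) <= (n%:R - w) * (2 * c).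
    by rewrite ler_wpM2l ?subr_ge0// /c; lra.
  apply: le_lt_trans h; apply: le_trans k4.
  by rewrite le_eqVlt; apply/orP; left; apply/eqP; ring.
have : `|V (C *m (W t - 1%:M))| < a.
  by rewrite -(@ltr_pXn2r _ 2) ?nnegrE// ltW.
rewrite ltr_norml => /andP[h1 _]; move: hV h1; rewrite /a.
by move: (V _) (V (C *m W t)) => x y; lra.
Qed.

Lemma uT_continuous k : continuous (uT k).
Proof.
move=> t; have [/(_ k)[su_ _] _ _ _] := ref.
by apply/differentiable_continuous/derivable1_diffP; exact: (su_ 0%N).
Qed.

(** * Continuous controls with a vanishing gain *)

Section Continuous.
Variables (M : 'M[R[i]]_n) (lam : 'I_n -> R) (N : nat).
Hypothesis dM : diagonalizes Xinf M lam.
Hypothesis fN : fine_enough M lam N.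

Let uM : M \is unitarymx. Proof. by case: dM. Qed.
Let lam0 : \sum_j lam j = 0. Proof. by case: dM. Qed.
Let N0 : (0 < N)%N. Proof. by case: fN. Qed.

(** The invariant at the start of stage [l], at time [j T]: the controls vanish there and the error
    lies in the region of convergence of that stage. What [v] and [Z] do afterwards is overwritten
    by the next gluing. *)
Definition partial_run (l : nat) (v : 'I_m -> R -> R) (Z : R -> 'M[R[i]]_n) (j : nat) :=
  [/\ forall k, continuous (v k) /\ v k (j%:R * T) = 0,
      forall t, mx_is_derive Z t (Z t *m (Xr t) ^t* *m generator H v t *m Xr t),
      Z 0 = Xinf, forall t, SU (Z t) &
      delta R n < V ((Zl M lam N l) ^t* *m Z (j%:R * T))].

Lemma partial_run_start : partial_run 1 (fun _ _ => 0) (fun=> Xinf) 0.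
Proof.
split=> //.
- by move=> k; split=> // t; exact: cvg_cst.
- move=> t; apply: mx_der_eq (mx_der_cst t Xinf) _.
  rewrite /generator big1 ?mulmx0 ?mul0mx// => k _; exact: scale0r.
- have [_ _ XE] := dM; rewrite {1}XE -(Zl0 M lam N); have [_ h] := fN; exact: h.
Qed.

(* The gain vanishes at multiples of T, so switching there keeps the controls
   continuous and the tracking error differentiable. *)
Lemma partial_run_glue l v Z j : (l <= N)%N -> partial_run l v Z j ->
  exists v' Z' W,
  [/\ forall k, continuous (v' k),
      forall t, mx_is_derive Z' t (Z' t *m (Xr t) ^t* *m generator H v' t *m Xr t),
      Z' 0 = Xinf & forall t, SU (Z' t)] /\
  [/\ forall k t, j%:R * T <= t -> v' k t = sine_gain k t * out H Xr k t (W t),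
      forall t, j%:R * T <= t -> Z' t = Zl M lam N l *m W t,
      forall t, SU (W t) & V (W t) @[t --> +oo] --> (n%:R : R)].
Proof.
move=> lN [vc dZ Z0 sZ dl]; set tau := j%:R * T in vc dl *.
have tau0 : 0 <= tau by rewrite mulr_ge0// ltW.
have sC : SU (Zl M lam N l) by exact: Zl_SU.
(* With this start [Zl W] continues [Z] at [tau]; a constant left factor preserves the form of the
   error equation. *)
have sW0 : SU ((Zl M lam N l) ^t* *m Z tau) by exact: (SU_M (SU_J sC) (sZ tau)).
have [W sW Wt] := sol_exists tau sine_gain_admissible sW0.
have sWt : SU (W tau) by rewrite Wt.
have SW := sol_SU sW sWt.
have VW : V (W t) @[t --> +oo] --> (n%:R : R).
  by apply: (sol_limit sine_gain_admissible sW sWt); rewrite Wt.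
pose C := Zl M lam N l.
pose v' k := glue tau (v k) (fun t => sine_gain k t * out H Xr k t (W t)).
pose Z' := glue tau Z (fun t => C *m W t).
exists v', Z', W; split; last first.
  by split=> [k t tt|t tt|//|//]; rewrite /v' /Z' /glue tt.
have CW : C *m W tau = Z tau by rewrite Wt mulmxA SU_mulJ// mul1mx.
have sg0 k : sine_gain k tau = 0 by exact: sine_gain_switch.
have Z'E t : Z' t = if tau <= t then C *m W t else Z t by [].
split.
- move=> k; apply: glue_continuous.
  + by have [] := vc k.
  + have [G [gc _ _ _]] := sine_gain_admissible.
    by move=> t; apply: cvgM; [exact: gc|exact: (@sol_out_continuous _ _ k sW)].
  + by have [_ ->] := vc k; rewrite sg0 mul0r.
- move=> t; have [tt|tt|tE] := ltgtP t tau.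
  + have e1 : Z' t = Z t by rewrite Z'E leNgt tt.
    have e2 : generator H v' t = generator H v t.
      by apply: eq_bigr => k _; rewrite /v' /glue leNgt tt.
    by rewrite e1 e2; apply: near_mx_is_derive (dZ t); exact: near_glue_l.
  + have e1 : Z' t = C *m W t by rewrite Z'E ltW.
    rewrite e1; apply: (@near_mx_is_derive _ _ (fun t => C *m W t)).
      exact: near_glue_r.
    apply: (sol_mul_der C sW) => k; by rewrite /v' /glue ltW.
  + have gz (w : 'I_m -> R -> R) : (forall k, w k tau = 0) -> generator H w tau = 0.
      by move=> w0; rewrite /generator big1// => k _; rewrite w0; exact: scale0r.
    rewrite tE (gz v'); last by move=> k; rewrite /v' /glue lexx sg0 mul0r.
    rewrite mulmx0 mul0mx; apply: glue_mx_der.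
    * apply: mx_der_eq (dZ tau) _; rewrite (gz v) ?mulmx0 ?mul0mx// => k.
      by have [] := vc k.
    * have hd := @sol_mul_der sine_gain W C (fun k t => sine_gain k t * out H Xr k t (W t)) tau sW.
      apply: mx_der_eq (hd (fun k => erefl)) _.
      by rewrite (gz (fun k t => sine_gain k t * out H Xr k t (W t))) ?mulmx0 ?mul0mx// => k;
        rewrite sg0 mul0r.
    * by rewrite CW.
(* Only [tau = 0] is possible here, and then both pieces start at [Xinf]. *)
- rewrite Z'E; case: ifP => // t0; have tz : tau = 0 by apply/eqP; rewrite eq_le t0.
  by rewrite -{1}tz CW tz.
- by move=> t; rewrite Z'E; case: ifP => _; [exact: (SU_M sC (SW t))|exact: sZ].
Qed.

Lemma partial_run_step l v Z j : (l < N)%N -> partial_run l v Z j ->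
  exists v' Z' j', partial_run l.+1 v' Z' j'.
Proof.
move=> lN pr; have [v' [Z' [W [[cv dZ Z0 sZ] [v'E Z'E SW VW]]]]] := partial_run_glue (ltnW lN) pr.
have [_ /(_ l lN) dl] := fN.
have [t1 ht] := V_mul_near SW VW dl.
(* A multiple of [T] beyond both [j T] and [t1], so that the gain vanishes when the stage ends. *)
pose j' := (j + Num.bound `|t1 / T|)%N.
have jj' : j%:R * T <= j'%:R * T by rewrite ler_pM2r// ler_nat leq_addr.
exists v', Z', j'; split=> //.
- move=> k; split; first exact: cv.
  by rewrite v'E// sine_gain_switch mul0r.
- rewrite (Z'E _ jj') mulmxA; apply: ht.
  rewrite -ler_pdivrMr//; apply: le_trans (ler_norm _) _.
  apply: le_trans (ltW (archi_boundP (normr_ge0 _))) _.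
  by rewrite ler_nat leq_addl.
Qed.

(** The path is followed whatever [V Xinf] is, so there are no cases. The last gluing is at [l = N],
    where [Zl] is 1: from then on the error is [W] itself, which tends to 1. *)
Lemma continuous_steering : exists u : 'I_m -> R -> R,
  (forall k, {within `[0, +oo[, continuous (u k)}) /\ steers H set0 u Xr.
Proof.
have run l : (1 <= l <= N)%N -> exists v Z j, partial_run l v Z j.
  elim: l => // -[_ _|l IH /andP[_ lN]].
    by exists (fun _ _ => 0), (fun=> Xinf), 0%N; exact: partial_run_start.
  have [|v [Z [j pr]]] := IH; first exact: ltnW.
  exact: partial_run_step pr.
have [|v [Z [j pr]]] := run N; first by rewrite N0 leqnn.
have [v' [Z' [W [[cv dZ Z0 sZ] [_ Z'E _ VW]]]]] := partial_run_glue (leqnn N) pr.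
exists (fun k t => uT k t - v' k t); split.
  move=> k; apply: continuous_subspaceT => t.
  by apply: cvgB; [exact: uT_continuous|exact: cv].
have cZ : mx_continuous Z' by move=> t; exact: mx_der_cont (dZ t).
apply: (tracking_steers H_su XrS XrD (s := [::]) (Z := Z') (Z0 := Z')) => //.
- by rewrite Xr_0.
- exact: nearW.
- apply: cvg_trans VW; apply: near_eq_cvg; near=> t.
  have tt : j%:R * T <= t by near: t; apply: nbhs_pinfty_ge; exact: num_real.
  by rewrite Z'E// (ZlN lam uM N0) mul1mx.
Unshelve. all: by end_near. Qed.

End Continuous.

Variable f : 'I_m -> R.
Hypothesis f0 : forall k, 0 < f k ^+ 2.
Let gf := fun (k : 'I_m) (_ : R) => f k ^+ 2.
Let gfA : admissible_gain gf. Proof. exact: const_gain. Qed.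

Lemma aux_outE k t W : f k * aux_a H f Xr k t W = gf k t * out H Xr k t W.
Proof. by rewrite /aux_a /gf /out mulrA. Qed.

Lemma auxE t W : aux H f Xr t W = gaux H gf Xr t W.
Proof.
rewrite gauxE /aux; congr (_ *m _ *m _).
by apply: eq_bigr => k _; rewrite aux_outE.
Qed.

Lemma aux_solves W : solves_line (aux H f Xr) W <-> solves_line (gaux H gf Xr) W.
Proof. by split=> sW t; have := sW t; rewrite auxE. Qed.

(** The closed-loop solution is not obtained from an existence theorem of its own: it is [Xr Z^*]
    for the auxiliary solution [Z]. Uniqueness then carries smoothness and tracking over to every
    closed-loop solution. *)
Lemma closed_loop_steering : delta R n < V Xinf ->
  (exists X, solves_half set0 (closed_loop H f Xr uT) X /\ X 0 = 1%:M) /\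
  (forall X, solves_half set0 (closed_loop H f Xr uT) X -> X 0 = 1%:M ->
     let u := fun k (t : R) => uT k t - f k ^+ 2 * V ((X t) ^t* *m H k *m Xr t) in
     (forall k, smooth_half (u k)) /\ steers H set0 u Xr).
Proof.
move=> dX; have [Z sZ Z0] := sol_exists 0 gfA Xinf_SU.
have sZ0 : SU (Z 0) by rewrite Z0.
have SZ := sol_SU sZ sZ0.
have VZ : V (Z t) @[t --> +oo] --> (n%:R : R) by apply: (sol_limit gfA sZ sZ0); rewrite Z0.
pose v k t := gf k t * out H Xr k t (Z t).
have dZ t : mx_is_derive Z t (Z t *m (Xr t) ^t* *m generator H v t *m Xr t).
  have := @sol_mul_der gf Z 1%:M v t sZ (fun k => erefl); rewrite mul1mx.
  by under eq_fun do rewrite mul1mx.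
pose X t := Xr t *m (Z t) ^t*.
have vE k t : f k ^+ 2 * V ((X t) ^t* *m H k *m Xr t) = v k t.
  by rewrite /v /out /X mxJM trmxCK.
have dXh t : mx_is_derive X t (closed_loop H f Xr uT t (X t)).
  have gE : generator H (fun k s => uT k s - f k ^+ 2 * V ((X t) ^t* *m H k *m Xr s)) t =
      generator H (fun k t => uT k t - v k t) t.
    by apply: eq_bigr => k _; rewrite vE.
  rewrite /closed_loop gE; exact: (tracking_der H_su XrS XrD (dZ t)).
have SX t : SU (X t) by apply: SU_M => //; exact: SU_J.
have cX : mx_continuous X by move=> t; exact: mx_der_cont (dXh t).
have X0 : X 0 = 1%:M by rewrite /X Z0 Xr_0 SU_mulJ.
have stX : steers H set0 (fun k t => uT k t - v k t) Xr.
  apply: (tracking_steers H_su XrS XrD (s := [::]) (Z := Z) (Z0 := Z)) => //.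
  - exact: sol_continuous sZ.
  - by rewrite Xr_0.
  - exact: nearW.
split.
  exists X; split=> //; split=> //; first exact: mx_continuous_halfW.
  by move=> i j; have [d1 d2] := dXh 0 i j; split; exact: is_derive_rderive.
move=> Y sY Y0 u; have [cY dY] := solves_half_extend sY.
have YX t : 0 <= t -> Y t = X t.
  move=> t0; have -> : Y t = Y (Num.max 0 t) by rewrite (max_idPr t0).
  apply: (closed_loop_unique H_su XrS SX (fun t _ => dXh t) cX cY _ _ t0).
    by move=> s s0; exact: dY.
  by rewrite maxxx X0 Y0.
have uE k t : 0 <= t -> u k t = uT k t - v k t.
  by move=> t0; rewrite /u (YX t t0) (vE k t).
split; last by apply: steers_ext stX => k t t0; rewrite uE.
move=> k; exists (fun t => uT k t - v k t); split; last first.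
  by move=> t; rewrite in_itv/= andbT => t0; rewrite uE.
(* [XrT] and [Z] generate together: the equation for [Z] involves [Xr], and the one for [XrT]
   involves only [uT] and [XrT]. *)
pose XX (b : bool) := if b then XrT else Z.
pose S := gbase uT XX.
have gXT : genmx S XrT by exact: (@gbase_X _ _ _ _ uT XX true).
have gZ : genmx S Z by exact: (@gbase_X _ _ _ _ uT XX false).
have gXr : genmx S Xr.
  have -> : Xr = fun t => XrT t *m Xinf by apply/funext.
  by apply: genmxM => //; exact: genmx_cst.
have gO l : gen S (fun t => out H Xr l t (Z t)).
  apply: gen_V; apply: genmxM => //; apply: genmxM; last exact: genmx_cst.
  by apply: genmxM => //; exact: genmxJ.
have gv l : gen S (v l) by apply: genM => //; exact: gen_cst.
have [hu [sX XT0] _ _] := ref.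
have gU : genmx S (generator H uT) by exact: gbase_generator.
apply: (@gen_smooth _ S).
  apply: gbase_derivable; first by move=> l; have [] := hu l.
  case.
    exists (fun t => generator H uT t *m XrT t); first exact: sX.
    exact: genmxM.
  exists (fun t => Z t *m (Xr t) ^t* *m generator H v t *m Xr t); first exact: dZ.
  apply: genmxM => //; apply: genmxM; first by apply: genmxM => //; exact: genmxJ.
  by apply: genmx_sum => l; apply: genmxZ => //; exact: genmx_cst.
apply: genD; first exact: gbase_u.
exact: genN.
Qed.

(** * Algorithm 1 with constant gains *)

Section Algorithm.
Variables (M : 'M[R[i]]_n) (lam : 'I_n -> R) (N : nat).
Hypothesis dM : diagonalizes Xinf M lam.
Hypothesis fN : fine_enough M lam N.
Variables (Ts : nat -> R) (W : nat -> R -> 'M[R[i]]_n).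

Let uM : M \is unitarymx. Proof. by case: dM. Qed.
Let lam0 : \sum_j lam j = 0. Proof. by case: dM. Qed.
Let N0 : (0 < N)%N. Proof. by case: fN. Qed.
Let C l := Zl M lam N l.
Let CS l : SU (C l). Proof. exact: Zl_SU. Qed.
Let CN : C N = 1%:M. Proof. exact: ZlN. Qed.

(** One formula for both cases of [is_stage], since [C N] is 1. *)
Definition stage_init l := (C l) ^t* *m C l.-1 *m W l.-1 (Ts l).

Lemma is_stageE l Wl : (l <= N)%N -> is_stage H f Xr M lam N Ts W l Wl <->
  solves_line (gaux H gf Xr) Wl /\ Wl (Ts l) = stage_init l.
Proof.
move=> lN; rewrite /is_stage aux_solves.
have -> : (if (l < N)%N then (Zl M lam N l) ^t* *m Zl M lam N l.-1 *m W l.-1 (Ts l)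
    else Zl M lam N N.-1 *m W N.-1 (Ts N)) = stage_init l; last by [].
case: ltnP => [_|Nl]; first reflexivity.
have -> : l = N by apply/eqP; rewrite eqn_leq lN.
by rewrite /stage_init CN mxJ1 mul1mx.
Qed.

Lemma run_upto_le L L' : (L' <= L)%N -> run_upto H f Xr M lam N Ts W L ->
  run_upto H f Xr M lam N Ts W L'.
Proof.
move=> LL [T1 W0 h]; split=> // l /andP[l1 lL]; apply: h.
by rewrite l1 (leq_trans lL).
Qed.

(** The condition by which a switching time is chosen is precisely the bound on V for the next
    initial value; for the first stage it comes from [fine_enough]. *)
Lemma stage_initP l : (1 <= l <= N)%N -> run_upto H f Xr M lam N Ts W l.-1 ->
  SU (stage_init l) /\ delta R n < V (stage_init l).
Proof.
elim: l => [//|[_ _ [T1 W0 _]|l IH /andP[_ lN] run]].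
  rewrite /stage_init /= W0 mulmx1; split; first exact: (SU_M (SU_J (CS _)) (CS _)).
  by have [_ h] := fN; exact: h.
have [_ _ h] := run; have [st nx] := h l.+1 (leqnn l.+1).
have [sS dS] := IH (ltnW lN) (run_upto_le (leqnSn l) run).
have [sW Wi] := (is_stageE _ (ltnW lN)).1 st.
have [_ d] := nx lN; split; last exact: d.
apply: (SU_M (SU_M (SU_J (CS _)) (CS _))).
by apply: (sol_SU sW (t0 := Ts l.+1)); rewrite Wi.
Qed.

(** The algorithm never blocks: [W] tends to 1, so the switching condition, which holds with [W]
    replaced by 1, is met eventually. *)
Lemma stage_run l : (1 <= l <= N)%N -> run_upto H f Xr M lam N Ts W l.-1 ->
  (exists Wl, is_stage H f Xr M lam N Ts W l Wl) /\
  (forall Wl, is_stage H f Xr M lam N Ts W l Wl ->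
     (forall t, SU (Wl t)) /\
     ((l < N)%N -> exists t, is_next_time M lam N Ts l Wl t)).
Proof.
move=> l1N run; have [sS dS] := stage_initP l1N run.
have /andP[l1 lN] := l1N.
split.
  have [Wl sW Wi] := sol_exists (Ts l) gfA sS.
  by exists Wl; apply/is_stageE.
move=> Wl /(is_stageE _ lN)[sW Wi].
have sWi : SU (Wl (Ts l)) by rewrite Wi.
have SW := sol_SU sW sWi; split=> // lltN.
have VW : V (Wl t) @[t --> +oo] --> (n%:R : R).
  by apply: (sol_limit gfA sW sWi); rewrite Wi.
have [_ /(_ l lltN) dl] := fN.
have [t1 ht] := V_mul_near SW VW dl.
exists (Num.max t1 (Ts l + 1)); split.
  by rewrite lt_max ltrDl ltr01 orbT.
by apply: ht; rewrite le_max lexx.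
Qed.

Hypothesis run : run_upto H f Xr M lam N Ts W N.

Let T1 : Ts 1%N = 0. Proof. by case: run. Qed.

Let stage l : (1 <= l <= N)%N ->
  [/\ solves_line (gaux H gf Xr) (W l), W l (Ts l) = stage_init l,
      forall t, SU (W l t) & delta R n < V (W l (Ts l))].
Proof.
move=> l1N; have /andP[l1 lN] := l1N; have [_ _ h] := run.
have [st _] := h l l1N.
have run' : run_upto H f Xr M lam N Ts W l.-1.
  by apply: run_upto_le run; exact: leq_trans (leq_pred l) lN.
have [sS dS] := stage_initP l1N run'.
have [sW Wi] := (is_stageE _ lN).1 st.
have sWi : SU (W l (Ts l)) by rewrite Wi.
split; [exact: sW|exact: Wi|exact: (sol_SU sW sWi)|by rewrite Wi].
Qed.

Let Ts_lt l : (1 <= l < N)%N -> Ts l < Ts l.+1.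
Proof.
move=> /andP[l1 lN]; have [_ _ h] := run.
have [|_ /(_ lN)[]//] := h l; by rewrite l1 ltnW.
Qed.

Let Ts_mono a b : (1 <= a <= b)%N -> (b <= N)%N -> Ts a <= Ts b.
Proof.
move=> /andP[a1]; elim: b => [|b IH]; first by rewrite leqn0 => /eqP ->.
rewrite leq_eqVlt => /predU1P[->//|ab] bN; apply: le_trans (IH ab (ltnW bN)) _.
by apply/ltW/Ts_lt; rewrite bN (leq_trans a1).
Qed.

Let v k := glued Ts (fun l t => f k * aux_a H f Xr k t (W l t)) N.
Let Z := glued Ts (fun l t => C l *m W l t) N.

Lemma algorithm_steering : exists v : 'I_m -> R -> R,
  [/\ algorithm_controls H f Xr N Ts W v,
      forall k, piecewise_continuous_half (switching_times N Ts) (v k)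
    & steers H (switching_times N Ts) (fun k t => uT k t - v k t) Xr].
Proof.
have cF k l : (1 <= l <= N)%N -> continuous (fun t => f k * aux_a H f Xr k t (W l t)).
  move=> /stage[sW _ _ _]; under eq_fun do rewrite aux_outE.
  by move=> t; apply: cvgM; [exact: cvg_cst|exact: (@sol_out_continuous _ _ k sW)].
exists v; split.
- move=> k; split=> [l t lN tt|t tt]; first exact: glued_stage.
  exact: (glued_last _ N0 tt).
- by move=> k; apply: (glued_piecewise N0 T1) => l lN; exact: cF.
pose rhs t (w : 'I_m -> R) (A : 'M[R[i]]_n) :=
  A *m (Xr t) ^t* *m (\sum_k (w k)%:C *: H k) *m Xr t.
pose vF (l : nat) t (k : 'I_m) := f k * aux_a H f Xr k t (W l t).
pose ZF (l : nat) t := C l *m W l t.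
have dF l : (1 <= l <= N)%N -> forall t, mx_is_derive (ZF l) t (rhs t (vF l t) (ZF l t)).
  move=> /stage[sW _ _ _] t.
  apply: (@sol_mul_der gf (W l) (C l) (fun k t => f k * aux_a H f Xr k t (W l t)) t sW) => k.
  exact: aux_outE.
have gluedv t : glued Ts vF N t = v^~ t.
  rewrite /v; elim: N => //= L IH; apply/funext => k; rewrite /glue.
  by case: ifP => // _; rewrite IH.
have alg (A B D : 'M[R[i]]_n) : SU A -> A *m (A ^t* *m B *m D) = B *m D.
  by move=> sA; rewrite !mulmxA SU_mulJ// mul1mx.
(* The initial conditions of the stages are made for this: [Z] is continuous although [W] and the
   controls jump. *)
have match_ l : (1 <= l < N)%N -> C l *m W l (Ts l.+1) = C l.+1 *m W l.+1 (Ts l.+1).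
  move=> /andP[l1 lN]; have [|_ -> _ _] := stage (l := l.+1); first by [].
  exact: esym (alg _ _ _ (CS l.+1)).
have cZ : mx_continuous Z.
  apply: glued_mx_continuous => //.
  by move=> l /stage[sW _ _ _] t; exact: mx_cvgM (mx_cvg_cst (C l)) (sol_continuous sW t).
have N1 : (1 <= 1 <= N)%N by [].
have [sW1 W1i _ _] := stage N1.
(* For [N = 1] the first stage is also the last and there is no second switching time to compare
   with. *)
have near0 (A : Type) (F : nat -> R -> A) :
    (\forall t \near 0^'+, F 1%N t = glued Ts F N t) /\ F 1%N 0 = glued Ts F N 0.
  have [N_1|] := leqP N 1.
    have NE : N = 1%N by apply/eqP; rewrite eqn_leq N_1.
    have h t : 0 <= t -> F 1%N t = glued Ts F N t.
      by move=> t0; rewrite NE glued_last// T1.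
    split; last exact: h.
    by near=> t; apply: h; near: t; exact: nbhs_right_ge.
  move=> N_1; have T2 : 0 < Ts 2%N by rewrite -T1; apply: Ts_lt.
  have h t : 0 <= t < Ts 2%N -> F 1%N t = glued Ts F N t.
    by move=> tt; rewrite (@glued_stage R A Ts F N 1%N t)// ?T1.
  split; last by apply: h; rewrite lexx.
  near=> t; apply: h; apply/andP; split; near: t; first exact: nbhs_right_ge.
  exact: nbhs_right_lt.
have Z0 : Z 0 = Xinf.
  apply: (eq_trans (esym (near0 _ (fun l t => C l *m W l t)).2)).
  have [_ W0 _] := run; have [_ _ XE] := dM.
  rewrite -{1}T1 W1i; apply: (eq_trans (alg _ _ _ (CS 1))).
  by rewrite W0 mulmx1 /C Zl0 -XE.
(* [iota 2 N] runs to [N + 1], one too far; the list only has to contain the switching times. *)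
apply: (@tracking_steers _ _ _ _ _ _ H_su XrS XrD (switching_times N Ts)
  [seq Ts l | l <- iota 2 N] v Z (ZF 1%N) _ cZ).
- move=> t [l /andP[l2 lN] ->]; apply: map_f; rewrite mem_iota l2/=.
  by rewrite (leq_ltn_trans lN)// add2n.
- by rewrite Xr_0 Z0.
- move=> t t0 Jt; have := @glued_mx_der _ _ _ Ts ZF vF rhs N N0 T1 dF t t0 Jt.
  by rewrite gluedv.
- apply: (@sol_mul_der gf (W 1%N) (C 1%N) v 0 sW1) => k.
  by rewrite -aux_outE; exact: (esym (near0 _ (fun l t => f k * aux_a H f Xr k t (W l t))).2).
- exact: (near0 _ ZF).2.
- exact: (near0 _ ZF).1.
- move=> t t0; apply: (glued_all (P := SU)) => [|l /stage[_ _ SW _]]; first exact: N0.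
  exact: (SU_M (CS l) (SW t)).
have NN : (1 <= N <= N)%N by rewrite N0 leqnn.
have [sWN _ SWN dN] := stage NN.
have VW := sol_limit gfA sWN (SWN (Ts N)) dN.
apply: cvg_trans VW; apply: near_eq_cvg; near=> t.
have tt : Ts N <= t by near: t; apply: nbhs_pinfty_ge; exact: num_real.
by rewrite /Z (glued_last _ N0 tt) CN mul1mx.
Unshelve. all: by end_near. Qed.

End Algorithm.
End Main.

Theorem theorem2 (R : realType) (n m : nat) (H : 'I_m -> 'M[R[i]]_n)
    (Xinf : 'M[R[i]]_n) (T : R) (f : 'I_m -> R)
    (uT : 'I_m -> R -> R) (XrT : R -> 'M[R[i]]_n) :
  (2 <= n)%N ->
  (forall k, su (H k)) ->
  regular H ->
  SU Xinf ->
  0 < T ->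
  (forall k, 0 < f k ^+ 2) ->
  regular_reference H T uT XrT ->
  let Xr := fun t : R => XrT t *m Xinf in
  [/\ exists u : 'I_m -> R -> R,
        (forall k, {within `[0, +oo[, continuous (u k)}) /\
        steers H set0 u Xr,
      delta R n < V Xinf ->
        (exists X, solves_half set0 (closed_loop H f Xr uT) X /\ X 0 = 1%:M) /\
        (forall X, solves_half set0 (closed_loop H f Xr uT) X ->
           X 0 = 1%:M ->
           let u := fun k (t : R) =>
             uT k t - f k ^+ 2 * V ((X t) ^t* *m H k *m Xr t) in
           (forall k, smooth_half (u k)) /\ steers H set0 u Xr)
    & V Xinf <= delta R n ->
        (exists M lam, diagonalizes Xinf M lam) /\
        (forall M lam, diagonalizes Xinf M lam ->
           (exists N, fine_enough M lam N) /\
           (forall N, fine_enough M lam N ->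
              (forall l Ts W, (1 <= l <= N)%N ->
                 run_upto H f Xr M lam N Ts W l.-1 ->
                 (exists Wl, is_stage H f Xr M lam N Ts W l Wl) /\
                 (forall Wl, is_stage H f Xr M lam N Ts W l Wl ->
                    (forall t, SU (Wl t)) /\
                    ((l < N)%N ->
                       exists t, is_next_time M lam N Ts l Wl t))) /\
              (forall Ts W, run_upto H f Xr M lam N Ts W N ->
                 exists v : 'I_m -> R -> R,
                   [/\ algorithm_controls H f Xr N Ts W v,
                       forall k, piecewise_continuous_half
                                   (switching_times N Ts) (v k)
                     & steers H (switching_times N Ts)
                         (fun k t => uT k t - v k t) Xr])))].
Proof.
move=> n2 H_su _ Xinf_SU T0 f0 ref Xr.
have XrE t : Xr t = XrT t *m Xinf by [].
split.
- have [M [lam dM]] := diagonalizes_exists n2 Xinf_SU.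
  have [uM lam0 _] := dM.
  have [N fN] := fine_enough_exists lam uM n2.
  exact: (continuous_steering n2 H_su Xinf_SU T0 ref XrE dM fN).
- exact: (closed_loop_steering n2 H_su Xinf_SU T0 ref XrE f0).
- move=> _; split; first exact: diagonalizes_exists.
  move=> M lam dM; have [uM lam0 _] := dM; split; first exact: fine_enough_exists.
  move=> N fN; split=> [l Ts W l1N run|Ts W run].
    exact: (stage_run n2 H_su Xinf_SU T0 ref XrE f0 dM fN l1N run).
  exact: (algorithm_steering n2 H_su Xinf_SU T0 ref XrE f0 dM fN run).
Qed.
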